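(* Let $\Omega$ be a measure space, let $1<p<\infty$, let $p'=p/(p-1)$, and let $T\colon L^p(\Omega)\to L^p(\Omega)$ be a power bounded operator. The following assertions are equivalent. (i) $T$ is $R$-Ritt and satisfies the unconditional Ritt condition. (ii) There exists a constant $C>0$ such that $$\Bigl\|\Bigl(\sum_{k=1}^{\infty}k\,\bigl|T^k(x)-T^{k-1}(x)\bigr|^2\Bigr)^{\frac12}\Bigr\|_{p}\leq C\|x\|$$ for every $x\in L^p(\Omega)$, and $$\Bigl\|\Bigl(\sum_{k=1}^{\infty}k\,\bigl|T^{*k}(y)-T^{*(k-1)}(y)\bigr|^2\Bigr)^{\frac12}\Bigr\|_{p'}\leq C\|y\|$$ for every $y\in L^{p'}(\Omega)$.
   Context: $L^p(\Omega)$ denotes the complex $L^p$-space, and $T^*\colon L^{p'}(\Omega)\to L^{p'}(\Omega)$ is the adjoint of $T$ under the identification $L^p(\Omega)^*=L^{p'}(\Omega)$. $T$ is power bounded if $\sup_{n\geq 0}\|T^n\|<\infty$. For a bounded operator $T$ on a complex Banach space $X$, write $R(\lambda,T)=(\lambda-T)^{-1}$. A set $\mathcal{F}$ of bounded operators on $X$ is $R$-bounded if there is a constant $C\geq 0$ such that for every finite family $S_1,\dots,S_n\in\mathcal{F}$ and $x_1,\dots,x_n\in X$, $\mathbb{E}\bigl\|\sum_{j}\varepsilon_j S_jx_j\bigr\|\leq C\,\mathbb{E}\bigl\|\sum_j\varepsilon_jx_j\bigr\|$, where $(\varepsilon_j)$ are independent random variables uniformly distributed on $\{-1,1\}$. $T$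 is a Ritt operator if its spectrum is included in the closed unit disc $\{z\in\mathbb{C}:|z|\le 1\}$ and the set $\{(\lambda-1)R(\lambda,T):|\lambda|>1\}$ is bounded; it is $R$-Ritt if moreover this set is $R$-bounded. $T$ satisfies the unconditional Ritt condition if there is a constant $K\geq 0$ such that $\bigl\|\sum_{k\geq 1}a_k(T^k-T^{k-1})\bigr\|\leq K\sup\{|a_k|:k\geq 1\}$ for every finite sequence $(a_k)_{k\geq 1}$ of complex numbers. *)

(* Defs.v *)
From HB Require Import structures.
From mathcomp Require Import all_boot all_order all_algebra.
From mathcomp Require Import complex.
From mathcomp Require Import all_classical all_reals all_analysis.
From mathcomp Require Import measurable_realfun.

Set Implicit Arguments.
Unset Strict Implicit.
Unset Printing Implicit Defensive.

Import Order.TTheory GRing.Theory Num.Theory.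
Import numFieldNormedType.Exports.
Import Normc.

Local Open Scope classical_set_scope.
Local Open Scope ring_scope.
Local Open Scope complex_scope.

Section Lp_functions.
Context d (Omega : measurableType d) (R : realType).
Variables (mu : {measure set Omega -> \bar R}) (p : R) (p1 : 1 <= p).

(* Borel measurability for the identification of R[i] with R * R. *)
Definition cmeasurable (f : Omega -> R[i]) : Prop :=
  measurable_fun setT (fun w => complex.Re (f w)) /\
  measurable_fun setT (fun w => complex.Im (f w)).

Definition cLnorm (f : Omega -> R[i]) : \bar R :=
  'N[mu]_p%:E[(fun w => (normc (f w))%:E)]%E.

Definition is_Lp (f : Omega -> R[i]) : Prop :=
  cmeasurable f /\ (cLnorm f < +oo)%E.

Lemma cmeasurable_normc f : cmeasurable f ->
  measurable_fun setT (fun w => normc (f w)).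
Proof.
case=> mr mi.
rewrite (_ : (fun w => _) = (fun w =>
  Num.sqrt (complex.Re (f w) ^+ 2 + complex.Im (f w) ^+ 2))); last first.
  by apply/funext => w; case: (f w).
apply: (measurableT_comp (f := @Num.sqrt R)).
  apply: continuous_measurable_fun; exact: sqrt_continuous.
by apply: measurable_funD; apply: measurable_funX.
Qed.

Lemma cmeasurable0 : cmeasurable 0.
Proof. by split; exact: measurable_cst. Qed.

Lemma cmeasurableD f g : cmeasurable f -> cmeasurable g -> cmeasurable (f + g).
Proof.
case=> fr fi [gr gi]; split.
  rewrite (_ : (fun w => _) =
    (fun w => complex.Re (f w)) \+ (fun w => complex.Re (g w))).
    exact: measurable_funD.
  by apply/funext => w /=; rewrite /GRing.add/=; case: (f w) (g w) => [? ?] [].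
rewrite (_ : (fun w => _) =
  (fun w => complex.Im (f w)) \+ (fun w => complex.Im (g w))).
  exact: measurable_funD.
by apply/funext => w /=; rewrite /GRing.add/=; case: (f w) (g w) => [? ?] [].
Qed.

Lemma cmeasurableZ (a : R[i]) f : cmeasurable f ->
  cmeasurable (fun w => a * f w).
Proof.
case=> fr fi; case: a => a b; split.
  rewrite (_ : (fun w => _) = (fun w => a * complex.Re (f w)) \-
      (fun w => b * complex.Im (f w))).
    by apply: measurable_funB; apply: measurable_funM.
  by apply/funext => w /=; case: (f w).
rewrite (_ : (fun w => _) = (fun w => a * complex.Im (f w)) \+
    (fun w => b * complex.Re (f w))).
  by apply: measurable_funD; apply: measurable_funM.
by apply/funext => w /=; case: (f w).
Qed.

Let p0 : 0 < p. Proof. exact: lt_le_trans p1. Qed.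

Lemma cLnormE f :
  cLnorm f = ((\int[mu]_w (normc (f w) `^ p)%:E) `^ p^-1)%E.
Proof.
rewrite /cLnorm unlock /=; congr (_ `^ _)%E; apply: eq_integral => w _.
by rewrite /= ger0_norm//; case: (f w) => a b /=; exact: sqrtr_ge0.
Qed.

Lemma normc_ge0 (z : R[i]) : 0 <= normc z.
Proof. by case: z => a b; exact: sqrtr_ge0. Qed.

Lemma cmeas_pow f : cmeasurable f ->
  measurable_fun setT (fun w => (normc (f w) `^ p)%:E).
Proof.
move=> mf; apply/measurable_EFinP.
apply: (@measurableT_comp _ _ _ _ _ _ (@powR R ^~ p)) => //.
exact: cmeasurable_normc.
Qed.

Lemma eq_ae_cLnorm f g : cmeasurable f -> cmeasurable g ->
  f = g %[ae mu] -> cLnorm f = cLnorm g.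
Proof.
move=> mf mg fg; rewrite !cLnormE; congr (_ `^ _)%E.
apply: ge0_ae_eq_integral => //; try exact: cmeas_pow.
- by move=> w _; rewrite lee_fin powR_ge0.
- by move=> w _; rewrite lee_fin powR_ge0.
- by apply: filterS fg => w /(_ I) -> _.
Qed.

Lemma cLnormD f g : cmeasurable f -> cmeasurable g ->
  (cLnorm (f + g)%R <= cLnorm f + cLnorm g)%E.
Proof.
move=> mf mg; have mfg := cmeasurableD mf mg.
have /= := @minkowski_EFin _ _ _ mu (@normc R \o f) (@normc R \o g) p
  (cmeasurable_normc mf) (cmeasurable_normc mg) p1.
apply: le_trans; rewrite cLnormE unlock.
apply: gt0_ler_poweR; rewrite ?invr_ge0 ?(ltW p0)//.
- rewrite in_itv/= leey andbT.
  by apply: integral_ge0 => w _; rewrite lee_fin powR_ge0.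
- rewrite in_itv/= leey andbT.
  by apply: integral_ge0 => w _; rewrite lee_fin powR_ge0.
apply: ge0_le_integral => //.
- by move=> w _; rewrite lee_fin powR_ge0.
- exact: cmeas_pow.
- apply/measurable_EFinP.
  apply: (@measurableT_comp _ _ _ _ _ _ (@powR R ^~ p)) => //.
  apply: measurableT_comp => //.
  by apply: measurable_funD; exact: cmeasurable_normc.
- move=> w _ /=; rewrite lee_fin ge0_ler_powR ?nnegrE ?normc_ge0 ?(ltW p0)//.
  by rewrite (le_trans (le_normcD _ _))// ler_norm.
Qed.

Lemma cLnormZ (a : R[i]) f : cmeasurable f ->
  cLnorm (fun w => a * f w) = ((normc a)%:E * cLnorm f)%E.
Proof.
move=> mf; rewrite !cLnormE.
under eq_integral do rewrite normcM powRM ?normc_ge0// EFinM.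
rewrite ge0_integralZl//; first last.
- by rewrite lee_fin powR_ge0.
- by move=> w _; rewrite lee_fin powR_ge0.
- exact: cmeas_pow.
rewrite poweRM ?lee_fin ?powR_ge0//; last first.
  by apply: integral_ge0 => w _; rewrite lee_fin powR_ge0.
by rewrite poweR_EFin -powRrM mulfV ?gt_eqF// powRr1 ?normc_ge0.
Qed.

Lemma cLnorm_ge0 f : (0 <= cLnorm f)%E.
Proof. exact: Lnorm_ge0. Qed.

Lemma cLnorm_eq0 f : cmeasurable f -> cLnorm f = 0%E -> f = 0 %[ae mu].
Proof.
move=> mf N0.
have mN : measurable_fun [set: Omega] (fun w => (normc (f w))%:E).
  by apply/measurable_EFinP; exact: cmeasurable_normc.
have p0E : (0 < p%:E)%E by rewrite lte_fin.
have := Lnorm_eq0_eq0 mN p0E N0.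
by apply: filterS => w /(_ I) [] /eq0_normc fw0 _.
Qed.

Lemma cLnorm0 : cLnorm 0 = 0%E.
Proof.
rewrite (_ : 0 = (fun w => 0 * (0 : Omega -> R[i]) w)).
  by rewrite cLnormZ ?normc0 ?mul0e//; exact: cmeasurable0.
by apply/funext => w; rewrite mul0r.
Qed.

End Lp_functions.

Section Lp_fun_type.
Context d (Omega : measurableType d) (R : realType).
Variables (mu : {measure set Omega -> \bar R}) (p : R) (p1 : 1 <= p).

Definition Lp_pred of 1 <= p : {pred Omega -> R[i]} :=
  fun f => `[< is_Lp mu p f >].

Lemma Lp_predP f : reflect (is_Lp mu p f) (f \in Lp_pred p1).
Proof. exact: asboolP. Qed.

Lemma Lp_predZ (a : R[i]) f :
  f \in Lp_pred p1 -> (fun w => a * f w) \in Lp_pred p1.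
Proof.
move=> /Lp_predP[mf ff]; apply/Lp_predP; split; first exact: cmeasurableZ.
by rewrite cLnormZ// lte_mul_pinfty// lee_fin normc_ge0.
Qed.

Lemma Lp_pred_zmod : zmod_closed (Lp_pred p1).
Proof.
split; first by apply/Lp_predP; split;
  [exact: cmeasurable0 | rewrite cLnorm0// ltry].
move=> f g fP /(Lp_predZ (-1)) gP.
suff -> : f - g = f + (fun w => -1 * g w).
  move: fP gP => /Lp_predP[mf ff] /Lp_predP[mg fg].
  apply/Lp_predP; split; first exact: cmeasurableD.
  by rewrite (le_lt_trans (cLnormD mu p1 mf mg))// lte_add_pinfty.
by apply/funext => w; congr (_ + _); rewrite mulN1r.
Qed.

HB.instance Definition _ :=
  GRing.isZmodClosed.Build (Omega -> R[i]) (Lp_pred p1) Lp_pred_zmod.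

Record Lp_fun := LpFun { Lp_val :> Omega -> R[i]; _ : Lp_val \in Lp_pred p1 }.

HB.instance Definition _ := [isSub for Lp_val].
HB.instance Definition _ := [Choice of Lp_fun by <:].
HB.instance Definition _ := [SubChoice_isSubZmodule of Lp_fun by <:].

Lemma Lp_funP (f : Lp_fun) : is_Lp mu p f.
Proof. by apply/Lp_predP; exact: valP. Qed.

Definition Lp_fun_scale (a : R[i]) (f : Lp_fun) : Lp_fun :=
  LpFun (Lp_predZ a (valP f)).

Definition Lp_null : {pred Lp_fun} :=
  fun f => `[< (f : Omega -> R[i]) = 0 %[ae mu] >].

Lemma Lp_null_zmod : zmod_closed Lp_null.
Proof.
split; first by apply/asboolP; apply: aeW.
move=> f g /asboolP f0 /asboolP g0; apply/asboolP.
apply: filterS2 f0 g0 => w /(_ I) fw /(_ I) gw _.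
rewrite (_ : (f - g : Lp_fun) w = (f : Omega -> R[i]) w - (g : Omega -> R[i]) w)//.
by rewrite fw gw subrr.
Qed.

HB.instance Definition _ :=
  GRing.isZmodClosed.Build Lp_fun Lp_null Lp_null_zmod.

End Lp_fun_type.

Section Lp_space.
Context d (Omega : measurableType d) (R : realType).
Variables (mu : {measure set Omega -> \bar R}) (p : R) (p1 : 1 <= p).

Local Open Scope quotient_scope.

Definition Lp_null_closed : zmodClosed (Lp_fun mu p1) := @Lp_null _ _ _ mu p p1.

Definition Lp : Type := Quotient.quot Lp_null_closed.

HB.instance Definition _ := GRing.Zmodule.on Lp.

Definition Lp_rep (x : Lp) : Lp_fun mu p1 := repr (x : Quotient.quot Lp_null_closed).
Definition Lp_class (f : Lp_fun mu p1) : Lp := \pi_(Quotient.quot Lp_null_closed) f.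

Lemma Lp_repK x : Lp_class (Lp_rep x) = x.
Proof. exact: reprK. Qed.

Lemma Lp_classP (f g : Lp_fun mu p1) :
  Lp_class f = Lp_class g <-> (f : Omega -> R[i]) = g %[ae mu].
Proof.
suff E : Lp_class f == Lp_class g = `[< (f : Omega -> R[i]) = g %[ae mu] >].
  split => [/eqP|fg]; first by rewrite E => /asboolP.
  by apply/eqP; rewrite E; apply/asboolP.
rewrite -Quotient.idealrBE; apply/asboolP/asboolP.
  by apply: filterS => w /(_ I) /eqP; rewrite subr_eq0 => /eqP ->.
by apply: filterS => w /(_ I) fg _; apply/eqP; rewrite subr_eq0; apply/eqP.
Qed.

Lemma Lp_rep_class f : (Lp_rep (Lp_class f) : Omega -> R[i]) = f %[ae mu].
Proof. by apply/Lp_classP; rewrite Lp_repK. Qed.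

Lemma Lp_classD f g : Lp_class (f + g) = Lp_class f + Lp_class g.
Proof. exact: (@Quotient.pi_add _ Lp_null_closed). Qed.

Lemma Lp_class0 : Lp_class 0 = 0.
Proof. by apply: (addrI (Lp_class 0)); rewrite -Lp_classD !addr0. Qed.

Definition Lp_scale (a : R[i]) (x : Lp) : Lp :=
  Lp_class (Lp_fun_scale a (Lp_rep x)).

Lemma Lp_classZ a f : Lp_scale a (Lp_class f) = Lp_class (Lp_fun_scale a f).
Proof.
apply/Lp_classP; apply: filterS (Lp_rep_class f) => w /(_ I) fw _ /=.
by rewrite fw.
Qed.

Lemma Lp_repD x y :
  (Lp_rep (x + y) : Omega -> R[i]) = (fun w => Lp_rep x w + Lp_rep y w) %[ae mu].
Proof.
have := Lp_rep_class (Lp_rep x + Lp_rep y).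
by rewrite Lp_classD !Lp_repK.
Qed.

Lemma Lp_scaleA a b x : Lp_scale a (Lp_scale b x) = Lp_scale (a * b) x.
Proof.
rewrite -[x]Lp_repK !Lp_classZ; congr Lp_class; apply/val_inj/funext => w /=.
by rewrite mulrA.
Qed.

Lemma Lp_scale1 : left_id 1 Lp_scale.
Proof.
move=> x; rewrite -[x]Lp_repK !Lp_classZ; congr Lp_class.
by apply/val_inj/funext => w /=; rewrite mul1r.
Qed.

Lemma Lp_scaleDr : right_distributive Lp_scale +%R.
Proof.
move=> a x y; rewrite -[x]Lp_repK -[y]Lp_repK -Lp_classD !Lp_classZ -Lp_classD.
congr Lp_class; apply/val_inj/funext => w /=.
exact: mulrDr.
Qed.

Lemma Lp_scaleDl x : {morph Lp_scale^~ x : a b / a + b}.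
Proof.
move=> a b; rewrite -[x]Lp_repK !Lp_classZ -Lp_classD; congr Lp_class.
by apply/val_inj/funext => w /=; exact: mulrDl.
Qed.

HB.instance Definition _ := GRing.Zmodule_isLmodule.Build R[i] Lp
  Lp_scaleA Lp_scale1 Lp_scaleDr Lp_scaleDl.

Lemma Lp_repZ (a : R[i]) (x : Lp) :
  (Lp_rep (a *: x) : Omega -> R[i]) = (fun w => a * Lp_rep x w) %[ae mu].
Proof. exact: Lp_rep_class. Qed.

Definition Lp_norm (x : Lp) : R := fine (cLnorm mu p (Lp_rep x)).

Lemma Lp_normE x : (Lp_norm x)%:E = cLnorm mu p (Lp_rep x).
Proof.
rewrite /Lp_norm fineK// ge0_fin_numE ?cLnorm_ge0//.
by case: (Lp_funP (Lp_rep x)).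
Qed.

Lemma Lp_rep_meas x : cmeasurable (Lp_rep x).
Proof. by case: (Lp_funP (Lp_rep x)). Qed.

Lemma Lp_normD x y : (Lp_norm (x + y))%:C <= (Lp_norm x)%:C + (Lp_norm y)%:C.
Proof.
rewrite -rmorphD lecR -lee_fin EFinD !Lp_normE.
have mx := Lp_rep_meas x; have my := Lp_rep_meas y.
rewrite (eq_ae_cLnorm p (Lp_rep_meas (x + y)) (cmeasurableD mx my) (Lp_repD x y)).
exact: cLnormD.
Qed.

Lemma Lp_normZ (a : R[i]) x : (Lp_norm (a *: x))%:C = `|a| * (Lp_norm x)%:C.
Proof.
have -> : `|a| = (normc a)%:C by [].
rewrite -rmorphM; congr (_%:C); apply: EFin_inj.
rewrite EFinM !Lp_normE -cLnormZ//; last exact: Lp_rep_meas.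
apply: eq_ae_cLnorm; last exact: Lp_repZ.
- exact: Lp_rep_meas.
- by apply: cmeasurableZ; exact: Lp_rep_meas.
Qed.

Lemma Lp_norm_eq0 x : (Lp_norm x)%:C = 0 -> x = 0.
Proof.
move=> /complexI x0; rewrite -[x]Lp_repK -Lp_class0; apply/Lp_classP.
apply: (cLnorm_eq0 p1); first exact: Lp_rep_meas.
by rewrite -Lp_normE x0.
Qed.

HB.instance Definition _ := Lmodule_isNormed.Build R[i] Lp
  Lp_normD Lp_normZ Lp_norm_eq0.

Lemma Lp_normrE (x : Lp) : `|x| = (fine (cLnorm mu p (Lp_rep x)))%:C.
Proof. by []. Qed.

End Lp_space.

Section Operators.
Context (R : realType) (X : normedModType R[i]).
Implicit Types (S T : X -> X) (F : set (X -> X)).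

(* The norm of X takes its values in the nonnegative reals of R[i]. *)
Definition rnorm (x : X) : R := complex.Re `|x|.

(* The operator norm of S is at most C. *)
Definition opnorm_le (C : R) S : Prop := forall x, rnorm (S x) <= C * rnorm x.

Definition bounded_operator S : Prop := linear S /\ exists C, opnorm_le C S.

Definition power_bounded T : Prop :=
  exists C, forall n, opnorm_le C (iter n T).

Definition is_resolvent T (l : R[i]) S : Prop :=
  [/\ bounded_operator S,
      forall x, S (l *: x - T x) = x &
      forall x, l *: S x - T (S x) = x].

Definition spectrum T : set R[i] :=
  [set l | ~ exists S, is_resolvent T l S].

(* Meaningful only for l outside the spectrum of T; 0 otherwise. *)
Definition resolvent T (l : R[i]) : X -> X :=
  xget (fun=> 0) [set S | is_resolvent T l S].

(* Expectation of the norm of sum_j eps_j x_j for independent uniform signs: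
   (eps_j)_j is uniformly distributed on the 2 ^ n sign patterns. *)
Definition rademacher_mean n (x : 'I_n -> X) : R :=
  (2 ^+ n)^-1 * \sum_(e : {ffun 'I_n -> bool})
    rnorm (\sum_(j < n) ((-1 : R[i]) ^+ e j) *: x j).

Definition R_bounded F : Prop :=
  exists2 C : R, 0 <= C & forall n (S : 'I_n -> X -> X) (x : 'I_n -> X),
    (forall j, F (S j)) ->
    rademacher_mean (fun j => S j (x j)) <= C * rademacher_mean x.

Definition Ritt_set T : set (X -> X) :=
  [set S | exists2 l : R[i], 1 < normc l &
           S = fun x => (l - 1) *: resolvent T l x].

Definition Ritt T : Prop :=
  spectrum T `<=` [set l | normc l <= 1] /\
  exists C, forall S, Ritt_set T S -> opnorm_le C S.

Definition R_Ritt T : Prop := Ritt T /\ R_bounded (Ritt_set T).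

Definition unconditional_Ritt T : Prop :=
  exists2 K : R, 0 <= K & forall n (a : nat -> R[i]),
    opnorm_le (K * \big[Num.max/0]_(1 <= k < n.+1) normc (a k))
      (fun x => \sum_(1 <= k < n.+1) a k *: (iter k T x - iter k.-1 T x)).

End Operators.

Section Lp_operators.
Context d (Omega : measurableType d) (R : realType).
Variable mu : {measure set Omega -> \bar R}.

Definition cintegral (f : Omega -> R[i]) : R[i] :=
  Rintegral mu setT (fun w => complex.Re (f w)) +i*
  Rintegral mu setT (fun w => complex.Im (f w)).

Definition conj_exponent (p : R) : R := p / (p - 1).

Lemma conj_exponent_ge1 (p : R) : 1 < p -> 1 <= conj_exponent p.
Proof.
by move=> p1; rewrite /conj_exponent ler_pdivlMr ?subr_gt0// mul1r gerBl.
Qed.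

(* The bilinear pairing which identifies L^q with the dual of L^p when
   1/p + 1/q = 1. *)
Definition Lp_pairing (p q : R) (p1 : 1 <= p) (q1 : 1 <= q)
    (x : Lp mu p1) (y : Lp mu q1) : R[i] :=
  cintegral (fun w => Lp_rep x w * Lp_rep y w).

(* T^* y is the element of L^q that represents the functional x |-> <T x, y>;
   for conjugate exponents 1 < p, q and bounded T it exists and is unique. *)
Definition adjoint (p q : R) (p1 : 1 <= p) (q1 : 1 <= q)
    (T : Lp mu p1 -> Lp mu p1) (y : Lp mu q1) : Lp mu q1 :=
  xget 0 [set z | forall x, Lp_pairing (T x) y = Lp_pairing x z].

Definition square_function (p : R) (p1 : 1 <= p) (T : Lp mu p1 -> Lp mu p1)
    (x : Lp mu p1) (w : Omega) : \bar R :=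
  ((\sum_(1 <= k <oo)
      (k%:R * normc (Lp_rep (iter k T x - iter k.-1 T x) w) ^+ 2)%:E)
    `^ 2^-1)%E.

Definition square_function_estimate (p : R) (p1 : 1 <= p) (C : R)
    (T : Lp mu p1 -> Lp mu p1) : Prop :=
  forall x, ('N[mu]_p%:E[square_function T x] <= (C * rnorm x)%:E)%E.

End Lp_operators.

Arguments adjoint {d Omega R mu p q p1} q1 T y.

(* Main.v *)
(* Write D = T - 1. By Khintchine's inequality, R-boundedness on Lp is the same
   as boundedness on families measured by || (sum_i |x_i|^2)^(1/2) ||_p, so all
   estimates are made on finite families in this norm.

   From (i) to (ii): averaging l^(n+3) R(l, T)^3 over the circle |l| = exp (1/(n+1))
   shows that {T^n} and {(n+1) T^n D} are R-bounded. The unconditional condition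
   bounds the square function of the dyadic blocks P_j = T^(2^j/2) - T^(2^j), and
   1 = sum_j P_j h_j P_j + (remainder) with h_j bounded combinations of powers of
   T. Since k T^(k-1) D P_j is R-bounded with constant of order
   min (2^j/k, k/2^j), Schur's test gives the square function estimate. These
   hypotheses dualize, so the same holds for the adjoint of T.

   From (ii) to (i): k T^(k-1) D^2 splits as a product of sqrt (a+1) T^a D and
   sqrt (b+1) T^b D with a + b = k - 1. Moving one factor to the adjoint and
   using Cauchy-Schwarz bounds sum_k A_k T^(k-1) D^2 uniformly for |A_k| <= k;
   Abel summation then yields the unconditional condition, and, applied to the
   Neumann series of (l - 1) R(l, T), the R-Ritt condition. *)

Require Import Defs.
From mathcomp Require Import all_boot all_order all_algebra.
From mathcomp Require Import cyclic separable cyclotomic complex.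
From mathcomp Require Import all_classical all_reals all_analysis.
From mathcomp Require Import measurable_realfun.
From mathcomp Require Import ring lra zify.

Set Implicit Arguments.
Unset Strict Implicit.
Unset Printing Implicit Defensive.

Import Order.TTheory GRing.Theory Num.Theory.
Import numFieldNormedType.Exports.
Import Normc.

Local Open Scope classical_set_scope.
Local Open Scope ring_scope.

(** * Khintchine inequalities *)

(** The measure need not be sigma-finite, so the Riesz representation, on which the value of
    [adjoint] rests, is not drawn from densities: a functional is represented through the minimizer
    of a uniformly convex functional on [Lp].

    The cube of the resolvent makes elementary averaging sufficient. Its n-th coefficient is of
    order n^2. On a circle at distance about 1/n from the unit circle the mean of |l - 1|^-2 is of
    order n by Parseval, hence that of |l - 1|^-3 is at most of order n^2. For R(l, T) itself the
    mean of |l - 1|^-1 would cost a logarithm.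

    In the reproducing formula each block P_j occurs twice because it has two tasks: one copy is
    controlled by the unconditional condition, the other gives the decay when k is far from 2^j.

    In the converse direction D^2 is needed since T and its adjoint each take one factor D. Abel
    summation reaches D from D^2 at the price of a boundary term n T^n D, which the same estimate
    controls, with coefficients A_k = k. *)

Section FiniteSums.
Context (R : realType).

(** Lagrange's identity: the defect is half a double sum of squares. *)
Lemma cauchy_schwarz_sum (I : finType) (a b : I -> R) :
  (\sum_i a i * b i) ^+ 2 <= (\sum_i a i ^+ 2) * (\sum_i b i ^+ 2).
Proof.
rewrite -subr_ge0.
have -> : (\sum_i a i ^+ 2) * (\sum_i b i ^+ 2) - (\sum_i a i * b i) ^+ 2 =
  2^-1 * \sum_i \sum_j (a i * b j - a j * b i) ^+ 2.
  have -> : \sum_i \sum_j (a i * b j - a j * b i) ^+ 2 =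
    \sum_i \sum_j (a i ^+ 2 * b j ^+ 2) + \sum_i \sum_j (b i ^+ 2 * a j ^+ 2)
     - 2 * \sum_i \sum_j ((a i * b i) * (a j * b j)).
    rewrite -big_split mulr_sumr -sumrB; apply: eq_bigr => i _ /=.
    rewrite -big_split mulr_sumr -sumrB; apply: eq_bigr => j _ /=; ring.
  by rewrite -!big_distrlr /=; field.
apply: mulr_ge0 => //; apply: sumr_ge0 => i _; apply: sumr_ge0 => j _.
exact: sqr_ge0.
Qed.

(** Splitting off the last sign is the step of the inductions on the number of signs. *)
Lemma sum_ffunS n (F : {ffun 'I_n.+1 -> bool} -> R) :
  \sum_e F e = \sum_(e : {ffun 'I_n -> bool}) \sum_(b : bool)
    F [ffun i => if unlift ord_max i is Some j then e j else b].
Proof.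
rewrite pair_big_dep /=.
rewrite (reindex (fun u : {ffun 'I_n -> bool} * bool =>
  [ffun i => if unlift ord_max i is Some j then u.1 j else u.2])) //=.
exists (fun f : {ffun 'I_n.+1 -> bool} =>
   ([ffun i : 'I_n => f (lift ord_max i)], f ord_max)) => [[e b] _|f _] /=.
  congr pair; last by rewrite ffunE unlift_none.
  by apply/ffunP => i; rewrite !ffunE liftK.
by apply/ffunP => i; rewrite !ffunE; case: unliftP => [j ->|->//]; rewrite ffunE.
Qed.

Lemma signed_sum_ffunS n (K : Type) (v : 'I_n.+1 -> K -> R)
    (e : {ffun 'I_n -> bool}) b k :
  \sum_(j < n.+1) (-1) ^+
     ([ffun i => if unlift ord_max i is Some j then e j else b] j) * v j k =
  \sum_(j < n) (-1) ^+ (e j) * v (lift ord_max j) k + (-1) ^+ b * v ord_max k.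
Proof.
rewrite big_ord_recr /=; congr (_ + _); last by rewrite ffunE unlift_none.
apply: eq_bigr => j _.
have -> : widen_ord (leqnSn n) j = lift ord_max j.
  by apply/val_inj; rewrite /= /bump leqNgt ltn_ord.
by rewrite ffunE liftK.
Qed.

Let nsq (K : finType) (a : K -> R) := \sum_k a k ^+ 2.

(** Summing over the last sign cancels its cross term with the other vectors. *)
Lemma rademacher_second_moment n (K : finType) (v : 'I_n -> K -> R) :
  \sum_(e : {ffun 'I_n -> bool}) nsq (fun k => \sum_(j < n) (-1) ^+ (e j) * v j k)
  = 2 ^+ n * \sum_(j < n) nsq (v j).
Proof.
elim: n v => [|n IH] v.
  rewrite big_ord0 mulr0; apply: big1 => e _; apply: big1 => k _.
  by rewrite big_ord0 expr0n.
rewrite sum_ffunS big_ord_recr /= exprS mulrDr.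
transitivity (\sum_(e : {ffun 'I_n -> bool})
  (2 * nsq (fun k => \sum_(j < n) (-1) ^+ (e j) * v (lift ord_max j) k) +
   2 * nsq (v ord_max))).
  apply: eq_bigr => e _; rewrite big_bool /nsq -big_split /= !mulr_sumr -big_split.
  apply: eq_bigr => k _; rewrite !signed_sum_ffunS /= expr1 expr0.
  set s := \sum_(j < n) _; ring.
rewrite big_split /= -mulr_sumr IH sumr_const card_ffun card_bool card_ord.
rewrite -[X in _ + X = _]mulr_natr natrX.
under [X in _ = _ * X + _]eq_bigr => i _.
  have -> : widen_ord (leqnSn n) i = lift ord_max i.
    by apply/val_inj; rewrite /= /bump leqNgt ltn_ord.
  over.
by rewrite mulrA; congr (_ + _); rewrite mulrAC.
Qed.

Lemma rademacher_fourth_moment n (K : finType) (v : 'I_n -> K -> R) :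
  \sum_(e : {ffun 'I_n -> bool})
     nsq (fun k => \sum_(j < n) (-1) ^+ (e j) * v j k) ^+ 2
  <= 2 ^+ n * (3 * (\sum_(j < n) nsq (v j)) ^+ 2).
Proof.
elim: n v => [|n IH] v.
  rewrite big_ord0 expr0n mulr0 mulr0 big1// => e _; rewrite [nsq _]big1 ?expr0n//.
  by move=> k _; rewrite big_ord0 expr0n.
pose u j := v (lift ord_max j).
pose s := \sum_(j < n) nsq (u j).
pose b := nsq (v ord_max).
have -> : \sum_(j < n.+1) nsq (v j) = s + b.
  rewrite big_ord_recr /=; congr (_ + _); apply: eq_bigr => i _.
  by rewrite /u; congr (nsq (v _)); apply/val_inj; rewrite /= /bump leqNgt ltn_ord.
have b0 : 0 <= b by apply: sumr_ge0 => k _; exact: sqr_ge0.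
rewrite sum_ffunS.
(* With X the square norm of the first n terms and z their inner product with the last vector, the
   two signs give 2 (X + b)^2 + 8 z^2, and z^2 <= X b by Cauchy-Schwarz. *)
apply: (@le_trans _ _ (\sum_(e : {ffun 'I_n -> bool})
  (2 * nsq (fun k => \sum_(j < n) (-1) ^+ (e j) * u j k) ^+ 2 +
   12 * b * nsq (fun k => \sum_(j < n) (-1) ^+ (e j) * u j k) + 2 * b ^+ 2))).
  apply: ler_sum => e _; rewrite big_bool /=.
  pose S k := \sum_(j < n) (-1) ^+ (e j) * u j k.
  have E c : nsq (fun k => \sum_(j < n.+1) (-1) ^+
     ([ffun i => if unlift ord_max i is Some j then e j else c] j) * v j k) =
     nsq S + 2 * (-1) ^+ c * (\sum_k S k * v ord_max k) + b.
    rewrite /nsq mulr_sumr -!big_split; apply: eq_bigr => k _ /=.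
    rewrite signed_sum_ffunS -/(u _ _) -/(S k) /=.
    by case: c => /=; rewrite ?expr1 ?expr0; ring.
  rewrite !E expr1 expr0 -/(S _).
  have := @cauchy_schwarz_sum K S (v ord_max); rewrite -/(nsq _) -/(nsq _) -/b.
  set z := \sum_k _; move=> H; rewrite -/S; nra.
rewrite !big_split /= -!mulr_sumr rademacher_second_moment -/s.
rewrite sumr_const card_ffun card_bool card_ord -[b *+ _]mulr_natr natrX exprS.
have := IH u; rewrite -/s => H.
have h2 : 0 <= 2 ^+ n :> R by rewrite exprn_ge0.
nra.
Qed.

(* The minorant t - 4/27 t ^ 3 <= 1 turns a bound on the fourth moment into a
   lower bound on the first one. *)
Lemma hilbert_khintchine n (K : finType) (v : 'I_n -> K -> R) :
  Num.sqrt (\sum_(j < n) \sum_k v j k ^+ 2) <=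
  2 * ((2 ^+ n)^-1 * \sum_(e : {ffun 'I_n -> bool})
     Num.sqrt (\sum_k (\sum_(j < n) (-1) ^+ (e j) * v j k) ^+ 2)).
Proof.
pose X (e : {ffun 'I_n -> bool}) := nsq (fun k => \sum_(j < n) (-1) ^+ (e j) * v j k).
have X0 e : 0 <= X e by apply: sumr_ge0 => k _; exact: sqr_ge0.
set s := \sum_(j < n) _.
have s0 : 0 <= s by apply: sumr_ge0 => i _; apply: sumr_ge0 => k _; exact: sqr_ge0.
have [->|sN0] := eqVneq s 0.
  by rewrite sqrtr0 !mulr_ge0// ?invr_ge0 ?exprn_ge0// sumr_ge0// => e _; exact: sqrtr_ge0.
pose r := Num.sqrt s.
have rr : r ^+ 2 = s by rewrite sqr_sqrtr.
have r0 : 0 < r by rewrite sqrtr_gt0 lt_neqAle eq_sym sN0.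
have e2 : \sum_e X e = 2 ^+ n * s by exact: rademacher_second_moment.
have e4 : \sum_e X e ^+ 2 <= 2 ^+ n * (3 * s ^+ 2) by exact: rademacher_fourth_moment.
have pt e : X e / r - 4 / 27 * X e ^+ 2 / r ^+ 3 <= Num.sqrt (X e).
  set t := Num.sqrt (X e).
  have tt : X e = t ^+ 2 by rewrite sqr_sqrtr.
  have t0 : 0 <= t by exact: sqrtr_ge0.
  rewrite tt.
  have -> : t ^+ 2 / r - 4 / 27 * t ^+ 2 ^+ 2 / r ^+ 3 =
    t * (t / r - 4 / 27 * (t / r) ^+ 3) by field; rewrite gt_eqF.
  have [->|tN0] := eqVneq t 0; first by rewrite mul0r.
  rewrite ger_pMr ?lt_neqAle 1?eq_sym ?tN0//.
  set y := t / r; have y0 : 0 <= y by rewrite divr_ge0// ltW.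
  rewrite -subr_ge0.
  have -> : 1 - (y - 4 / 27 * y ^+ 3) = (2 * y - 3) ^+ 2 * (y + 3) / 27 by field.
  by rewrite divr_ge0// mulr_ge0 ?sqr_ge0// addr_ge0.
have h2 : 0 < 2 ^+ n :> R by rewrite exprn_gt0.
have : \sum_e (X e / r - 4 / 27 * X e ^+ 2 / r ^+ 3) <= \sum_e Num.sqrt (X e).
  by apply: ler_sum.
rewrite sumrB -mulr_suml e2.
have -> : \sum_e 4 / 27 * X e ^+ 2 / r ^+ 3 = 4 / 27 / r ^+ 3 * \sum_e X e ^+ 2.
  by rewrite mulr_sumr; apply: eq_bigr => e _; rewrite mulrAC.
move=> H.
have : 4 / 27 / r ^+ 3 * \sum_e X e ^+ 2 <= 4 / 27 / r ^+ 3 * (2 ^+ n * (3 * s ^+ 2)).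
  by rewrite ler_wpM2l// divr_ge0// exprn_ge0// ltW.
have -> : 4 / 27 / r ^+ 3 * (2 ^+ n * (3 * s ^+ 2)) = 4 / 9 * (2 ^+ n * r).
  by rewrite -rr; field; rewrite gt_eqF.
have E : 2 ^+ n * s / r = 2 ^+ n * r by rewrite -rr; field; rewrite gt_eqF.
rewrite E in H; move=> H2.
(* The two moments leave (1 - 4/9) r = 5/9 r as a lower bound for the mean, whence the constant
   2. *)
rewrite -/r mulrCA ler_pdivlMl//.
change (2 ^+ n * r <= 2 * \sum_e Num.sqrt (X e)).
have q0 : 0 <= 2 ^+ n * r by rewrite mulr_ge0 ?(ltW h2) ?(ltW r0).
set w := \sum_e Num.sqrt (X e) in H *; set q := 2 ^+ n * r in H H2 q0 *; lra.
Qed.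

End FiniteSums.

Section Complex.
Context (R : realType).
Implicit Types (z : R[i]).

Lemma sqr_normcE z : normc z ^+ 2 = complex.Re z ^+ 2 + complex.Im z ^+ 2.
Proof. by case: z => a b /=; rewrite sqr_sqrtr// addr_ge0 ?sqr_ge0. Qed.

Lemma ReD z1 z2 : complex.Re (z1 + z2) = complex.Re z1 + complex.Re z2.
Proof. by case: z1 z2 => ? ? []. Qed.

Lemma ImD z1 z2 : complex.Im (z1 + z2) = complex.Im z1 + complex.Im z2.
Proof. by case: z1 z2 => ? ? []. Qed.

Lemma Re_sum (I : Type) (r : seq I) (P : pred I) (F : I -> R[i]) :
  complex.Re (\sum_(i <- r | P i) F i) = \sum_(i <- r | P i) complex.Re (F i).
Proof. by apply: (big_morph _ ReD). Qed.

Lemma Im_sum (I : Type) (r : seq I) (P : pred I) (F : I -> R[i]) :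
  complex.Im (\sum_(i <- r | P i) F i) = \sum_(i <- r | P i) complex.Im (F i).
Proof. by apply: (big_morph _ ImD). Qed.

Lemma Re_signM (b : bool) z : complex.Re ((-1) ^+ b * z) = (-1) ^+ b * complex.Re z.
Proof. by case: b; rewrite ?expr1 ?expr0 ?mulN1r ?mul1r; case: z. Qed.

Lemma Im_signM (b : bool) z : complex.Im ((-1) ^+ b * z) = (-1) ^+ b * complex.Im z.
Proof. by case: b; rewrite ?expr1 ?expr0 ?mulN1r ?mul1r; case: z. Qed.

Lemma normc_le_ReIm z : normc z <= `|complex.Re z| + `|complex.Im z|.
Proof.
rewrite -ler_sqr ?nnegrE ?normc_ge0 ?addr_ge0// sqr_normcE.
rewrite -[complex.Re z ^+ 2]real_normK ?num_real//.
rewrite -[complex.Im z ^+ 2]real_normK ?num_real//.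
have := normr_ge0 (complex.Re z); have := normr_ge0 (complex.Im z); nra.
Qed.

Lemma normr_Re_le z : `|complex.Re z| <= normc z.
Proof.
rewrite -ler_sqr ?nnegrE ?normc_ge0// sqr_normcE real_normK ?num_real//.
by rewrite lerDl sqr_ge0.
Qed.

Lemma normr_Im_le z : `|complex.Im z| <= normc z.
Proof.
rewrite -ler_sqr ?nnegrE ?normc_ge0// sqr_normcE real_normK ?num_real//.
by rewrite lerDr sqr_ge0.
Qed.

Lemma normc_sum (I : Type) (r : seq I) (P : pred I) (F : I -> R[i]) :
  normc (\sum_(i <- r | P i) F i) <= \sum_(i <- r | P i) normc (F i).
Proof.
elim/big_rec2: _ => [|i x y _ H]; first by rewrite normc0.
by rewrite (le_trans (le_normcD _ _))// lerD2l.
Qed.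

Lemma normc_real (x : R) : normc (x%:C)%C = `|x|.
Proof. by rewrite /= expr0n addr0 sqrtr_sqr. Qed.

Lemma normc_conj z : normc (z^*)%C = normc z.
Proof. by case: z => a b /=; rewrite sqrrN. Qed.

Lemma normcX z n : normc (z ^+ n) = normc z ^+ n.
Proof. by elim: n => [|n IH]; rewrite ?expr0 ?normc1// !exprS normcM IH. Qed.

End Complex.

Section Khintchine.
Context (R : realType).

(** Raise t / p <= exp (t / p) to the power [p]. *)
Lemma powR_le_expR (p t : R) : 0 < p -> 0 <= t -> t `^ p <= p `^ p * expR t.
Proof.
move=> p0 t0.
have -> : expR t = expR (t / p) `^ p by rewrite -expRM divfK// gt_eqF.
rewrite -powRM ?expR_ge0 ?(ltW p0)//.
rewrite ge0_ler_powR ?nnegrE ?(ltW p0)// ?mulr_ge0 ?expR_ge0 ?(ltW p0)//.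
rewrite mulrC -ler_pdivrMr//.
by apply: le_trans (expR_ge1Dx _); rewrite lerDr.
Qed.


Lemma expR_le_inv (x : R) : x < 1 -> expR x <= (1 - x)^-1.
Proof.
move=> x1; rewrite -[x in expR x]opprK expRN lef_pV2 ?posrE ?expR_gt0 ?subr_gt0//.
exact: expR_ge1Dx.
Qed.

(** The optimal exponent is a^2 / 2. The weaker 3/2 a^2 on |a| <= 1 follows from exp x <= (1 -
    x/2)^-2 alone, and a finite subgaussian constant is all that is required. *)
Lemma cosh_bound (a : R) : `|a| <= 1 ->
  expR a + expR (- a) <= 2 * expR (3 / 2 * a ^+ 2).
Proof.
rewrite ler_norml => /andP[a1 a2].
have h (x : R) : x <= 1 -> expR x <= ((1 - x / 2)^-1) ^+ 2.
  move=> x1; rewrite [x in leLHS](_ : x = 2%:R * (x / 2)); last by field.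
  rewrite expRM_natl ler_sqr ?nnegrE ?expR_ge0 ?invr_ge0//; last by lra.
  by apply: expR_le_inv; lra.
apply: (@le_trans _ _ (2 * (1 + 3 / 2 * a ^+ 2))); last first.
  by rewrite ler_pM2l// expR_ge1Dx.
apply: (le_trans (lerD (h _ a2) (h (- a) _))); first by lra.
have u : 0 < 1 - a / 2 by lra.
have v : 0 < 1 + a / 2 by lra.
have -> : 1 - - a / 2 = 1 + a / 2 by lra.
pose b := a ^+ 2 / 4.
have b0 : 0 <= b by rewrite divr_ge0 ?sqr_ge0.
have b1 : b <= 1 / 4 by rewrite /b ler_pM2r ?invr_gt0//; nra.
have -> : (1 - a / 2)^-1 ^+ 2 + (1 + a / 2)^-1 ^+ 2 =
   2 * (1 + b) / ((1 - a / 2) * (1 + a / 2)) ^+ 2.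
  by rewrite /b; field; rewrite !gt_eqF//; lra.
have -> : (1 - a / 2) * (1 + a / 2) = 1 - b by rewrite /b; field.
have -> : 3 / 2 * a ^+ 2 = 6 * b by rewrite /b; field.
rewrite ler_pdivrMr; last by rewrite exprn_gt0//; lra.
have b3 : 0 <= b ^+ 3 by rewrite exprn_ge0.
nra.
Qed.

Lemma rademacher_exp_moment n (a : 'I_n -> R) : \sum_j a j ^+ 2 <= 1 ->
  \sum_(e : {ffun 'I_n -> bool}) expR (\sum_j (-1) ^+ (e j) * a j)
    <= 2 ^+ n * expR (3 / 2).
Proof.
move=> a1.
have aj j : `|a j| <= 1.
  rewrite -(@ler_pXn2r _ 2)// ?nnegrE// expr1n real_normK ?num_real//.
  apply: le_trans a1; rewrite (bigD1 j)//= lerDl.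
  by apply: sumr_ge0 => i _; exact: sqr_ge0.
under eq_bigr => e _ do rewrite expR_sum.
(* Independence of the signs: the sum over sign patterns of a product is the product of the sums
   over single signs. *)
rewrite -(bigA_distr_bigA (fun j (b : bool) => expR ((-1) ^+ b * a j))) /=.
apply: (@le_trans _ _ (\prod_(j < n) (2 * expR (3 / 2 * a j ^+ 2)))).
  apply: ler_prod => j _; rewrite big_bool /= expr1 expr0 mulN1r mul1r.
  by rewrite addr_ge0 ?expR_ge0//= addrC cosh_bound.
rewrite big_split /= prodr_const card_ord -expR_sum ler_pM2l ?exprn_gt0//.
rewrite ler_expR -mulr_sumr.
by rewrite -[leRHS]mulr1 ler_pM2l// divr_gt0.
Qed.

(** Compare |S/s|^p with exp (S/s) + exp (- S/s). Here [s] is only an upper bound for the l2 norm,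
    so that the real and imaginary parts of a complex family can share it. *)
Lemma real_khintchine_upper n (a : 'I_n -> R) (p s : R) : 0 < p -> 0 < s ->
  \sum_j a j ^+ 2 <= s ^+ 2 ->
  \sum_(e : {ffun 'I_n -> bool}) `|\sum_j (-1) ^+ (e j) * a j| `^ p
    <= 2 ^+ n * (2 * p `^ p * expR (3 / 2) * s `^ p).
Proof.
move=> p0 s0 sa.
have H (c : R) : c ^+ 2 = 1 -> \sum_(j < n) (c * a j / s) ^+ 2 <= 1.
  move=> c1; under eq_bigr do rewrite exprMn exprMn c1 mul1r.
  by rewrite -mulr_suml exprVn ler_pdivrMr ?exprn_gt0// mul1r.
have H1 := rademacher_exp_moment (H 1 (expr1n _ _)).
have H2 := rademacher_exp_moment (H (-1) (sqrr_sign _ 1)).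
pose S (e : {ffun 'I_n -> bool}) := \sum_j (-1) ^+ (e j) * a j.
have E (c : R) (e : {ffun 'I_n -> bool}) : \sum_j (-1) ^+ (e j) * (c * a j / s) = c * (S e / s).
  rewrite /S mulr_suml mulr_sumr; apply: eq_bigr => j _; ring.
move: H1 H2; under eq_bigr do rewrite E mul1r; under [X in _ -> X <= _ -> _]eq_bigr do rewrite E mulN1r.
move=> H1 H2.
apply: (@le_trans _ _ (\sum_(e : {ffun 'I_n -> bool})
   (s `^ p * p `^ p) * (expR (S e / s) + expR (- (S e / s))))).
  apply: ler_sum => e _.
  rewrite -/(S e) -[`|S e|](divfK (lt0r_neq0 s0)) mulrC powRM ?divr_ge0 ?(ltW s0)//.
  rewrite -mulrA ler_wpM2l ?powR_ge0//.
  rewrite (le_trans (powR_le_expR p0 _)) ?divr_ge0 ?(ltW s0)//.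
  rewrite ler_wpM2l ?powR_ge0//.
  have -> : `|S e| / s = `|S e / s| by rewrite normrM normfV [`|s|]gtr0_norm.
  by case: (ger0P (S e / s)) => _; rewrite ?lerDl ?lerDr expR_ge0.
rewrite -mulr_sumr big_split /=.
have -> : 2 ^+ n * (2 * p `^ p * expR (3 / 2) * s `^ p) =
  (s `^ p * p `^ p) * (2 ^+ n * expR (3 / 2) + 2 ^+ n * expR (3 / 2)) by ring.
by rewrite ler_wpM2l ?mulr_ge0 ?powR_ge0// lerD.
Qed.

Lemma powR_addr_le (p x y : R) : 0 <= p -> 0 <= x -> 0 <= y ->
  (x + y) `^ p <= 2 `^ p * (x `^ p + y `^ p).
Proof.
move=> p0; wlog xy : x y / x <= y => [H x0 y0|x0 y0].
  have [xy|/ltW xy] := leP x y; first exact: H.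
  by rewrite addrC [_ `^ _ + _]addrC H.
apply: (@le_trans _ _ ((2 * y) `^ p)).
  by rewrite ge0_ler_powR ?nnegrE ?addr_ge0 ?mulr_ge0//; lra.
by rewrite powRM// ler_wpM2l ?powR_ge0// lerDr powR_ge0.
Qed.

Lemma khintchine_upper (p : R) : 0 < p -> exists2 C : R, 0 < C &
  forall n (z : 'I_n -> R[i]),
  \sum_(e : {ffun 'I_n -> bool}) normc (\sum_j (-1) ^+ (e j) * z j) `^ p
    <= 2 ^+ n * (C * Num.sqrt (\sum_j normc (z j) ^+ 2) `^ p).
Proof.
move=> p0; exists (2 `^ p * 2 * (2 * p `^ p * expR (3 / 2))).
  by rewrite !mulr_gt0 ?powR_gt0 ?expR_gt0.
move=> n z; set s := Num.sqrt _.
have S0 : 0 <= \sum_j normc (z j) ^+ 2 by apply: sumr_ge0 => j _; exact: sqr_ge0.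
have [s0|sN0] := eqVneq s 0.
  have z0 j : z j = 0.
    apply: eq0_normc; apply/eqP; rewrite -sqrf_eq0; move/eqP: s0.
    rewrite sqrtr_eq0 => s0; rewrite eq_le sqr_ge0 andbT (le_trans _ s0)//.
    by rewrite (bigD1 j)//= lerDl; apply: sumr_ge0 => i _; exact: sqr_ge0.
  rewrite big1 ?mulr_ge0 ?exprn_ge0 ?powR_ge0 ?expR_ge0// => e _.
  rewrite big1 ?normc0 ?powR0 ?gt_eqF// => j _; by rewrite z0 mulr0.
have s0 : 0 < s by rewrite lt_neqAle eq_sym sN0 sqrtr_ge0.
have hre : \sum_j complex.Re (z j) ^+ 2 <= s ^+ 2.
  by rewrite sqr_sqrtr//; apply: ler_sum => j _; rewrite sqr_normcE lerDl sqr_ge0.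
have him : \sum_j complex.Im (z j) ^+ 2 <= s ^+ 2.
  by rewrite sqr_sqrtr//; apply: ler_sum => j _; rewrite sqr_normcE lerDr sqr_ge0.
have H1 := real_khintchine_upper p0 s0 hre.
have H2 := real_khintchine_upper p0 s0 him.
apply: (@le_trans _ _ (\sum_(e : {ffun 'I_n -> bool}) 2 `^ p *
   (`|\sum_j (-1) ^+ (e j) * complex.Re (z j)| `^ p +
    `|\sum_j (-1) ^+ (e j) * complex.Im (z j)| `^ p))).
  apply: ler_sum => e _; apply: le_trans (powR_addr_le (ltW p0) _ _) => //.
  rewrite ge0_ler_powR ?nnegrE ?normc_ge0 ?addr_ge0 ?(ltW p0)//.
  rewrite (le_trans (normc_le_ReIm _))// Re_sum Im_sum.
  by under eq_bigr do rewrite Re_signM; under [X in _ + `|X|]eq_bigr do rewrite Im_signM.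
rewrite -mulr_sumr big_split /=.
set A := 2 * p `^ p * expR (3 / 2) in H1 H2 *.
have -> : 2 ^+ n * (2 `^ p * 2 * A * s `^ p) =
  2 `^ p * (2 ^+ n * (A * s `^ p) + 2 ^+ n * (A * s `^ p)) by ring.
by rewrite ler_wpM2l ?powR_ge0// lerD.
Qed.

(** Complex l2 over [K] is real l2 over [K * bool]. The values are vectors and not scalars because
    square functions of random sums are compared later. *)
Lemma khintchine_lower n (K : finType) (v : 'I_n -> K -> R[i]) :
  Num.sqrt (\sum_j \sum_k normc (v j k) ^+ 2) <=
  2 * ((2 ^+ n)^-1 * \sum_(e : {ffun 'I_n -> bool})
     Num.sqrt (\sum_k normc (\sum_(j < n) (-1) ^+ (e j) * v j k) ^+ 2)).
Proof.
pose w j (kb : K * bool) := if kb.2 then complex.Re (v j kb.1) else complex.Im (v j kb.1).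
have := hilbert_khintchine w.
have E (f : K * bool -> R) : \sum_kb f kb = \sum_k (f (k, true) + f (k, false)).
  rewrite (eq_bigr (fun u => f (u.1, u.2))); last by case.
  by rewrite -(pair_bigA _ (fun k b => f (k, b)))/=; apply: eq_bigr => k _; rewrite big_bool.
under eq_bigr do rewrite E.
under [X in _ <= _ * (_ * X)]eq_bigr do rewrite E.
under eq_bigr do under eq_bigr do rewrite /w /= -sqr_normcE.
under [X in _ <= _ * (_ * X)]eq_bigr => e _.
  under eq_bigr => k _.
    rewrite /w /=.
    under eq_bigr do rewrite -Re_signM.
    under [X in _ + X ^+ 2]eq_bigr do rewrite -Im_signM.
    rewrite -Re_sum -Im_sum -sqr_normcE.
    over.
  over.
by [].
Qed.

End Khintchine.

(** * Uniform convexity and duality maps of the scalar field *)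

Section UniformConvexity.
Context (R : realType) (p : R) (p1 : 1 < p).

Let p0 : 0 < p. Proof. exact: lt_trans p1. Qed.

(** Write u^p = u exp ((p - 1) ln u) and use ln u = 2 ln (sqrt u) >= 2 (1 - 1 / sqrt u). Unlike the
    tangent line at 1, the term u - sqrt u keeps second-order information once u + v is fixed. *)
Let powR_tangent (u : R) : 0 <= u ->
  u + 2 * (p - 1) * (u - Num.sqrt u) <= u `^ p.
Proof.
rewrite le_eqVlt => /predU1P[<-|u0].
  by rewrite sqrtr0 subrr mulr0 addr0 powR_ge0.
pose w := Num.sqrt u.
have w0 : 0 < w by rewrite sqrtr_gt0.
have uw : u = w ^+ 2 by rewrite sqr_sqrtr// ltW.
rewrite -/w -(mulr_powRB1 (ltW u0) p0) /powR gt_eqF//.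
apply: (@le_trans _ _ (u * (1 + (p - 1) * ln u))); last first.
  by rewrite ler_pM2l// expR_ge1Dx.
have lnw : 1 - w^-1 <= ln w.
  have := @le_ln1Dx _ (w^-1 - 1); rewrite [1 + _]addrC subrK lnV ?posrE// => H.
  have {H} := H _; rewrite ltrBrDr addNr invr_gt0 w0 => /(_ isT); lra.
have -> : ln u = 2 * ln w by rewrite uw lnXn// mulr_natl.
rewrite [leRHS]mulrDr mulr1 lerD2l.
have -> : u - w = u * (1 - w^-1) by rewrite uw; field; rewrite gt_eqF.
have -> : u * ((p - 1) * (2 * ln w)) = 2 * (p - 1) * (u * ln w) by ring.
by rewrite ler_wpM2l ?mulr_ge0 ?subr_ge0 ?(ltW p1)// ler_wpM2l// ltW.
Qed.

(** With a = sqrt u and b = sqrt v one has a^2 + b^2 = 2, so (u - v)^2 <= 4 (a - b)^2 <= 16 (2 - (a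
    + b)). *)
Let powR_mean_normalized (u v : R) : 0 <= u -> 0 <= v -> u + v = 2 ->
  2 + (p - 1) * (u - v) ^+ 2 / 8 <= u `^ p + v `^ p.
Proof.
move=> u0 v0 uv.
apply: le_trans (lerD (powR_tangent u0) (powR_tangent v0)).
have := sqrtr_ge0 u; have := sqrtr_ge0 v.
have := sqr_sqrtr u0; have := sqr_sqrtr v0.
set a := Num.sqrt u; set b := Num.sqrt v => vb ua b0 a0.
suff H : (u - v) ^+ 2 / 16 <= 2 - (a + b).
  have -> : u + 2 * (p - 1) * (u - a) + (v + 2 * (p - 1) * (v - b)) =
    (u + v) + 2 * (p - 1) * ((u + v) - (a + b)) by ring.
  have q0 : 0 <= p - 1 by rewrite subr_ge0 ltW.
  rewrite uv; nra.
have -> : (u - v) ^+ 2 = (a - b) ^+ 2 * (a + b) ^+ 2 by rewrite -ua -vb; ring.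
have ab : (a + b) ^+ 2 = 4 - (a - b) ^+ 2.
  have -> : (a + b) ^+ 2 = 2 * (a ^+ 2 + b ^+ 2) - (a - b) ^+ 2 by ring.
  by rewrite ua vb uv; ring.
have ab2 : a + b <= 2 by have := sqr_ge0 (a - b); nra.
have : (a - b) ^+ 2 <= 4 * (2 - (a + b)) by nra.
have := sqr_ge0 (a - b); nra.
Qed.

Lemma powR_mean_strict (x y : R) : 0 <= x -> 0 <= y -> 0 < x + y ->
  ((x + y) / 2) `^ p * (1 + (p - 1) / 4 * ((x - y) / (x + y)) ^+ 2) <=
  (x `^ p + y `^ p) / 2.
Proof.
move=> x0 y0 xy.
have [M MD] : exists M, M = (x + y) / 2 by exists ((x + y) / 2).
have M0 : 0 < M by rewrite MD divr_gt0.
have xyM : x + y = 2 * M by rewrite MD; field.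
have uv : x / M + y / M = 2 by rewrite -mulrDl xyM mulfK// gt_eqF.
have := powR_mean_normalized (divr_ge0 x0 (ltW M0)) (divr_ge0 y0 (ltW M0)) uv.
have MV : (M^-1) `^ p = (M `^ p)^-1.
  by rewrite -powRN -[M^-1]powR_inv1 ?(ltW M0)// -powRrM mulN1r.
have E z : 0 <= z -> (z / M) `^ p = z `^ p / M `^ p.
  by move=> z0; rewrite powRM ?invr_ge0 ?(ltW M0)// MV.
rewrite !E// -MD xyM.
have -> : x `^ p / M `^ p + y `^ p / M `^ p = (x `^ p + y `^ p) / M `^ p by rewrite mulrDl.
rewrite ler_pdivlMr ?powR_gt0// => H.
rewrite ler_pdivlMr//; apply: le_trans H; rewrite le_eqVlt; apply/orP; left; apply/eqP.
by set Mp := M `^ p; field; rewrite gt_eqF.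
Qed.

Lemma powR_mean (x y : R) : 0 <= x -> 0 <= y ->
  ((x + y) / 2) `^ p <= (x `^ p + y `^ p) / 2.
Proof.
move=> x0 y0.
have := addr_ge0 x0 y0; rewrite le_eqVlt => /predU1P[xy|xy].
  by rewrite -xy mul0r powR0 ?gt_eqF// divr_ge0// addr_ge0 ?powR_ge0.
apply: le_trans (powR_mean_strict x0 y0 xy).
rewrite ler_peMr ?powR_ge0// lerDl mulr_ge0 ?sqr_ge0// divr_ge0// subr_ge0.
exact: ltW.
Qed.

(* Integrating this pointwise inequality gives uniform convexity: when the
   defect of convexity is small against K, so is the norm of a - b. *)
Lemma pointwise_uniform_convexity (eta : R) : 0 < eta ->
  exists2 K : R, 0 < K & forall a b : R[i],
  normc (a - b) `^ p + K * normc ((a + b) / 2) `^ p <=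
    (eta + K) * ((normc a `^ p + normc b `^ p) / 2).
Proof.
move=> eta0.
(* [e] separates the cases: when |a - b| <= 2 e M, with M the mean of the moduli, the term [eta]
   alone pays for |a - b|^p. *)
have [e /andP[e0 e1] he] : exists2 e : R, 0 < e <= 1 & (2 * e) `^ p <= eta.
  exists (Num.min 1 (eta `^ p^-1 / 2)).
    by rewrite lt_min ltr01 divr_gt0 ?powR_gt0//= ge_min lexx.
  apply: (@le_trans _ _ ((eta `^ p^-1) `^ p)); last first.
    by rewrite -powRrM mulVf ?gt_eqF// powRr1 ?(ltW eta0).
  rewrite ge0_ler_powR ?nnegrE ?powR_ge0 ?(ltW p0)//.
    by rewrite mulr_ge0// le_min ler01 divr_ge0 ?powR_ge0.
  by rewrite mulrC -ler_pdivlMr// ge_min lexx orbT.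
pose c := (p - 1) / 8 * e ^+ 2.
have c0 : 0 < c by rewrite mulr_gt0 ?exprn_gt0// divr_gt0// subr_gt0.
pose P2 : R := 2 `^ p; have P20 : 0 < P2 by rewrite powR_gt0.
have K1 : 0 < P2 * (1 + c) / c by rewrite divr_gt0// mulr_gt0// addr_gt0.
have K2 : 0 < P2 * 4 / e ^+ 2 by rewrite divr_gt0 ?exprn_gt0// mulr_gt0.
(* One summand for each way in which [a] and [b] can be far apart: by their moduli, where the
   midpoint loses a fraction c / (1 + c), or by their directions, where it loses e^2 / 4. *)
pose K := P2 * (1 + c) / c + P2 * 4 / e ^+ 2.
exists K; first by rewrite addr_gt0.
have K0 : 0 < K by rewrite addr_gt0.
move=> a b.
set x := normc a; set y := normc b; set A := (x `^ p + y `^ p) / 2.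
set m := normc ((a + b) / 2); set D := normc (a - b).
have [M MD] : exists M, M = (x + y) / 2 by exists ((x + y) / 2).
have x0 : 0 <= x := normc_ge0 _. have y0 : 0 <= y := normc_ge0 _.
have m0 : 0 <= m := normc_ge0 _. have D0 : 0 <= D := normc_ge0 _.
have M0 : 0 <= M by rewrite MD divr_ge0// addr_ge0.
have n2 : normc (2^-1 : R[i]) = 2^-1.
  rewrite normcV; congr (_^-1).
  have -> : (2 : R[i]) = (2%:R)%:C%C by rewrite rmorph_nat.
  by rewrite normc_real ger0_norm.
have mM : m <= M by rewrite /m normcM n2 MD ler_pM2r ?invr_gt0// le_normcD.
have DM : D <= 2 * M.
  rewrite /D MD mulrC divfK// (le_trans (le_normcD _ _))// lerD2l.
  by rewrite normcN.
have MA : M `^ p <= A by rewrite MD; exact: powR_mean.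
have A0 : 0 <= A by apply: le_trans MA; exact: powR_ge0.
have pm (u v : R) : 0 <= u -> u <= v -> u `^ p <= v `^ p.
  by move=> u0 uv; rewrite ge0_ler_powR ?nnegrE ?(ltW p0)// (le_trans u0).
have [DeM|eMD] := leP D (2 * e * M).
  have -> : (eta + K) * A = eta * A + K * A by exact: mulrDl.
  rewrite lerD//.
    apply: (@le_trans _ _ (eta * M `^ p)); last by rewrite ler_wpM2l// ltW.
    apply: (le_trans (pm _ _ D0 DeM)).
    by rewrite powRM ?mulr_ge0 ?(ltW e0)// ler_wpM2r ?powR_ge0.
  rewrite ler_wpM2l ?(ltW K0)//; apply: le_trans MA; exact: pm.
have Mgt0 : 0 < M by rewrite lt_neqAle M0 andbT; apply/eqP => M00; move: eMD DM; rewrite -M00; lra.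
have DP : D `^ p <= P2 * A.
  apply: (le_trans (pm _ _ D0 DM)); rewrite powRM// ler_wpM2l// ltW//.
suff [d [d0 Kd md]] : exists d, [/\ 0 <= d, P2 <= K * d & m `^ p <= (1 - d) * A].
  apply: (@le_trans _ _ (P2 * A + K * ((1 - d) * A))).
    by rewrite lerD// ler_wpM2l// ltW.
  have -> : P2 * A + K * ((1 - d) * A) = (P2 + K - K * d) * A by ring.
  by rewrite ler_wpM2r//; lra.
have Dsq : D ^+ 2 = (x - y) ^+ 2 + 2 * (x * y -
    (complex.Re a * complex.Re b + complex.Im a * complex.Im b)).
  rewrite /D sqr_normcE ReD ImD.
  have -> : (x - y) ^+ 2 = x ^+ 2 + y ^+ 2 - 2 * (x * y) by ring.
  have -> : complex.Re (- b) = - complex.Re b by case: (b).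
  have -> : complex.Im (- b) = - complex.Im b by case: (b).
  rewrite !sqr_normcE; ring.
have msq : m ^+ 2 = M ^+ 2 - (x * y -
    (complex.Re a * complex.Re b + complex.Im a * complex.Im b)) / 2.
  rewrite /m normcM n2 exprMn sqr_normcE ReD ImD.
  have -> : M ^+ 2 = (x ^+ 2 + y ^+ 2 + 2 * (x * y)) / 4 by rewrite MD; field.
  by rewrite !sqr_normcE; field.
(* [z] is |a| |b| - Re (a conj b), the part of |a - b|^2 due to the angle. A large |a - b| forces
   either |x - y| or [z] to be large. *)
set z := x * y - _ in Dsq msq.
have D2 : 4 * e ^+ 2 * M ^+ 2 <= D ^+ 2.
  have -> : 4 * e ^+ 2 * M ^+ 2 = (2 * e * M) ^+ 2 by ring.
  by rewrite ler_sqr ?nnegrE ?mulr_ge0 ?(ltW e0)// ltW.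
have [xyD|xyD] := leP (2 * e ^+ 2 * M ^+ 2) ((x - y) ^+ 2).
  exists (c / (1 + c)); split.
  - by rewrite divr_ge0 ?addr_ge0// ltW.
  - have -> : P2 = (P2 * (1 + c) / c) * (c / (1 + c)).
      by field; rewrite !gt_eqF// addr_gt0.
    by rewrite ler_wpM2r ?divr_ge0 ?addr_ge0 ?(ltW c0)// lerDl ltW.
  have -> : 1 - c / (1 + c) = (1 + c)^-1 by field; rewrite gt_eqF// addr_gt0.
  rewrite ler_pdivlMl ?addr_gt0//.
  apply: le_trans (powR_mean_strict x0 y0 _); last first.
    by move: Mgt0; rewrite MD pmulr_lgt0.
  rewrite -MD.
  rewrite mulrC; apply: (@le_trans _ _ (M `^ p * (1 + c))).
    by rewrite ler_wpM2r ?addr_ge0 ?(ltW c0)// pm.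
  rewrite ler_wpM2l ?powR_ge0// lerD2l.
  have -> : x + y = 2 * M by rewrite MD; field.
  rewrite /c.
  have -> : (p - 1) / 4 * ((x - y) / (2 * M)) ^+ 2 =
     (p - 1) / 16 * ((x - y) ^+ 2 / M ^+ 2) by field; rewrite gt_eqF.
  have -> : (p - 1) / 8 * e ^+ 2 = (p - 1) / 16 * (2 * e ^+ 2) by field.
  rewrite ler_wpM2l//; first by rewrite divr_ge0// subr_ge0 ltW.
  by rewrite ler_pdivlMr ?exprn_gt0.
exists (e ^+ 2 / 4); split.
- by rewrite divr_ge0// sqr_ge0.
- have -> : P2 = (P2 * 4 / e ^+ 2) * (e ^+ 2 / 4) by field; rewrite gt_eqF.
  by rewrite ler_wpM2r ?divr_ge0 ?sqr_ge0// lerDr ltW.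
have e21 : e ^+ 2 <= 1 by nra.
have mle : m <= (1 - e ^+ 2 / 4) * M.
  have k0 : 0 <= 1 - e ^+ 2 / 4 by lra.
  rewrite -ler_sqr ?nnegrE ?mulr_ge0// exprMn msq.
  have := sqr_ge0 (e ^+ 2); have := sqr_ge0 M; nra.
apply: (@le_trans _ _ ((1 - e ^+ 2 / 4) * M `^ p)); last first.
  by rewrite ler_wpM2l//; lra.
rewrite -(mulr_powRB1 m0 p0) -(mulr_powRB1 M0 p0) mulrA ler_pM ?powR_ge0//.
by rewrite ge0_ler_powR ?nnegrE ?subr_ge0 ?(ltW p1).
Qed.

End UniformConvexity.

Section DualityMap.
Context (R : realType) (p : R) (p1 : 1 < p).
Let p0 : 0 < p. Proof. exact: lt_trans p1. Qed.

(** This is the gradient of |b|^p / p: the derivative in the direction h is the real part of h times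
    it. At 0 the factor [b^*] makes it vanish, whatever the value of the power. *)
Definition duality_map (b : R[i]) : R[i] := ((normc b `^ (p - 2))%:C * b^*)%C.

Lemma mulr_duality_map b : b * duality_map b = ((normc b `^ p)%:C)%C.
Proof.
have [->|bN0] := eqVneq b 0.
  by rewrite /duality_map mul0r normc0 powR0 ?gt_eqF.
have nb : normc b != 0 by apply: contra bN0 => /eqP /eq0_normc ->.
rewrite /duality_map mulrCA.
have -> : (b * b^*)%C = ((normc b ^+ 2)%:C)%C.
  rewrite sqr_normcE; case: b {bN0 nb} => x y.
  by apply/eqP; rewrite eq_complex /= ; apply/andP; split; apply/eqP; ring.
rewrite -rmorphM /= -powR_mulrn ?normc_ge0// -powRD ?subrK//.
by rewrite nb implybT.
Qed.

Lemma normc_duality_map b : normc (duality_map b) = normc b `^ (p - 1).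
Proof.
rewrite /duality_map normcM normc_real normc_conj ger0_norm ?powR_ge0//.
have [->|nb] := eqVneq (normc b) 0; first by rewrite mulr0 powR0 ?subr_eq0 ?gt_eqF.
rewrite mulrC -[X in X * _]powRr1 ?normc_ge0// -powRD.
  by congr (_ `^ _); ring.
by rewrite nb implybT.
Qed.

(** The graph of |.|^p lies above its tangent plane at [b]. Young's inequality applied to |a| and
    |b|^(p-1) gives this without derivatives. *)
Lemma powR_normc_gradient (a b : R[i]) :
  normc b `^ p + p * complex.Re ((a - b) * duality_map b) <= normc a `^ p.
Proof.
rewrite mulrBl mulr_duality_map ReD.
have -> : complex.Re (- ((normc b `^ p)%:C)%C) = - normc b `^ p by [].
have H : complex.Re (a * duality_map b) <= normc a * normc b `^ (p - 1).
  rewrite -normc_duality_map -normcM.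
  by rewrite (le_trans (ler_norm _)) ?normr_Re_le.
pose q := p / (p - 1).
have q1 : 0 < p - 1 by rewrite subr_gt0.
have q0 : 0 < q by rewrite divr_gt0.
have pq : p^-1 + q^-1 = 1 by rewrite /q; field; rewrite !gt_eqF.
have := conjugate_powR (normc_ge0 a) (powR_ge0 (normc b) (p - 1)) p0 q0 pq.
rewrite -powRrM.
have -> : (p - 1) * q = p by rewrite /q; field; rewrite gt_eqF.
move=> H2.
have -> : normc b `^ p + p * (complex.Re (a * duality_map b) - normc b `^ p) =
  p * complex.Re (a * duality_map b) - p * (normc b `^ p / q).
  by rewrite /q; field; rewrite !gt_eqF.
have -> : normc a `^ p = p * (normc a `^ p / p) by field; rewrite gt_eqF.
rewrite -mulrBr ler_pM2l//; lra.
Qed.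

End DualityMap.

(** * Averages over roots of unity *)

Section RootsOfUnity.
Context (R : realType).

(** [R[i]] is algebraically closed and X^n - 1 is separable, so there are n roots of unity, and they
    contain a primitive one. *)
Lemma exists_prim_root n : (n > 0)%N -> exists z : R[i], n.-primitive_root z.
Proof.
pose p : {poly R[i]} := 'X^n - 1; have [r Dp] := closed_field_poly_normal p.
move=> n_gt0; rewrite (monicP _) ?monicXnsubC // scale1r in Dp.
have rn1: all n.-unity_root r by apply/allP=> z; rewrite -root_prod_XsubC -Dp.
have sz_r: (n < (size r).+1)%N.
  by rewrite -(size_prod_XsubC r id) -Dp size_XnsubC.
have [|z] := hasP (has_prim_root n_gt0 rn1 _ sz_r); last by exists z.
by rewrite -separable_prod_XsubC -Dp separable_Xn_sub_1 // pnatr_eq0 -lt0n.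
Qed.

Context (N : nat) (z : R[i]).
Hypotheses (N0 : (0 < N)%N) (prz : N.-primitive_root z).

Lemma prim_root_neq0 : z != 0.
Proof. by rewrite (prim_root_eq0 prz) -lt0n. Qed.

Lemma sum_prim_root_expr (m : nat) :
  \sum_(i < N) (z ^+ i) ^+ m = if (N %| m)%N then N%:R else 0.
Proof.
case: ifP => [/dvdnP[k ->]|Nm].
  rewrite (eq_bigr (fun=> 1)) ?sumr_const ?card_ord// => i _.
  by rewrite -exprM mulnA mulnC exprM (prim_expr_order prz) expr1n.
have zm1 : z ^+ m - 1 != 0.
  by rewrite subr_eq0 -(prim_order_dvd prz) Nm.
apply: (mulfI zm1); rewrite mulr0.
transitivity ((z ^+ m) ^+ N - 1).
  rewrite [RHS]subrX1; congr (_ * _); apply: eq_bigr => i _.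
  by rewrite -!exprM mulnC.
by rewrite -exprM mulnC exprM (prim_expr_order prz) expr1n subrr.
Qed.

Lemma sum_prim_root_div (n k : nat) : (n < N)%N -> (k < N)%N ->
  \sum_(i < N) (z ^+ i) ^+ n / (z ^+ i) ^+ k = if n == k then N%:R else 0.
Proof.
move=> nN kN.
have E (i : 'I_N) : (z ^+ i) ^+ n / (z ^+ i) ^+ k = (z ^+ i) ^+ (n + (N - k)).
  rewrite exprD; congr (_ * _).
  have u : (z ^+ i) ^+ k * (z ^+ i) ^+ (N - k) = 1.
    by rewrite -exprD subnKC ?(ltnW kN)// -exprM mulnC exprM (prim_expr_order prz) expr1n.
  by apply: (mulfI (_ : (z ^+ i) ^+ k != 0)); rewrite ?mulfV ?expf_neq0// prim_root_neq0.
under eq_bigr do rewrite E.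
rewrite sum_prim_root_expr; congr (if _ then _ else _).
have [->|nk] := eqVneq n k; first by rewrite subnKC ?(ltnW kN) ?dvdnn.
apply/negbTE; apply/negP => /dvdnP[c]; move: nk kN nN; clear.
by case: c => [|[|c]] nk kN nN H; [lia|lia|nia].
Qed.

Lemma normc_prim_root i : normc (z ^+ i) = 1.
Proof.
have : normc z ^+ N = 1 by rewrite -normcX (prim_expr_order prz) normc1.
move=> /eqP; rewrite pexprn_eq1 ?normc_ge0// => /orP[|/eqP zz].
  by rewrite eqn0Ngt N0.
by rewrite normcX zz expr1n.
Qed.

(* Parseval for the trigonometric polynomial
   1 / (r w - 1) = (r ^ N - 1)^-1 sum_(k < N) r ^ k w ^ k, valid for w ^ N = 1. *)
Lemma sum_inv_normc_sqr (r : R) : 1 < r -> 2 <= r ^+ N ->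
  \sum_(i < N) (normc ((r%:C)%C * z ^+ i - 1) ^+ 2)^-1 <= N%:R * (3 / (r ^+ 2 - 1)).
Proof.
move=> r1 rN.
have r0 : 0 < r by exact: lt_trans r1.
have r2 : 1 < r ^+ 2 by rewrite exprn_egt1.
pose V (i : 'I_N) := \sum_(k < N) ((r%:C)%C * z ^+ i) ^+ k.
have E (i : 'I_N) : (normc ((r%:C)%C * z ^+ i - 1) ^+ 2)^-1 = normc (V i) ^+ 2 / (r ^+ N - 1) ^+ 2.
  have : ((r%:C)%C * z ^+ i - 1) * V i = ((r ^+ N - 1)%:C)%C.
    rewrite -subrX1 exprMn -exprM mulnC exprM (prim_expr_order prz) expr1n mulr1.
    by rewrite -rmorphXn rmorphB rmorph1.
  move/(congr1 (@normc R)); rewrite normcM normc_real ger0_norm; last by lra.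
  set A := normc _; set B := normc _ => AB.
  have AN0 : A != 0 by apply/eqP => A0; move: AB; rewrite A0 mul0r; lra.
  have BN0 : B != 0 by apply/eqP => B0; move: AB; rewrite B0 mulr0; lra.
  by rewrite -AB; field; rewrite AN0 BN0.
under eq_bigr do rewrite E.
rewrite -mulr_suml.
have S : \sum_i normc (V i) ^+ 2 = N%:R * ((r ^+ 2) ^+ N - 1) / (r ^+ 2 - 1).
  apply: complexI; rewrite rmorph_sum /=.
  transitivity (\sum_(i < N) \sum_(k < N) \sum_(l < N)
      ((r ^+ (k + l))%:C)%C * ((z ^+ i) ^+ k / (z ^+ i) ^+ l)).
    apply: eq_bigr => i _.
    have zc : ((z ^+ i)^*)%C = (z ^+ i)^-1.
      apply: (mulfI (_ : z ^+ i != 0)); first by rewrite expf_neq0// prim_root_neq0.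
      rewrite mulfV ?expf_neq0 ?prim_root_neq0// -sqr_normc.
      have -> : `|z ^+ i| = ((normc (z ^+ i))%:C)%C by [].
      by rewrite normc_prim_root expr1n.
    have -> : ((normc (V i) ^+ 2)%:C)%C = (V i * (V i)^*)%C.
      by rewrite -sqr_normc rmorphXn.
    rewrite /V rmorph_sum big_distrlr /=; apply: eq_bigr => k _; apply: eq_bigr => l _.
    have W : ((((r%:C)%C * z ^+ i) ^+ l)^*)%C = ((r%:C)%C) ^+ l / (z ^+ i) ^+ l.
      have E2 (x : R) (u : R[i]) : (((x%:C)%C * u)^*)%C = ((x%:C)%C * (u^*)%C).
        by case: u => u1 u2; apply/eqP; rewrite eq_complex /=; apply/andP; split; apply/eqP; ring.
      by rewrite rmorphXn /= E2 zc exprMn exprVn.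
    rewrite -[(_ ^+ l)^*]/((((r%:C)%C * z ^+ i) ^+ l)^*)%C W.
    rewrite exprD rmorphM !rmorphXn exprMn /=; ring.
  rewrite exchange_big /=.
  transitivity (\sum_(k < N) N%:R * ((((r ^+ 2) ^+ k)%:C)%C) : R[i]).
    apply: eq_bigr => k _; rewrite exchange_big /= (bigD1 k)//= [X in _ + X]big1 ?addr0.
      rewrite -mulr_sumr sum_prim_root_div// eqxx mulrC; congr (_ * (_%:C)%C).
      by rewrite addnn -mul2n exprM.
    by move=> l lk; rewrite -mulr_sumr sum_prim_root_div// val_eqE eq_sym (negbTE lk) mulr0.
  rewrite -mulr_sumr -rmorph_sum -[N%:R](rmorph_nat (real_complex R)) -rmorphM; congr (_%:C)%C.
  rewrite -mulrA; congr (_ * _); rewrite subrX1 mulrAC mulfV ?mul1r// gt_eqF// subr_gt0//.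
rewrite S -!mulrA ler_pM2l ?ltr0n// mulrCA mulrC ler_pM2r ?invr_gt0 ?subr_gt0//.
(* The quotient left is (r^N + 1) / (r^N - 1), which is at most 3 since r^N >= 2. *)
have -> : (r ^+ 2) ^+ N - 1 = (r ^+ N - 1) * (r ^+ N + 1).
  by rewrite -exprM mulnC exprM; ring.
rewrite ler_pdivrMr; last by rewrite exprn_gt0//; lra.
nra.
Qed.

End RootsOfUnity.

(** * Row and column sums of the dyadic kernel *)

Section SchurWeights.
Context (R : realType).

Definition dyadic_weight (k j : nat) : R :=
  if (2 ^ j <= k)%N then (2 ^ j)%:R / k%:R else k%:R / (2 ^ j)%:R.

Lemma dyadic_weight_ge0 k j : 0 <= dyadic_weight k j.
Proof. by rewrite /dyadic_weight; case: ifP => _; rewrite divr_ge0. Qed.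

Lemma sum_dyadic_weight k J : (0 < k)%N -> \sum_(j < J) dyadic_weight k j <= 4.
Proof.
move=> k0.
have kR : 0 < k%:R :> R by rewrite ltr0n.
have p2 j : 0 < (2 ^ j)%:R :> R by rewrite ltr0n expn_gt0.
(* The induction carries explicit partial sums of two geometric series: the weights double while 2^j
   <= k and are halved afterwards. *)
suff : \sum_(j < J) dyadic_weight k j <=
  if (2 ^ J <= k)%N then (2 ^ J)%:R / k%:R else 4 - 2 * k%:R / (2 ^ J)%:R.
  move=> /le_trans; apply; case: ifP => kJ.
    by rewrite ler_pdivrMr//; rewrite -(ler_nat R) in kJ; lra.
  by rewrite gerBl divr_ge0 ?mulr_ge0// ltW.
elim: J => [|J IH].
  by rewrite big_ord0 expn0 k0 divr_ge0.
rewrite big_ord_recr /=; apply: (le_trans (lerD IH (lexx _))).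
rewrite /dyadic_weight; have [kJ|kJ] /= := leqP (2 ^ J) k.
  have e2 : (2 ^ J.+1)%:R = 2 * (2 ^ J)%:R :> R by rewrite expnS natrM.
  case: ifP => kJ1; first by rewrite e2; lra.
  move: kJ1 => /negbT; rewrite -ltnNge -(ltr_nat R) e2 => kJ1.
  move: kJ; rewrite -(ler_nat R) => kJ.
  set a := (2 ^ J)%:R in kJ kJ1 e2 *; have a0 : 0 < a by exact: p2.
  have -> : 2 * k%:R / (2 * a) = k%:R / a by field; rewrite gt_eqF.
  rewrite lerBrDr.
  set x := a / k%:R.
  have -> : k%:R / a = x^-1 by rewrite /x invf_div.
  have x0 : 0 < x by rewrite divr_gt0.
  have x1 : x <= 1 by rewrite ler_pdivrMr// mul1r.
  have x2 : x^-1 <= 2.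
    by rewrite -[2]invrK lef_pV2 ?posrE ?invr_gt0// /x ler_pdivlMr//; lra.
  lra.
have -> : (2 ^ J.+1 <= k)%N = false.
  by apply/negbTE; rewrite -ltnNge (ltn_trans kJ)// ltn_exp2l.
rewrite expnS natrM.
set a := (2 ^ J)%:R; have a0 : 0 < a by exact: p2.
have -> : 2 * k%:R / (2 * a) = k%:R / a by field; rewrite gt_eqF.
lra.
Qed.

Lemma sum_dyadic_weight_div n j : \sum_(k < n) dyadic_weight k.+1 j / k.+1%:R <= 2.
Proof.
set a := (2 ^ j)%N; have a0 : (0 < a)%N by rewrite expn_gt0.
have aR : 0 < a%:R :> R by rewrite ltr0n.
(* Each term with k < a equals 1 / a; beyond [a] the terms a / k^2 are dominated by the telescoping
   a / (k - 1) - a / k. *)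
suff : \sum_(k < n) dyadic_weight k.+1 j / k.+1%:R <=
  if (n < a)%N then n%:R / a%:R else 2 - a%:R / n%:R.
  move=> /le_trans; apply; case: ifP => na.
    by rewrite ler_pdivrMr//; rewrite -(ltr_nat R) in na; lra.
  by rewrite gerBl divr_ge0.
elim: n => [|n IH]; first by rewrite big_ord0 a0 mul0r.
rewrite big_ord_recr /=; apply: (le_trans (lerD IH (lexx _))).
have [x xE] : exists x, x = n.+1%:R :> R by exists n.+1%:R.
have n1 : 0 < x by rewrite xE ltr0n.
have nx : n%:R = x - 1 :> R by rewrite xE -natr1 addrK.
rewrite /dyadic_weight -/a -xE; have [na|na] := ltnP n a; last first.
  rewrite leqW// ltnNge leqW//=.
  have n0 : 0 < n%:R :> R by rewrite ltr0n (leq_trans a0).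
  rewrite -subr_ge0.
  rewrite nx in n0 *.
  have -> : 2 - a%:R / x - (2 - a%:R / (x - 1) + a%:R / x / x) =
     a%:R / ((x - 1) * x * x) :> R by field; rewrite !gt_eqF.
  by rewrite divr_ge0// !mulr_ge0// ltW.
rewrite leqNgt ltnNge; have [an|an] /= := leqP a n.+1; last first.
  rewrite -subr_ge0 nx.
  have -> : x / a%:R - ((x - 1) / a%:R + x / a%:R / x) = 0 by field; rewrite !gt_eqF.
  by [].
have -> : a = n.+1 by apply/eqP; rewrite eqn_leq an na.
rewrite -xE nx.
have -> : (x - 1) / x + x / x / x = 1 by field; rewrite gt_eqF.
by rewrite divff ?gt_eqF//; lra.
Qed.

End SchurWeights.

(** * Square functions of finite families in Lp *)

Section RealNorm.
Context d (Omega : measurableType d) (R : realType).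
Variables (mu : {measure set Omega -> \bar R}) (p : R) (p1 : 1 <= p).
Let p0 : 0 < p. Proof. exact: lt_le_trans p1. Qed.
Implicit Types f g : Omega -> R.

Local Notation N f := ('N[mu]_p%:E[EFin \o f])%E.

Lemma measurable_powR_comp (r : R) f : measurable_fun setT f ->
  measurable_fun setT (fun w => f w `^ r).
Proof. by move=> mf; apply: (@measurableT_comp _ _ _ _ _ _ (@powR R ^~ r)). Qed.

Lemma Lnorm_powR f : (forall w, 0 <= f w) ->
  (N f `^ p = \int[mu]_w (f w `^ p)%:E)%E.
Proof.
move=> f0; rewrite unlock -poweRrM mulVf ?gt_eqF// poweRe1; last first.
  by apply: integral_ge0 => w _; exact: poweR_ge0.
by apply: eq_integral => w _ /=; rewrite ger0_norm// poweR_EFin.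
Qed.

Lemma le_ae_Lnorm f g : (forall w, 0 <= f w) -> (forall w, 0 <= g w) ->
  measurable_fun setT f -> measurable_fun setT g ->
  (\forall w \ae mu, f w <= g w) -> (N f <= N g)%E.
Proof.
move=> f0 g0 mf mg fg; rewrite unlock.
have H (h : Omega -> R) : measurable_fun setT h -> (forall w, 0 <= h w) ->
    measurable_fun setT (fun w => `|(EFin \o h) w| `^ p)%E.
  move=> mh h0; rewrite (_ : (fun w => _) = (fun w => (h w `^ p)%:E)).
    by apply/measurable_EFinP; exact: measurable_powR_comp.
  by apply/funext => w /=; rewrite ger0_norm// poweR_EFin.
apply: gt0_ler_poweR.
- by rewrite invr_ge0 ltW.
- by rewrite in_itv/= leey andbT integral_ge0// => w _; exact: poweR_ge0.
- by rewrite in_itv/= leey andbT integral_ge0// => w _; exact: poweR_ge0.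
apply: ae_ge0_le_integral => //.
- by move=> w _; exact: poweR_ge0.
- exact: H.
- by move=> w _; exact: poweR_ge0.
- exact: H.
apply: filterS fg => w fgw _ /=.
by rewrite !ger0_norm// ?poweR_EFin lee_fin ge0_ler_powR ?nnegrE ?(ltW p0).
Qed.

Lemma LnormZ_real (c : R) f : 0 <= c -> (forall w, 0 <= f w) ->
  measurable_fun setT f -> (N (fun w => (c * f w)%R) = c%:E * N f)%E.
Proof.
move=> c0 f0 mf; rewrite unlock.
rewrite (eq_integral (fun w => (c `^ p)%:E * (f w `^ p)%:E)%E); last first.
  by move=> w _ /=; rewrite ger0_norm ?mulr_ge0// ?poweR_EFin powRM// EFinM.
rewrite [in RHS](eq_integral (fun w => (f w `^ p)%:E)); last first.
  by move=> w _ /=; rewrite ger0_norm// ?poweR_EFin.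
rewrite ge0_integralZl//; first last.
- by rewrite lee_fin powR_ge0.
- by move=> w _; rewrite lee_fin powR_ge0.
- by apply/measurable_EFinP; exact: measurable_powR_comp.
rewrite poweRM ?lee_fin ?powR_ge0//; last first.
  by apply: integral_ge0 => w _; rewrite lee_fin powR_ge0.
by rewrite ?poweR_EFin -powRrM mulfV ?gt_eqF// powRr1.
Qed.

Lemma Lnorm_lincomb (I : Type) (s : seq I) (c : I -> R) (f : I -> Omega -> R) :
  (forall i, 0 <= c i) -> (forall i w, 0 <= f i w) ->
  (forall i, measurable_fun setT (f i)) ->
  (N (fun w => (\sum_(i <- s) c i * f i w)%R) <= \sum_(i <- s) (c i)%:E * N (f i))%E.
Proof.
move=> c0 f0 mf; elim: s => [|i s IH].
  rewrite big_nil (_ : (EFin \o _) = cst 0%E); first by rewrite Lnorm0// eqe gt_eqF.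
  by apply/funext => w /=; rewrite big_nil.
rewrite big_cons (_ : (fun w => _) =
  ((fun w => c i * f i w) \+ (fun w => \sum_(j <- s) c j * f j w))); last first.
  by apply/funext => w /=; rewrite big_cons.
apply: le_trans (minkowski_EFin mu _ _ p1) _.
- by apply: measurable_funM.
- by apply: measurable_sum => j; apply: measurable_funM.
by rewrite leeD// LnormZ_real.
Qed.

End RealNorm.

Section SquareNorm.
Context d (Omega : measurableType d) (R : realType).
Variables (mu : {measure set Omega -> \bar R}) (p : R) (p1 : 1 <= p).
Let p0 : 0 < p. Proof. exact: lt_le_trans p1. Qed.

Local Notation N f := ('N[mu]_p%:E[EFin \o f])%E.
Local Notation X := (Lp mu p1).

Definition sqf (I : finType) (x : I -> X) (w : Omega) : R :=
  Num.sqrt (\sum_i normc (Lp_rep (x i) w) ^+ 2).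

(* The norm of the family x in Lp(l2). *)
Definition sqn (I : finType) (x : I -> X) : R := fine (N (sqf x)).

Lemma sqf_ge0 (I : finType) (x : I -> X) w : 0 <= sqf x w.
Proof. exact: sqrtr_ge0. Qed.

Lemma sqrsum_ge0 (I : finType) (a : I -> R) : 0 <= \sum_i a i ^+ 2.
Proof. by apply: sumr_ge0 => i _; exact: sqr_ge0. Qed.

Lemma sqf_sqr (I : finType) (x : I -> X) w :
  sqf x w ^+ 2 = \sum_i normc (Lp_rep (x i) w) ^+ 2.
Proof. by rewrite sqr_sqrtr// sqrsum_ge0. Qed.

Lemma measurable_sqf (I : finType) (x : I -> X) : measurable_fun setT (sqf x).
Proof.
apply: (measurableT_comp (f := @Num.sqrt R)).
  by apply: continuous_measurable_fun; exact: sqrt_continuous.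
apply: measurable_sum => i; apply: measurable_funX.
by apply: cmeasurable_normc; exact: Lp_rep_meas.
Qed.

Lemma sqf_le_sum (I : finType) (x : I -> X) w :
  sqf x w <= \sum_i normc (Lp_rep (x i) w).
Proof.
rewrite -ler_sqr ?nnegrE ?sqf_ge0 ?sumr_ge0// => [|i _]; last exact: normc_ge0.
rewrite sqf_sqr; pose a i := normc (Lp_rep (x i) w).
have a0 i : 0 <= a i by exact: normc_ge0.
rewrite [leRHS]expr2 mulr_sumr; apply: ler_sum => i _.
rewrite expr2 ler_wpM2r ?normc_ge0// (bigD1 i)//= lerDl; apply: sumr_ge0 => j _; exact: a0.
Qed.

Lemma rnormE (x : X) : rnorm x = Lp_norm x.
Proof. by []. Qed.

Lemma rnorm_cLnorm (x : X) : ((rnorm x)%:E = N (fun w => normc (Lp_rep x w)))%E.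
Proof. by rewrite rnormE Lp_normE. Qed.

Lemma rnorm_ge0 (x : X) : 0 <= rnorm x.
Proof. by rewrite -lee_fin rnorm_cLnorm Lnorm_ge0. Qed.

Lemma measurable_normc_rep (x : X) : measurable_fun setT (fun w => normc (Lp_rep x w)).
Proof. by apply: cmeasurable_normc; exact: Lp_rep_meas. Qed.

Lemma Lnorm_sqf_lty (I : finType) (x : I -> X) : (N (sqf x) < +oo)%E.
Proof.
apply: (@le_lt_trans _ _ (\sum_i 1%:E * N (fun w => normc (Lp_rep (x i) w)))%E).
  apply: le_trans (Lnorm_lincomb mu p1 _ _ _ _) => //; last 2 first.
  - by move=> *; exact: normc_ge0.
  - by move=> i; exact: measurable_normc_rep.
  apply: le_ae_Lnorm => //.
  - exact: sqf_ge0.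
  - by move=> w; apply: sumr_ge0 => i _; rewrite mul1r normc_ge0.
  - exact: measurable_sqf.
  - apply: measurable_sum => i; apply: measurable_funM => //.
    exact: measurable_normc_rep.
  - by apply: aeW => w; under eq_bigr do rewrite mul1r; exact: sqf_le_sum.
under eq_bigr do rewrite mul1e -rnorm_cLnorm.
by rewrite sumEFin ltry.
Qed.

Lemma sqnE (I : finType) (x : I -> X) : ((sqn x)%:E = N (sqf x))%E.
Proof. by rewrite fineK// ge0_fin_numE ?Lnorm_sqf_lty// Lnorm_ge0. Qed.

Lemma sqn_ge0 (I : finType) (x : I -> X) : 0 <= sqn x.
Proof. by rewrite -lee_fin sqnE Lnorm_ge0. Qed.

Lemma sqn_powR (I : finType) (x : I -> X) :
  ((sqn x `^ p)%:E = \int[mu]_w (sqf x w `^ p)%:E)%E.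
Proof.
rewrite -Lnorm_powR//; last exact: sqf_ge0.
by rewrite -sqnE poweR_EFin.
Qed.

(** Minkowski's inequality turns a pointwise bound between square functions into one between norms.
    The index type may vary with [k], which permits cutting a family into pieces. *)
Lemma sqn_le_lincomb (K : finType) (c : K -> R) (J : K -> finType)
    (y : forall k, J k -> X) (I : finType) (x : I -> X) :
  (forall k, 0 <= c k) ->
  (\forall w \ae mu, sqf x w <= \sum_k c k * sqf (@y k) w) ->
  sqn x <= \sum_k c k * sqn (@y k).
Proof.
move=> c0 H; rewrite -lee_fin sqnE -sumEFin.
under eq_bigr do rewrite EFinM sqnE.
apply: le_trans (Lnorm_lincomb mu p1 _ c0 _ _); first last.
- by move=> k; exact: measurable_sqf.
- by move=> *; exact: sqf_ge0.
apply: le_ae_Lnorm => //.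
- exact: sqf_ge0.
- by move=> w; apply: sumr_ge0 => k _; rewrite mulr_ge0 ?sqf_ge0.
- exact: measurable_sqf.
- by apply: measurable_sum => k; apply: measurable_funM => //; exact: measurable_sqf.
Qed.

Lemma sqn_le (I J : finType) (x : I -> X) (y : J -> X) (c : R) : 0 <= c ->
  (\forall w \ae mu, \sum_i normc (Lp_rep (x i) w) ^+ 2 <=
     c ^+ 2 * \sum_j normc (Lp_rep (y j) w) ^+ 2) ->
  sqn x <= c * sqn y.
Proof.
move=> c0 H.
have := @sqn_le_lincomb unit (fun=> c) (fun=> J) (fun _ => y) I x.
rewrite (big_pred1 tt); last by case.
apply => //; apply: filterS H => w H.
rewrite (big_pred1 tt); last by case.
by rewrite -ler_sqr ?nnegrE ?mulr_ge0 ?sqf_ge0// exprMn !sqf_sqr.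
Qed.

Lemma sqn1 (x : X) : sqn (fun _ : unit => x) = rnorm x.
Proof.
apply: EFin_inj; rewrite sqnE rnorm_cLnorm; congr (Lnorm mu p%:E (EFin \o _)); apply/funext => w /=.
by rewrite /sqf (big_pred1 tt) ?sqrtr_sqr ?ger0_norm ?normc_ge0//; case.
Qed.

Lemma sqn_le_sum (I : finType) (x : I -> X) : sqn x <= \sum_i rnorm (x i).
Proof.
rewrite [leRHS](eq_bigr (fun i => 1 * sqn (fun _ : unit => x i))); last first.
  by move=> i _; rewrite mul1r sqn1.
apply: (@sqn_le_lincomb I (fun=> 1) (fun=> unit) (fun i _ => x i)) => //.
apply: aeW => w; apply: le_trans (sqf_le_sum _ _) _.
apply: ler_sum => i _; rewrite mul1r /sqf (big_pred1 tt); last by case.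
by rewrite sqrtr_sqr ger0_norm ?normc_ge0.
Qed.

Lemma Lp_rep0 : (Lp_rep (0 : X) : Omega -> R[i]) = (fun=> 0) %[ae mu].
Proof. by have := Lp_rep_class (0 : Lp_fun mu p1); rewrite Lp_class0. Qed.

Lemma Lp_rep_sum (J : Type) (s : seq J) (x : J -> X) :
  \forall w \ae mu, Lp_rep (\sum_(i <- s) x i) w = \sum_(i <- s) Lp_rep (x i) w.
Proof.
elim: s => [|i s IH].
  by apply: filterS Lp_rep0 => w /(_ I) H; rewrite !big_nil.
have H := Lp_repD (x i) (\sum_(j <- s) x j).
apply: filterS2 IH H => w IH /(_ I) H.
by rewrite !big_cons H IH.
Qed.

Lemma Lp_repZ_ae (a : R[i]) (x : X) :
  \forall w \ae mu, Lp_rep (a *: x) w = a * Lp_rep x w.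
Proof. by apply: filterS (Lp_repZ a x) => w /(_ I). Qed.

Lemma Lp_rep_lincomb (I : finType) (a : I -> R[i]) (x : I -> X) :
  \forall w \ae mu, Lp_rep (\sum_i a i *: x i) w = \sum_i a i * Lp_rep (x i) w.
Proof.
have H : \forall w \ae mu, forall i, Lp_rep (a i *: x i) w = a i * Lp_rep (x i) w.
  by apply: filter_forall => i; exact: Lp_repZ_ae.
apply: filterS2 H (Lp_rep_sum (index_enum I) (fun i => a i *: x i)) => w H ->.
by apply: eq_bigr => i _; rewrite H.
Qed.

End SquareNorm.

Section LinearMaps.
Context (K : comNzRingType) (U V : lmodType K).

Lemma linear_lincomb (f : U -> V) : linear f -> forall (J : Type) (s : seq J)
  (a : J -> K) (x : J -> U),
  f (\sum_(i <- s) a i *: x i) = \sum_(i <- s) a i *: f (x i).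
Proof.
move=> lf J s a x; elim: s => [|i s IH]; last by rewrite !big_cons lf IH.
rewrite !big_nil; apply: (addrI (f 0)).
by have := lf 1 0 0; rewrite !scale1r !addr0.
Qed.

End LinearMaps.

Section KhintchineLp.
Context d (Omega : measurableType d) (R : realType).
Variables (mu : {measure set Omega -> \bar R}) (p : R) (p1 : 1 <= p).
Let p0 : 0 < p. Proof. exact: lt_le_trans p1. Qed.
Local Notation X := (Lp mu p1).

Lemma sqn_reindex (I J : finType) (h : J -> I) (x : I -> X) : bijective h ->
  sqn (fun j => x (h j)) = sqn x.
Proof.
move=> bh; congr (fine (Lnorm mu p%:E (EFin \o _))); apply/funext => w.
by rewrite /sqf [in RHS](reindex h)//=; exact: onW_bij.
Qed.

(** The scalar inequality under the integral bounds the mean of the p-th powers of the norms; the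
    mean of the norms is then deduced. *)
Lemma rademacher_mean_le_sqn : exists2 C : R, 0 < C &
  forall n (x : 'I_n -> X), rademacher_mean x <= C * sqn x.
Proof.
have [C0 C00 H] := @khintchine_upper R p p0.
exists (1 + C0); first by rewrite addr_gt0.
move=> n x; rewrite /rademacher_mean.
pose F (e : {ffun 'I_n -> bool}) : X := \sum_(j < n) ((-1 : R[i]) ^+ e j) *: x j.
pose a e := rnorm (F e).
have a0 e : 0 <= a e by exact: rnorm_ge0.
have h2 : 0 < 2 ^+ n :> R by rewrite exprn_gt0.
have mF e : measurable_fun setT (fun w => (normc (Lp_rep (F e) w) `^ p)%:E).
  by apply/measurable_EFinP/measurable_powR_comp; exact: measurable_normc_rep.
have Sa : \sum_e a e `^ p <= 2 ^+ n * (C0 * sqn x `^ p).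
  rewrite -lee_fin -sumEFin.
  under eq_bigr => e _.
    rewrite /a -poweR_EFin rnorm_cLnorm Lnorm_powR//; last by move=> w; exact: normc_ge0.
    over.
  rewrite -ge0_integral_sum//; last by move=> e w _; rewrite lee_fin powR_ge0.
  rewrite !EFinM sqn_powR muleA -ge0_integralZl//; first last.
  - by rewrite lee_fin mulr_ge0 ?(ltW h2) ?(ltW C00).
  - by move=> w _; rewrite lee_fin powR_ge0.
  - by apply/measurable_EFinP/measurable_powR_comp; exact: measurable_sqf.
  apply: ae_ge0_le_integral => //.
  - by move=> w _; apply: sume_ge0 => e _; rewrite lee_fin powR_ge0.
  - by apply: emeasurable_sum => e.
  - by move=> w _; rewrite -EFinM lee_fin mulr_ge0 ?powR_ge0// mulr_ge0 ?(ltW h2) ?(ltW C00).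
  - apply: measurable_funeM; apply/measurable_EFinP/measurable_powR_comp.
    exact: measurable_sqf.
  have : \forall w \ae mu, forall e : {ffun 'I_n -> bool},
      Lp_rep (F e) w = \sum_j ((-1) ^+ e j) * Lp_rep (x j) w.
    by apply: filter_forall => e; exact: Lp_rep_lincomb.
  apply: filterS => w Fw _; rewrite sumEFin -!EFinM lee_fin.
  by under eq_bigr do rewrite Fw; rewrite -mulrA; exact: H.
rewrite ler_pdivrMl//.
have [s0|sN0] := eqVneq (sqn x) 0.
  rewrite s0 !mulr0 big1// => e _; apply/eqP.
  have : a e `^ p <= 0.
    apply: le_trans (_ : \sum_e a e `^ p <= 0).
      by rewrite (bigD1 e)//= lerDl; apply: sumr_ge0 => *; exact: powR_ge0.
    by apply: (le_trans Sa); rewrite s0 powR0 ?gt_eqF// !mulr0.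
  by rewrite le_eqVlt ltNge powR_ge0 orbF powR_eq0 => /andP[].
have s0 : 0 < sqn x by rewrite lt_neqAle eq_sym sN0 sqn_ge0.
set s := sqn x in s0 Sa *.
(* In place of Jensen's inequality: either a <= s, or a <= a^p / s^(p-1). Averaging gives the
   constant 1 + C0. *)
apply: (@le_trans _ _ (\sum_e (s + a e `^ p / s `^ (p - 1)))).
  apply: ler_sum => e _; rewrite -/(F e) -/(a e).
  have [as_|sa] := leP (a e) s.
    by rewrite (le_trans as_)// lerDl divr_ge0 ?powR_ge0.
  have ap : 0 < a e := lt_trans s0 sa.
  apply: (@le_trans _ _ (a e `^ p / s `^ (p - 1))); last by rewrite lerDr ltW.
  rewrite ler_pdivlMr ?powR_gt0// -[leRHS](mulr_powRB1 (a0 e) p0) ler_wpM2l//.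
  by rewrite ge0_ler_powR ?nnegrE ?subr_ge0 ?(ltW s0) ?(ltW sa).
rewrite big_split /= sumr_const card_ffun card_bool card_ord -mulr_suml.
rewrite -[s *+ _]mulr_natr natrX.
have -> : 2 ^+ n * ((1 + C0) * s) = s * 2 ^+ n + 2 ^+ n * (C0 * s) by ring.
rewrite lerD2l ler_pdivrMr ?powR_gt0//; apply: (le_trans Sa).
by rewrite -!mulrA mulr_powRB1// ltW.
Qed.

(** By linearity V_k applied to a random sum is the random sum of the V_k x_j, so the lower
    Khintchine inequality can be used pointwise on vectors indexed by [K]. *)
Lemma sqn_le_rademacher_mean (K : finType) (V : K -> X -> X) (C : R) :
  0 <= C -> (forall k, linear (V k)) ->
  (forall x, sqn (V^~ x) <= C * rnorm x) ->
  forall n (x : 'I_n -> X),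
    sqn (fun jk : 'I_n * K => V jk.2 (x jk.1)) <= 2 * C * rademacher_mean x.
Proof.
move=> C0 lV HV n x.
have h2 : 0 < 2 ^+ n :> R by rewrite exprn_gt0.
pose F (e : {ffun 'I_n -> bool}) : X := \sum_(j < n) ((-1 : R[i]) ^+ e j) *: x j.
apply: (@le_trans _ _ (\sum_(e : {ffun 'I_n -> bool}) (2 / 2 ^+ n) * sqn (V^~ (F e)))); last first.
  rewrite /rademacher_mean -mulr_sumr -[leRHS]mulrA [C * _]mulrCA [leRHS]mulrA ler_wpM2l ?divr_ge0 ?(ltW h2)//.
  by rewrite mulr_sumr; apply: ler_sum => e _; exact: HV.
apply: sqn_le_lincomb => [e|]; first by rewrite divr_ge0 ?(ltW h2).
have : \forall w \ae mu, forall e : {ffun 'I_n -> bool}, forall k,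
    Lp_rep (V k (F e)) w = \sum_j ((-1) ^+ e j) * Lp_rep (V k (x j)) w.
  apply: filter_forall => e; apply: filter_forall => k.
  by rewrite /F (linear_lincomb (lV k)); exact: Lp_rep_lincomb.
apply: filterS => w Hw; rewrite -mulr_sumr -mulrA.
have := khintchine_lower (fun j k => Lp_rep (V k (x j)) w).
rewrite pair_bigA /=; congr (_ <= _ * (_ * _)).
by apply: eq_bigr => e _; rewrite /sqf; under [in RHS]eq_bigr do rewrite Hw.
Qed.

(* Apply the hypothesis to the random sums of the x_i and use Khintchine's
   inequality on both sides. *)
Lemma sqn_extension : exists2 M : R, 0 < M & forall (K : finType)
  (V : K -> X -> X) (C : R), 0 <= C -> (forall k, linear (V k)) ->
  (forall x, sqn (V^~ x) <= C * rnorm x) ->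
  forall (I : finType) (x : I -> X),
    sqn (fun ik : I * K => V ik.2 (x ik.1)) <= M * C * sqn x.
Proof.
have [C1 C10 H1] := rademacher_mean_le_sqn.
exists (2 * C1); first by rewrite mulr_gt0.
move=> K V C C0 lV HV I x.
have be : bijective (@enum_val I I) by exact: enum_val_bij.
rewrite -(sqn_reindex x be) -(@sqn_reindex _ _ (fun jk => (@enum_val I I jk.1, jk.2))); last first.
  case: be => g g1 g2; exists (fun ik => (g ik.1, ik.2)) => -[i k] /=; by rewrite ?g1 ?g2.
apply: (le_trans (sqn_le_rademacher_mean C0 lV HV (fun j => x (@enum_val I I j)))).
have -> : 2 * C1 * C * sqn (fun j => x (@enum_val I I j)) = 2 * C * (C1 * sqn (fun j => x (@enum_val I I j))) by ring.
by rewrite ler_wpM2l ?mulr_ge0.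
Qed.

Lemma sqn_le_rademacher n (x : 'I_n -> X) : sqn x <= 2 * rademacher_mean x.
Proof.
have := @sqn_le_rademacher_mean unit (fun _ => id) 1 ler01.
have l1 : unit -> linear (id : X -> X) by [].
move=> /(_ l1) H; have {H} := H _ n x.
rewrite mulr1 => H; apply: le_trans (H _); last by move=> y; rewrite sqn1 mul1r.
rewrite -[leRHS]mul1r; apply: sqn_le => //; apply: aeW => w.
rewrite expr1n mul1r -(pair_bigA _ (fun j (u : unit) => normc (Lp_rep (x j) w) ^+ 2)) /=.
by apply: ler_sum => j _; rewrite (big_pred1 tt)//; case.
Qed.

Definition l2_bounded (C : R) (F : set (X -> X)) := forall (I : finType)
  (S : I -> X -> X) (x : I -> X), (forall i, F (S i)) ->
  sqn (fun i => S i (x i)) <= C * sqn x.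

Lemma R_bounded_l2 (F : set (X -> X)) : R_bounded F ->
  exists2 C : R, 0 <= C & l2_bounded C F.
Proof.
have [C1 C10 H1] := rademacher_mean_le_sqn.
case=> C C0 HF; exists (2 * (C * C1)).
  by rewrite !mulr_ge0 ?(ltW C10).
move=> I S x FS.
have be : bijective (@enum_val I I) by exact: enum_val_bij.
rewrite -(sqn_reindex x be) -(sqn_reindex (fun i => S i (x i)) be).
apply: (le_trans (sqn_le_rademacher _)).
rewrite -mulrA ler_wpM2l// -mulrA; apply: (le_trans (HF _ (fun j => S (enum_val j)) (fun j => x (enum_val j)) _)) => //.
by rewrite ler_wpM2l.
Qed.

Lemma l2_R_bounded (F : set (X -> X)) (C : R) : 0 <= C -> l2_bounded C F ->
  R_bounded F.
Proof.
have [C1 C10 H1] := rademacher_mean_le_sqn.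
move=> C0 HF; exists (C1 * (C * 2)).
  by rewrite !mulr_ge0 ?(ltW C10).
move=> n S x FS; apply: (le_trans (H1 _ _)).
rewrite -mulrA ler_wpM2l ?(ltW C10)//; apply: (le_trans (HF _ _ _ FS)).
by rewrite -mulrA ler_wpM2l// sqn_le_rademacher.
Qed.

End KhintchineLp.

(** * Operations preserving boundedness on Lp(l2) *)

Section L2Calculus.
Context d (Omega : measurableType d) (R : realType).
Variables (mu : {measure set Omega -> \bar R}) (p : R) (p1 : 1 <= p).
Let p0 : 0 < p. Proof. exact: lt_le_trans p1. Qed.
Local Notation X := (Lp mu p1).
Implicit Types (F G : set (X -> X)).

Lemma sqnD (I : finType) (x y : I -> X) : sqn (fun i => x i + y i) <= sqn x + sqn y.
Proof.
have -> : sqn x + sqn y = \sum_(b : bool) 1 * sqn (if b then x else y).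
  by rewrite big_bool !mul1r.
apply: (@sqn_le_lincomb _ _ _ mu p p1 _ (fun=> 1) (fun=> I)
  (fun b => if b then x else y)) => //.
have : \forall w \ae mu, forall i, Lp_rep (x i + y i) w = Lp_rep (x i) w + Lp_rep (y i) w.
  by apply: filter_forall => i; apply: filterS (Lp_repD (x i) (y i)) => w /(_ Logic.I).
apply: filterS => w H; rewrite big_bool !mul1r.
rewrite -ler_sqr ?nnegrE ?addr_ge0 ?sqf_ge0// sqrrD !sqf_sqr.
pose a i := normc (Lp_rep (x i) w); pose b i := normc (Lp_rep (y i) w).
apply: (@le_trans _ _ (\sum_i (a i + b i) ^+ 2)).
  apply: ler_sum => i _; rewrite H ler_sqr ?nnegrE ?addr_ge0 ?normc_ge0//.
  exact: le_normcD.
have -> : \sum_i (a i + b i) ^+ 2 = \sum_i a i ^+ 2 + (\sum_i a i * b i) *+ 2 + \sum_i b i ^+ 2.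
  by rewrite -sumrMnl -!big_split; apply: eq_bigr => i _ /=; rewrite sqrrD.
rewrite lerD2r lerD2l lerMn2r/=.
rewrite -ler_sqr ?nnegrE ?mulr_ge0 ?sqf_ge0//; last first.
  by apply: sumr_ge0 => i _; rewrite mulr_ge0 ?normc_ge0.
by rewrite exprMn !sqf_sqr; exact: cauchy_schwarz_sum.
Qed.

Lemma sqnZ_le (I : finType) (c : R) (x : I -> X) (a : I -> R[i]) : 0 <= c ->
  (forall i, normc (a i) <= c) -> sqn (fun i => a i *: x i) <= c * sqn x.
Proof.
move=> c0 ac; apply: sqn_le => //.
have : \forall w \ae mu, forall i, Lp_rep (a i *: x i) w = a i * Lp_rep (x i) w.
  by apply: filter_forall => i; exact: Lp_repZ_ae.
apply: filterS => w H; rewrite mulr_sumr; apply: ler_sum => i _.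
by rewrite H normcM exprMn ler_wpM2r ?sqr_ge0// ler_sqr ?nnegrE ?normc_ge0.
Qed.

Lemma sqnN (I : finType) (x : I -> X) : sqn (fun i => - x i) <= sqn x.
Proof.
rewrite -[leRHS]mul1r.
have -> : (fun i => - x i) = (fun i => (-1 : R[i]) *: x i).
  by apply/funext => i; rewrite scaleN1r.
by apply: sqnZ_le => // i; rewrite normcN normc1.
Qed.

Lemma sqnB (I : finType) (x y : I -> X) : sqn (fun i => x i - y i) <= sqn x + sqn y.
Proof. by apply: (le_trans (sqnD _ _)); rewrite lerD2l; exact: sqnN. Qed.

Lemma rnormD (x y : X) : rnorm (x + y) <= rnorm x + rnorm y.
Proof. by have := sqnD (fun _ : unit => x) (fun _ => y); rewrite !sqn1. Qed.

Lemma rnormZ (a : R[i]) (x : X) : rnorm (a *: x) = normc a * rnorm x.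
Proof.
have := Lp_normZ a x; have -> : `|a| = ((normc a)%:C)%C by [].
by rewrite -rmorphM => /complexI.
Qed.

Lemma rnormN (x : X) : rnorm (- x) = rnorm x.
Proof. by rewrite -scaleN1r rnormZ normcN normc1 mul1r. Qed.

Lemma rnormB (x y : X) : rnorm (x - y) <= rnorm x + rnorm y.
Proof. by rewrite -(rnormN y); exact: rnormD. Qed.

Lemma rnorm0 : rnorm (0 : X) = 0.
Proof. by rewrite -(scale0r (0 : X)) rnormZ normc0 mul0r. Qed.

Lemma rnorm_sum (J : Type) (s : seq J) (P : pred J) (x : J -> X) :
  rnorm (\sum_(i <- s | P i) x i) <= \sum_(i <- s | P i) rnorm (x i).
Proof.
elim/big_rec2: _ => [|i a b _ H]; first by rewrite rnorm0.
by rewrite (le_trans (rnormD _ _))// lerD2l.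
Qed.

Lemma rnorm0_eq0 (x : X) : rnorm x = 0 -> x = 0.
Proof. by move=> x0; apply: Lp_norm_eq0; rewrite -rnormE x0. Qed.

Definition compset F G : set (X -> X) :=
  [set S | exists A B, [/\ F A, G B & forall x, S x = A (B x)]].

Definition linset F := forall A, F A -> linear A.

Lemma linset_comp F G : linset F -> linset G -> linset (compset F G).
Proof.
move=> lF lG S [A [B [FA GB SE]]] a u v.
by rewrite !SE (lG _ GB) (lF _ FA).
Qed.

Lemma l2_bounded_comp C C' F G : 0 <= C -> l2_bounded C F -> l2_bounded C' G ->
  l2_bounded (C * C') (compset F G).
Proof.
move=> C0 HF HG I S x HS.
have [A HA] := choice HS; have [B HB] := choice HA.
rewrite (_ : (fun i => _) = (fun i => A i (B i (x i)))); last first.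
  by apply/funext => i; case: (HB i) => _ _ ->.
apply: (le_trans (HF _ _ _ _)) => [i|]; first by case: (HB i).
by rewrite -mulrA ler_wpM2l//; apply: HG => i; case: (HB i).
Qed.

(** The index set is cut in two according to the set chosen for each operator, and each piece is
    treated as a family of its own. *)
Lemma l2_boundedU C C' F G : 0 <= C -> 0 <= C' -> l2_bounded C F -> l2_bounded C' G ->
  l2_bounded (C + C') (F `|` G).
Proof.
move=> C0 C0' HF HG I S x HS.
have H i : exists b : bool, if b then F (S i) else G (S i).
  by case: (HS i) => ?; [exists true|exists false].
have [b Hb] := choice H.
pose J (c : bool) : finType := {i in [pred i | b i == c]}.
have Jsum c (f : I -> R) : \sum_(u : J c) f (val u) = \sum_(i | b i == c) f i.
  by rewrite -(big_sub [pred i | b i == c] f).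
have bJ c (j : J c) : b (val j) = c by apply/eqP; exact: (valP j).
have le c : sqn (fun j : J c => x (val j)) <= sqn x.
  rewrite -[leRHS]mul1r; apply: sqn_le => //; apply: aeW => w.
  rewrite expr1n mul1r (Jsum c (fun i => normc (Lp_rep (x i) w) ^+ 2)).
  rewrite [leRHS](bigID (fun i => b i == c)) /= lerDl.
  by apply: sumr_ge0 => i _; exact: sqr_ge0.
apply: (@le_trans _ _ (\sum_(c : bool) 1 * sqn (fun j : J c => S (val j) (x (val j))))).
  apply: (@sqn_le_lincomb _ _ _ mu p p1 _ (fun=> 1) J
    (fun c (j : J c) => S (val j) (x (val j)))) => //.
  apply: aeW => w; rewrite big_bool !mul1r.
  rewrite -ler_sqr ?nnegrE ?addr_ge0 ?sqf_ge0// sqrrD !sqf_sqr.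
  rewrite (bigID (fun i => b i == true)) /=.
  rewrite !(Jsum _ (fun i => normc (Lp_rep (S i (x i)) w) ^+ 2)).
  rewrite (eq_bigl (fun i => b i == false) (fun i => normc (Lp_rep (S i (x i)) w) ^+ 2) (P1 := fun i => b i != true)); last first.
    by move=> i; case: (b i).
  by rewrite addrAC lerDl mulrn_wge0// mulr_ge0 ?sqf_ge0.
rewrite big_bool !mul1r mulrDl lerD//.
  apply: (@le_trans _ _ (C * sqn (fun j : J true => x (val j)))); last by rewrite ler_wpM2l.
  by apply: (HF _ (fun j : J true => S (val j)) (fun j => x (val j))) => j; have := Hb (val j); rewrite bJ.
apply: (@le_trans _ _ (C' * sqn (fun j : J false => x (val j)))); last by rewrite ler_wpM2l.
by apply: (HG _ (fun j : J false => S (val j)) (fun j => x (val j))) => j; have := Hb (val j); rewrite bJ.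
Qed.

(** [L] times the absolutely convex hull of [F], with complex coefficients and combinations of any
    finite length. *)
Definition absconv (L : R) F : set (X -> X) :=
  [set S | exists (m : nat) (c : 'I_m -> R[i]) (A : 'I_m -> X -> X),
    [/\ forall i, F (A i), \sum_i normc (c i) <= L &
        forall x, S x = \sum_i c i *: A i x]].

Lemma linset_absconv L F : linset F -> linset (absconv L F).
Proof.
move=> lF S [m [c [A [FA _ SE]]]] a u v.
rewrite !SE scaler_sumr -big_split; apply: eq_bigr => i _ /=.
by rewrite (lF _ (FA i)) scalerDr !scalerA mulrC.
Qed.

Lemma normc_sqrt (a : R) : 0 <= a -> normc ((Num.sqrt a)%:C)%C ^+ 2 = a.
Proof. by move=> a0; rewrite normc_real real_normK ?num_real// sqr_sqrtr. Qed.

(* Weighted Cauchy-Schwarz absorbs half of each coefficient into the argument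
   and half into the value. *)
Lemma normc_lincomb_sqr m (c z : 'I_m -> R[i]) (L : R) : \sum_i normc (c i) <= L ->
  normc (\sum_i c i * z i) ^+ 2 <= L * \sum_i normc (c i) * normc (z i) ^+ 2.
Proof.
move=> cL; pose s i := Num.sqrt (normc (c i)).
have ss i : s i ^+ 2 = normc (c i) by rewrite sqr_sqrtr// normc_ge0.
have s0 i : 0 <= s i by exact: sqrtr_ge0.
apply: (@le_trans _ _ ((\sum_i s i * (s i * normc (z i))) ^+ 2)).
  rewrite ler_sqr ?nnegrE ?normc_ge0//; last first.
    by apply: sumr_ge0 => i _; rewrite !mulr_ge0 ?normc_ge0.
  apply: (le_trans (normc_sum _ _ _)); apply: ler_sum => i _.
  by rewrite normcM mulrA -expr2 ss.
apply: (le_trans (cauchy_schwarz_sum _ _)).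
under eq_bigr do rewrite ss.
under [X in _ * X <= _]eq_bigr do rewrite exprMn ss.
by rewrite ler_wpM2r// sumr_ge0// => i _; rewrite mulr_ge0 ?normc_ge0 ?sqr_ge0.
Qed.

(** Expand every operator, so that the new index is a pair formed of an index and a term of its
    combination. The bound [L] on the coefficients is used once on the values and once on the
    arguments, each time through a square root; no extra constant appears. *)
Lemma l2_bounded_absconv (L C : R) F : 0 <= L -> 0 <= C -> linset F ->
  l2_bounded C F -> l2_bounded (L * C) (absconv L F).
Proof.
move=> L0 C0 lF HF I S x HS.
have HS' i : exists t : {m : nat & (('I_m -> R[i]) * ('I_m -> X -> X))%type},
    [/\ forall j, F ((tagged t).2 j), \sum_j normc ((tagged t).1 j) <= L &
        forall x, S i x = \sum_j (tagged t).1 j *: (tagged t).2 j x].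
  by have [m [c [A HA]]] := HS i; exists (Tagged (fun m => (('I_m -> R[i]) * ('I_m -> X -> X))%type) (c, A)).
have [t Ht] := choice HS'.
pose m i := tag (t i); pose c i : 'I_(m i) -> R[i] := (tagged (t i)).1.
pose A i : 'I_(m i) -> X -> X := (tagged (t i)).2.
have HA i : [/\ forall j, F (A i j), \sum_j normc (c i j) <= L &
    forall x, S i x = \sum_j c i j *: A i j x] by exact: Ht.
pose s i j : R[i] := ((Num.sqrt (normc (c i j)))%:C)%C.
pose J : finType := {i : I & 'I_(m i)}.
have [l ll l0] : exists2 l : R, l ^+ 2 = L & 0 <= l.
  by exists (Num.sqrt L); rewrite ?sqr_sqrtr ?sqrtr_ge0.
have Jsum (f : forall i, 'I_(m i) -> R) :
    \sum_(u : J) f (tag u) (tagged u) = \sum_i \sum_(j : 'I_(m i)) f i j.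
  by rewrite sig_big_dep.
apply: (@le_trans _ _ (l * sqn (fun u : J => s (tag u) (tagged u) *: A (tag u) (tagged u) (x (tag u))))).
  apply: sqn_le => //.
  have h1 : \forall w \ae mu, forall i, Lp_rep (S i (x i)) w =
      \sum_j c i j * Lp_rep (A i j (x i)) w.
    apply: filter_forall => i; case: (HA i) => _ _ ->; exact: Lp_rep_lincomb.
  have h2 : \forall w \ae mu, forall u : J,
      Lp_rep (s (tag u) (tagged u) *: A (tag u) (tagged u) (x (tag u))) w =
      s (tag u) (tagged u) * Lp_rep (A (tag u) (tagged u) (x (tag u))) w.
    by apply: filter_forall => u; exact: Lp_repZ_ae.
  apply: filterS2 h1 h2 => w h1 h2; rewrite ll.
  under [X in _ <= _ * X]eq_bigr do rewrite h2 normcM exprMn normc_sqrt ?normc_ge0//.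
  rewrite (Jsum (fun i j => normc (c i j) * normc (Lp_rep (A i j (x i)) w) ^+ 2)).
  rewrite mulr_sumr; apply: ler_sum => i _; rewrite h1.
  by apply: normc_lincomb_sqr; case: (HA i).
rewrite -ll expr2 -!mulrA ler_wpM2l//.
rewrite (_ : (fun u : J => _) = (fun u : J => A (tag u) (tagged u) (s (tag u) (tagged u) *: x (tag u)))); last first.
  apply/funext => u; case: (HA (tag u)) => FA _ _.
  have := linear_lincomb (lF _ (FA (tagged u))) [:: tt] (fun=> s (tag u) (tagged u)) (fun=> x (tag u)).
  by rewrite !big_seq1.
apply: (le_trans (HF J (fun u => A (tag u) (tagged u))
    (fun u => s (tag u) (tagged u) *: x (tag u)) _)) => [u|].
  by case: (HA (tag u)).
rewrite [leRHS]mulrCA ler_wpM2l//; apply: sqn_le => //.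
have h : \forall w \ae mu, forall u : J,
    Lp_rep (s (tag u) (tagged u) *: x (tag u)) w = s (tag u) (tagged u) * Lp_rep (x (tag u)) w.
  by apply: filter_forall => u; exact: Lp_repZ_ae.
apply: filterS h => w h.
under eq_bigr do rewrite h normcM exprMn normc_sqrt ?normc_ge0//.
rewrite (Jsum (fun i j => normc (c i j) * normc (Lp_rep (x i) w) ^+ 2)).
rewrite ll mulr_sumr; apply: ler_sum => i _.
rewrite -mulr_suml ler_wpM2r ?sqr_ge0//.
by case: (HA i).
Qed.

Definition ptclosure F : set (X -> X) :=
  [set S | forall x e, 0 < e -> exists2 A, F A & rnorm (S x - A x) <= e].

Lemma l2_bounded_ptclosure C F : l2_bounded C F -> l2_bounded C (ptclosure F).
Proof.
move=> HF I S x HS; apply/ler_addgt0Pr => e e0.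
(* The summand 1 covers the empty family. *)
pose e' := e / (#|I|%:R + 1).
have c0 : 0 < #|I|%:R + 1 :> R by rewrite ltr_wpDl.
have e'0 : 0 < e' by rewrite divr_gt0.
have H i : exists A, F A /\ rnorm (S i (x i) - A (x i)) <= e'.
  by have [A ? ?] := HS i (x i) _ e'0; exists A.
have [A HA] := choice H.
rewrite (_ : (fun i => _) = (fun i => A i (x i) + (S i (x i) - A i (x i)))); last first.
  by apply/funext => i; rewrite addrCA subrr addr0.
apply: (le_trans (sqnD _ _)); rewrite lerD//.
  by apply: HF => i; case: (HA i).
apply: (le_trans (sqn_le_sum _)); apply: (@le_trans _ _ (\sum_(i : I) e')).
  by apply: ler_sum => i _; case: (HA i).
rewrite sumr_const -[_ *+ _]mulr_natr /e' mulrAC ler_pdivrMr// ler_wpM2l ?(ltW e0)//.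
by rewrite lerDl.
Qed.

Lemma l2_bounded_sub C F G : F `<=` G -> l2_bounded C G -> l2_bounded C F.
Proof. by move=> FG HG I S x HS; apply: HG => i; exact: FG. Qed.

(** Meant for the operators (l - 1) R(l, T) - 1 = R(l, T) (T - 1). *)
Lemma l2_bounded_subid C F : l2_bounded C F ->
  l2_bounded (C + 1) [set S | exists2 A, F A & forall x, S x = A x - x].
Proof.
move=> HF I S x HS; have H i : exists A, F A /\ forall x, S i x = A x - x.
  by have [A ? ?] := HS i; exists A.
have [A HA] := choice H.
rewrite (_ : (fun i => _) = (fun i => A i (x i) - x i)); last first.
  by apply/funext => i; case: (HA i) => _ ->.
apply: (le_trans (sqnB _ _)); rewrite mulrDl mul1r lerD2r.
by apply: HF => i; case: (HA i).
Qed.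

Lemma l2_bounded_opnorm C F A : l2_bounded C F -> F A -> opnorm_le C A.
Proof.
by move=> HF FA x; have := HF unit (fun=> A) (fun=> x) (fun=> FA); rewrite !sqn1.
Qed.

End L2Calculus.

(** * The duality pairing *)

Section ComplexIntegral.
Context d (Omega : measurableType d) (R : realType).
Variables (mu : {measure set Omega -> \bar R}).
Implicit Types f g : Omega -> R[i].

Definition cintegrable f : Prop :=
  cmeasurable f /\ (\int[mu]_w (normc (f w))%:E < +oo)%E.

Lemma cmeasurableM f g : cmeasurable f -> cmeasurable g -> cmeasurable (fun w => f w * g w).
Proof.
case=> fr fi [gr gi]; split.
  rewrite (_ : (fun w => _) = (fun w => complex.Re (f w) * complex.Re (g w)) \-
      (fun w => complex.Im (f w) * complex.Im (g w))).
    by apply: measurable_funB; apply: measurable_funM.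
  by apply/funext => w /=; case: (f w) (g w) => [? ?] [].
rewrite (_ : (fun w => _) = (fun w => complex.Re (f w) * complex.Im (g w)) \+
    (fun w => complex.Im (f w) * complex.Re (g w))).
  by apply: measurable_funD; apply: measurable_funM.
by apply/funext => w /=; case: (f w) (g w) => [? ?] [].
Qed.

Lemma cmeasurable_real (h : Omega -> R) : measurable_fun setT h ->
  cmeasurable (fun w => ((h w)%:C)%C).
Proof. by move=> mh; split => //=; exact: measurable_cst. Qed.

Lemma cmeasurable_conj f : cmeasurable f -> cmeasurable (fun w => ((f w)^*)%C).
Proof.
case=> fr fi; split.
  by rewrite (_ : (fun w => _) = (fun w => complex.Re (f w)))//; apply/funext => w; case: (f w).
rewrite (_ : (fun w => _) = \- (fun w => complex.Im (f w))); last first.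
  by apply/funext => w /=; case: (f w).
exact: measurableT_comp.
Qed.

Lemma cmeasurable_sum (J : Type) (s : seq J) (f : J -> Omega -> R[i]) :
  (forall i, cmeasurable (f i)) -> cmeasurable (fun w => \sum_(i <- s) f i w).
Proof.
move=> mf; split.
  rewrite (_ : (fun w => _) = (fun w => \sum_(i <- s) complex.Re (f i w))).
    by apply: measurable_sum => i; case: (mf i).
  by apply/funext => w; rewrite Re_sum.
rewrite (_ : (fun w => _) = (fun w => \sum_(i <- s) complex.Im (f i w))).
  by apply: measurable_sum => i; case: (mf i).
by apply/funext => w; rewrite Im_sum.
Qed.

Lemma cintegrable_Re f : cintegrable f ->
  mu.-integrable setT (EFin \o (fun w => complex.Re (f w))).
Proof.
case=> -[mr mi] fi; apply/integrableP; split; first exact/measurable_EFinP.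
apply: le_lt_trans fi; apply: ge0_le_integral => //.
- by apply/measurable_EFinP; apply: measurableT_comp.
- by apply/measurable_EFinP; exact: cmeasurable_normc.
- by move=> w _ /=; rewrite lee_fin normr_Re_le.
Qed.

Lemma cintegrable_Im f : cintegrable f ->
  mu.-integrable setT (EFin \o (fun w => complex.Im (f w))).
Proof.
case=> -[mr mi] fi; apply/integrableP; split; first exact/measurable_EFinP.
apply: le_lt_trans fi; apply: ge0_le_integral => //.
- by apply/measurable_EFinP; apply: measurableT_comp.
- by apply/measurable_EFinP; exact: cmeasurable_normc.
- by move=> w _ /=; rewrite lee_fin normr_Im_le.
Qed.

Lemma eq_ae_cintegral f g : cmeasurable f -> cmeasurable g ->
  (\forall w \ae mu, f w = g w) -> cintegral mu f = cintegral mu g.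
Proof.
case=> fr fi [gr gi] fg; rewrite /cintegral; congr Complex; congr fine;
  apply: ae_eq_integral => //; try exact/measurable_EFinP.
- by apply: filterS fg => w -> _.
- by apply: filterS fg => w -> _.
Qed.

Lemma cintegrableD f g : cintegrable f -> cintegrable g ->
  cintegrable (fun w => f w + g w).
Proof.
move=> [mf fi] [mg gi]; have mfg := cmeasurableD mf mg; split => //.
apply: (@le_lt_trans _ _ (\int[mu]_w ((normc (f w))%:E + (normc (g w))%:E))%E).
  apply: ge0_le_integral => //.
  - by move=> w _; rewrite lee_fin normc_ge0.
  - by apply/measurable_EFinP; exact: cmeasurable_normc.
  - apply/measurable_EFinP; apply: measurable_funD; exact: cmeasurable_normc.
  - by move=> w _; rewrite -EFinD lee_fin le_normcD.
rewrite ge0_integralD//; try by [move=> w _; rewrite lee_fin normc_ge0|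
  apply/measurable_EFinP; exact: cmeasurable_normc].
exact: lte_add_pinfty.
Qed.

Lemma cintegrableZ (a : R[i]) f : cintegrable f -> cintegrable (fun w => a * f w).
Proof.
move=> [mf fi]; split; first exact: cmeasurableZ.
under eq_integral do rewrite normcM EFinM.
rewrite ge0_integralZl ?lee_fin ?normc_ge0//; last 2 first.
- by apply/measurable_EFinP; exact: cmeasurable_normc.
- by move=> w _; rewrite lee_fin normc_ge0.
by rewrite lte_mul_pinfty ?lee_fin ?normc_ge0.
Qed.

Lemma cintegralD f g : cintegrable f -> cintegrable g ->
  cintegral mu (fun w => f w + g w) = cintegral mu f + cintegral mu g.
Proof.
move=> fi gi; rewrite /cintegral.
rewrite [LHS](_ : _ = Complex
   (Rintegral mu setT (fun w => complex.Re (f w) + complex.Re (g w)))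
   (Rintegral mu setT (fun w => complex.Im (f w) + complex.Im (g w)))).
  rewrite !RintegralD//; [exact: cintegrable_Im|exact: cintegrable_Im|
    exact: cintegrable_Re|exact: cintegrable_Re].
by congr Complex; apply: eq_Rintegral => w _; rewrite ?ReD ?ImD.
Qed.

Lemma cintegralZ (a : R[i]) f : cintegrable f ->
  cintegral mu (fun w => a * f w) = a * cintegral mu f.
Proof.
move=> fi; have rI := cintegrable_Re fi; have iI := cintegrable_Im fi.
case: a => a b; rewrite /cintegral.
rewrite [LHS](_ : _ = Complex
   (Rintegral mu setT (fun w => a * complex.Re (f w) - b * complex.Im (f w)))
   (Rintegral mu setT (fun w => a * complex.Im (f w) + b * complex.Re (f w)))); last first.
  by congr Complex; apply: eq_Rintegral => w _; case: (f w).
have Zi c h : mu.-integrable setT (EFin \o h) ->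
    mu.-integrable setT (EFin \o (fun w => c * h w)).
  move=> hi; rewrite (_ : _ \o _ = (fun w => c%:E * (EFin \o h) w)%E); last by apply/funext.
  exact: integrableZl.
rewrite RintegralB//; [|exact: Zi|exact: Zi].
rewrite RintegralD//; [|exact: Zi|exact: Zi].
by rewrite !RintegralZl.
Qed.

Lemma cintegrable0 : cintegrable (fun=> 0).
Proof.
split; first exact: cmeasurable0.
by under eq_integral do rewrite normc0; rewrite integral0 ltry.
Qed.

Lemma cintegral0 : cintegral mu (fun=> 0) = 0.
Proof. by rewrite /cintegral /= /Rintegral integral0. Qed.

Lemma cintegrable_sum (J : Type) (s : seq J) (f : J -> Omega -> R[i]) :
  (forall i, cintegrable (f i)) -> cintegrable (fun w => \sum_(i <- s) f i w).
Proof.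
move=> fi; elim: s => [|i s IH].
  by under eq_fun do rewrite big_nil; exact: cintegrable0.
by under eq_fun do rewrite big_cons; exact: cintegrableD.
Qed.

Lemma cintegral_sum (J : Type) (s : seq J) (f : J -> Omega -> R[i]) :
  (forall i, cintegrable (f i)) ->
  cintegral mu (fun w => \sum_(i <- s) f i w) = \sum_(i <- s) cintegral mu (f i).
Proof.
move=> fi; elim: s => [|i s IH].
  by under eq_fun do rewrite big_nil; rewrite big_nil cintegral0.
under eq_fun do rewrite big_cons.
by rewrite big_cons cintegralD// ?IH//; exact: cintegrable_sum.
Qed.

(** Real and imaginary parts are bounded separately, hence the factor 2, which every later estimate
    through the pairing inherits. *)
Lemma normc_cintegral_le f : cintegrable f ->
  ((normc (cintegral mu f))%:E <= 2%:E * \int[mu]_w (normc (f w))%:E)%E.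
Proof.
move=> fi; have [mf ff] := fi.
have fin : (\int[mu]_w (normc (f w))%:E)%E \is a fin_num.
  by rewrite ge0_fin_numE// integral_ge0// => w _; rewrite lee_fin normc_ge0.
have nf : mu.-integrable setT (EFin \o (fun w => normc (f w))).
  apply/integrableP; split; first by apply/measurable_EFinP; exact: cmeasurable_normc.
  by under eq_integral => w _ do rewrite /= ger0_norm ?normc_ge0//.
rewrite -(fineK fin) -EFinM lee_fin.
apply: (le_trans (normc_le_ReIm _)) => /=.
have -> : 2 * fine (\int[mu]_w (normc (f w))%:E)%E =
  fine (\int[mu]_w (normc (f w))%:E)%E + fine (\int[mu]_w (normc (f w))%:E)%E by ring.
have nI (h : Omega -> R) : mu.-integrable setT (EFin \o h) ->
    mu.-integrable setT (EFin \o (fun w => `|h w|)).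
  by move=> hi; have := integrable_abse hi.
apply: lerD.
  apply: (le_trans (le_normr_Rintegral _ (cintegrable_Re fi))) => //.
  apply: le_Rintegral => //; first exact/nI/cintegrable_Re.
  by move=> w _; exact: normr_Re_le.
apply: (le_trans (le_normr_Rintegral _ (cintegrable_Im fi))) => //.
apply: le_Rintegral => //; first exact/nI/cintegrable_Im.
by move=> w _; exact: normr_Im_le.
Qed.

End ComplexIntegral.

Section Representatives.
Context d (Omega : measurableType d) (R : realType).
Variables (mu : {measure set Omega -> \bar R}) (p : R) (p1 : 1 <= p).
Let p0 : 0 < p. Proof. exact: lt_le_trans p1. Qed.

Lemma exists_Lp_rep (f : Omega -> R[i]) : cmeasurable f ->
  (\int[mu]_w (normc (f w) `^ p)%:E < +oo)%E ->
  exists x : Lp mu p1, \forall w \ae mu, Lp_rep x w = f w.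
Proof.
move=> mf ff.
have fP : f \in Lp_pred mu p1.
  by apply/Lp_predP; split => //; rewrite cLnormE poweR_lty.
exists (Lp_class (LpFun fP)).
by apply: filterS (Lp_rep_class (LpFun fP)) => w /(_ I).
Qed.

End Representatives.

Section Pairing.
Context d (Omega : measurableType d) (R : realType).
Variables (mu : {measure set Omega -> \bar R}) (p q : R) (p1 : 1 <= p) (q1 : 1 <= q).
Hypothesis pq : p^-1 + q^-1 = 1.
Let p0 : 0 < p. Proof. exact: lt_le_trans p1. Qed.
Let q0 : 0 < q. Proof. exact: lt_le_trans q1. Qed.
Local Notation X := (Lp mu p1).
Local Notation Y := (Lp mu q1).

(** Cauchy-Schwarz in the index, then Hölder in the variable. *)
Lemma integral_sqf_le (I : finType) (x : I -> X) (y : I -> Y) :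
  (\int[mu]_w (\sum_i normc (Lp_rep (x i) w * Lp_rep (y i) w))%:E <= (sqn x * sqn y)%:E)%E.
Proof.
rewrite EFinM !sqnE; apply: le_trans (hoelder mu _ _ p0 q0 pq).
- rewrite Lnorm1; apply: ge0_le_integral => //.
  + by move=> w _; rewrite lee_fin sumr_ge0// => i _; exact: normc_ge0.
  + apply/measurable_EFinP/measurable_sum => i; apply: cmeasurable_normc.
    apply: cmeasurableM; exact: Lp_rep_meas.
  + apply/measurable_EFinP; apply: measurableT_comp => //.
    by apply: measurable_funM; exact: measurable_sqf.
  move=> w _ /=; rewrite lee_fin ger0_norm ?mulr_ge0 ?sqf_ge0//.
  rewrite -ler_sqr ?nnegrE ?mulr_ge0 ?sqf_ge0//; last first.
    by apply: sumr_ge0 => i _; exact: normc_ge0.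
  rewrite exprMn !sqf_sqr; under eq_bigr do rewrite normcM.
  exact: cauchy_schwarz_sum.
- exact: measurable_sqf.
- exact: measurable_sqf.
Qed.

Lemma cintegrable_pairing (x : X) (y : Y) :
  cintegrable mu (fun w => Lp_rep x w * Lp_rep y w).
Proof.
split; first by apply: cmeasurableM; exact: Lp_rep_meas.
have := @integral_sqf_le unit (fun=> x) (fun=> y).
under eq_integral do rewrite (big_pred1 tt) //.
by move=> /le_lt_trans; apply; rewrite ltry.
Qed.

Lemma sum_pairing_le (I : finType) (x : I -> X) (y : I -> Y) :
  normc (\sum_i Lp_pairing (x i) (y i)) <= 2 * (sqn x * sqn y).
Proof.
have ci i : cintegrable mu (fun w => Lp_rep (x i) w * Lp_rep (y i) w).
  exact: cintegrable_pairing.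
rewrite -cintegral_sum// -lee_fin.
apply: (le_trans (normc_cintegral_le _)); first exact: cintegrable_sum.
rewrite EFinM lee_pmul2l//; apply: le_trans (integral_sqf_le x y).
apply: ge0_le_integral => //.
- by move=> w _; rewrite lee_fin normc_ge0.
- apply/measurable_EFinP/cmeasurable_normc/cmeasurable_sum => i; by case: (ci i).
- apply/measurable_EFinP/measurable_sum => i; apply: cmeasurable_normc; by case: (ci i).
- by move=> w _; rewrite lee_fin normc_sum.
Qed.

Lemma pairing_le (x : X) (y : Y) :
  normc (Lp_pairing x y) <= 2 * (rnorm x * rnorm y).
Proof.
have := @sum_pairing_le unit (fun=> x) (fun=> y).
by rewrite (big_pred1 tt)// !sqn1.
Qed.

Lemma pairing_lincombl (J : finType) (a : J -> R[i]) (x : J -> X) (y : Y) :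
  Lp_pairing (\sum_j a j *: x j) y = \sum_j a j * Lp_pairing (x j) y.
Proof.
have ci j : cintegrable mu (fun w => Lp_rep (x j) w * Lp_rep y w).
  exact: cintegrable_pairing.
under [RHS]eq_bigr do rewrite -cintegralZ//.
rewrite -cintegral_sum; last by move=> j; apply: cintegrableZ.
apply: eq_ae_cintegral.
- by apply: cmeasurableM; exact: Lp_rep_meas.
- by apply: cmeasurable_sum => j; apply: cmeasurableZ; case: (ci j).
apply: filterS (Lp_rep_lincomb a x) => w ->; rewrite mulr_suml.
by apply: eq_bigr => j _; rewrite mulrA.
Qed.

End Pairing.

Lemma Lp_pairingC d (Omega : measurableType d) (R : realType)
  (mu : {measure set Omega -> \bar R}) (p q : R) (p1 : 1 <= p) (q1 : 1 <= q)
  (x : Lp mu p1) (y : Lp mu q1) : Lp_pairing x y = Lp_pairing y x.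
Proof. by congr cintegral; apply/funext => w; rewrite mulrC. Qed.

Section Norming.
Context d (Omega : measurableType d) (R : realType).
Variables (mu : {measure set Omega -> \bar R}) (p q : R) (p1 : 1 <= p) (q1 : 1 <= q).
Hypotheses (pgt1 : 1 < p) (pq : p^-1 + q^-1 = 1).
Let p0 : 0 < p. Proof. exact: lt_le_trans p1. Qed.
Let q0 : 0 < q. Proof. exact: lt_le_trans q1. Qed.
Local Notation X := (Lp mu p1).
Local Notation Y := (Lp mu q1).

Lemma conjugate_mul : (p - 1) * q = p.
Proof.
have : q = p / (p - 1).
  rewrite -[q]invrK; have -> : q^-1 = (p - 1) / p.
    have -> : q^-1 = 1 - p^-1 by rewrite -pq addrAC subrr add0r.
    by field; rewrite gt_eqF.
  by rewrite invf_div.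
by move=> ->; field; rewrite subr_eq0 gt_eqF.
Qed.

(** With s the square function of [z], take y_i = s^(p-2) conj z_i. Its square function is s^(p-1),
    whose q-th power is s^p since (p - 1) q = p. The norm is attained exactly, so that no constant
    is lost in passing to the dual. *)
Lemma norming_family (I : finType) (z : I -> X) : exists y : I -> Y,
  sqn y = sqn z `^ (p - 1) /\
  \sum_i Lp_pairing (z i) (y i) = ((sqn z `^ p)%:C)%C.
Proof.
pose s := sqf z.
have s0 w : 0 <= s w by exact: sqf_ge0.
have ms : measurable_fun setT s by exact: measurable_sqf.
pose f i w : R[i] := (((s w) `^ (p - 2))%:C * (Lp_rep (z i) w)^*)%C.
have mf i : cmeasurable (f i).
  apply: cmeasurableM; first by apply: cmeasurable_real; exact: measurable_powR_comp.
  by apply: cmeasurable_conj; exact: Lp_rep_meas.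
have nf i w : normc (f i w) = s w `^ (p - 2) * normc (Lp_rep (z i) w).
  by rewrite /f normcM normc_real normc_conj ger0_norm ?powR_ge0.
have zs i w : normc (Lp_rep (z i) w) <= s w.
  rewrite -ler_sqr ?nnegrE ?normc_ge0// sqf_sqr (bigD1 i)//= lerDl.
  by apply: sumr_ge0 => j _; exact: sqr_ge0.
have sp w (r : R) : r != 0 -> s w `^ (r - 1) * s w = s w `^ r.
  move=> r0; have [->|sN0] := eqVneq (s w) 0; first by rewrite mulr0 powR0.
  by rewrite -[X in _ * X]powRr1// -powRD ?subrK// sN0 implybT.
have sqf_f w : Num.sqrt (\sum_i normc (f i w) ^+ 2) = s w `^ (p - 1).
  under eq_bigr do rewrite nf exprMn.
  rewrite -mulr_sumr -sqf_sqr -/(s w) -exprMn sqrtr_sqr.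
  have -> : p - 2 = (p - 1) - 1 by ring.
  by rewrite sp ?ger0_norm ?powR_ge0// subr_eq0 gt_eqF.
have spq w : (s w `^ (p - 1)) `^ q = s w `^ p by rewrite -powRrM conjugate_mul.
have sfin : (\int[mu]_w (s w `^ p)%:E < +oo)%E by rewrite -sqn_powR ltry.
have ex i : exists y : Y, \forall w \ae mu, Lp_rep y w = f i w.
  apply: exists_Lp_rep; first exact: mf.
  apply: le_lt_trans sfin.
  apply: ge0_le_integral => //.
  - by move=> w _; rewrite lee_fin powR_ge0.
  - by apply/measurable_EFinP/measurable_powR_comp; exact: cmeasurable_normc.
  - by apply/measurable_EFinP/measurable_powR_comp.
  move=> w _; rewrite lee_fin -spq ge0_ler_powR ?nnegrE ?normc_ge0 ?powR_ge0 ?(ltW q0)//.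
  rewrite -sqf_f -ler_sqr ?nnegrE ?normc_ge0 ?sqrtr_ge0// sqr_sqrtr ?sqrsum_ge0//.
  by rewrite (bigD1 i)//= lerDl; apply: sumr_ge0 => j _; exact: sqr_ge0.
have [y Hy] := choice ex; exists y.
have Hyw : \forall w \ae mu, forall i, Lp_rep (y i) w = f i w by exact: filter_forall.
have sqny : ((sqn y `^ q)%:E = (sqn z `^ p)%:E)%E.
  rewrite !sqn_powR; apply: ge0_ae_eq_integral => //.
  - by apply/measurable_EFinP/measurable_powR_comp; exact: measurable_sqf.
  - by apply/measurable_EFinP/measurable_powR_comp; exact: measurable_sqf.
  - by move=> w _; rewrite lee_fin powR_ge0.
  - by move=> w _; rewrite lee_fin powR_ge0.
  apply: filterS Hyw => w Hw _; congr EFin; rewrite -spq -sqf_f; congr (Num.sqrt _ `^ q).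
  by apply: eq_bigr => i _; rewrite Hw.
split.
  move: sqny => [] /(congr1 (fun t => t `^ q^-1)).
  rewrite -!powRrM mulfV ?gt_eqF// powRr1 ?sqn_ge0// => ->.
  by congr (_ `^ _); rewrite -[p in LHS]conjugate_mul mulfK// gt_eqF.
have ci i : cintegrable mu (fun w => Lp_rep (z i) w * Lp_rep (y i) w).
  exact: cintegrable_pairing.
rewrite -cintegral_sum//.
transitivity (cintegral mu (fun w => ((s w `^ p)%:C)%C)).
  apply: eq_ae_cintegral.
  - by apply: cmeasurable_sum => i; case: (ci i).
  - by apply: cmeasurable_real; exact: measurable_powR_comp.
  apply: filterS Hyw => w Hw.
  transitivity (\sum_i ((s w `^ (p - 2) * normc (Lp_rep (z i) w) ^+ 2)%:C)%C).
    apply: eq_bigr => i _; rewrite Hw /f mulrCA rmorphM; congr (_ * _).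
    rewrite sqr_normcE; case: (Lp_rep (z i) w) => a b.
    by apply/eqP; rewrite eq_complex /=; apply/andP; split; apply/eqP; ring.
  rewrite -rmorph_sum -mulr_sumr -sqf_sqr -/(s w); congr (_%:C)%C.
  rewrite expr2 mulrA.
  have -> : p - 2 = (p - 1) - 1 by ring.
  by rewrite !sp ?subr_eq0 ?gt_eqF.
rewrite /cintegral /=; congr Complex; last by rewrite /Rintegral integral0.
by apply: EFin_inj; rewrite sqn_powR /Rintegral fineK// ge0_fin_numE// integral_ge0// => w _; rewrite lee_fin powR_ge0.
Qed.

Lemma sqn_le_dual (I : finType) (z : I -> X) (A : R) : 0 <= A ->
  (forall y : I -> Y, normc (\sum_i Lp_pairing (z i) (y i)) <= A * sqn y) ->
  sqn z <= A.
Proof.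
move=> A0 H; have [y [ny zy]] := norming_family z.
have [->//|zN0] := eqVneq (sqn z) 0.
have z0 : 0 < sqn z by rewrite lt_neqAle eq_sym zN0 sqn_ge0.
have := H y; rewrite zy ny normc_real ger0_norm ?powR_ge0//.
by rewrite -(mulr_powRB1 (ltW z0) p0) ler_pM2r ?powR_gt0.
Qed.

Lemma pairing_eq0 (z : X) : (forall y : Y, Lp_pairing z y = 0) -> z = 0.
Proof.
move=> H; apply: rnorm0_eq0; apply/eqP; rewrite eq_le rnorm_ge0 andbT.
rewrite -sqn1; apply: sqn_le_dual => // y; rewrite big1 ?normc0 ?mul0r//.
Qed.

End Norming.

(** * Completeness of Lp and the Riesz representation *)

Lemma ler_powR_cancel (R : realType) (r x y : R) : 0 < r -> 0 <= x -> 0 <= y ->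
  x `^ r <= y `^ r -> x <= y.
Proof.
move=> r0 x0 y0; apply: contra_le => yx.
by rewrite gt0_ltr_powR ?nnegrE.
Qed.

Section SeriesLimit.
Context (R : realType).

Lemma abs_series_limit (a b : nat -> R) (M0 : R) :
  (forall k, `|a k| <= b k) -> (forall m, \sum_(0 <= k < m) b k <= M0) ->
  forall n M, (forall m, \sum_(n <= k < n + m) b k <= M) ->
  `|fine (limn_esup (fun m => (\sum_(0 <= k < m) a k)%:E)) - \sum_(0 <= k < n) a k| <= M.
Proof.
move=> ab bM.
have cv : cvgn (series a).
  have E n : [normed series a] n = \sum_(0 <= k < n) `|a k|.
    by rewrite /normed_series_of seriesEnat.
  apply: normed_cvg; apply: nondecreasing_is_cvgn.
    by apply/nondecreasing_seqP => n; rewrite !E big_nat_recr//= lerDl.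
  exists M0 => _ [m _ <-]; apply: le_trans (bM m).
  by rewrite E; apply: ler_sum => k _.
pose l := limn (series a).
have -> : fine (limn_esup (fun m => (\sum_(0 <= k < m) a k)%:E)) = l.
  have H : (fun m => (\sum_(0 <= k < m) a k)%:E) @ \oo --> l%:E.
    by apply: cvg_EFin; [exact: nearW|exact: cv].
  by have [_ ->] := cvg_limn_einf_sup H.
move=> n M HM.
have cvn : (fun m => `|series a m - \sum_(0 <= k < n) a k|) @ \oo --> `|l - \sum_(0 <= k < n) a k|.
  by apply: cvg_norm; apply: cvgB => //; exact: cvg_cst.
rewrite -(cvg_lim _ cvn)//; apply: limr_le; first by apply/cvg_ex; exists `|l - \sum_(0 <= k < n) a k|.
exists n => // m /= nm; rewrite seriesEnat /= (@big_cat_nat _ _ _ n 0 m)//= [X in `|X|]addrAC subrr add0r.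
apply: le_trans (ler_norm_sum _ _ _) _; apply: le_trans (HM (m - n)%N).
by rewrite subnKC//; apply: ler_sum.
Qed.

End SeriesLimit.

Lemma cmeasurableB d (Omega : measurableType d) (R : realType)
  (f g : Omega -> R[i]) : cmeasurable f -> cmeasurable g ->
  cmeasurable (fun w => f w - g w).
Proof.
move=> mf mg; rewrite (_ : (fun w => _) = f + (fun w => -1 * g w)).
  by apply: cmeasurableD => //; exact: cmeasurableZ.
by apply/funext => w; congr (_ + _); rewrite mulN1r.
Qed.

Section Completeness.
Context d (Omega : measurableType d) (R : realType).
Variables (mu : {measure set Omega -> \bar R}) (p : R) (p1 : 1 <= p).
Let p0 : 0 < p. Proof. exact: lt_le_trans p1. Qed.
Local Notation X := (Lp mu p1).

Section Series.
Variables (u : nat -> X) (C rho : R).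
Hypotheses (C0 : 0 <= C) (rho01 : 0 <= rho < 1).
Hypothesis uC : forall n, rnorm (u n) <= C * rho ^+ n.

Let r0 : 0 <= rho. Proof. by case/andP: rho01. Qed.
Let r1 : 0 < 1 - rho. Proof. by rewrite subr_gt0; case/andP: rho01. Qed.

Let T n m w : R := \sum_(n <= k < n + m) normc (Lp_rep (u k) w).
Let D n w : \bar R := limn (fun m => (T n m w `^ p)%:E).
Let B n : R := C * (rho ^+ n / (1 - rho)).

Let T0 n m w : 0 <= T n m w.
Proof. by apply: sumr_ge0 => k _; exact: normc_ge0. Qed.

Let B0 n : 0 <= B n.
Proof. by rewrite mulr_ge0// divr_ge0 ?exprn_ge0 ?(ltW r1). Qed.

Let geometric_tail n m : \sum_(n <= k < n + m) rho ^+ k <= rho ^+ n / (1 - rho).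
Proof.
have -> : \sum_(n <= k < n + m) rho ^+ k = rho ^+ n * (1 - rho ^+ m) / (1 - rho).
  elim: m => [|m IH]; first by rewrite addn0 big_geq// expr0 subrr mulr0 mul0r.
  by rewrite addnS big_nat_recr ?leq_addr//= IH exprD exprS; field; rewrite gt_eqF.
rewrite ler_wpM2r ?invr_ge0 ?(ltW r1)// -[leRHS]mulr1 ler_wpM2l ?exprn_ge0//.
by rewrite gerBl exprn_ge0.
Qed.

Let mT n m : measurable_fun setT (T n m).
Proof. by apply: measurable_sum => k; exact: measurable_normc_rep. Qed.

Let T_nd n w : {homo (fun m => (T n m w `^ p)%:E) : m m' / (m <= m')%N >-> (m <= m')%E}.
Proof.
move=> m m' mm; rewrite lee_fin ge0_ler_powR ?nnegrE ?T0 ?(ltW p0)//.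
rewrite /T [leRHS](@big_cat_nat _ _ _ (n + m)) ?leq_addr ?leq_add2l//= lerDl.
by apply: sumr_ge0 => k _; exact: normc_ge0.
Qed.

Let integral_T n m : (\int[mu]_w (T n m w `^ p)%:E <= (B n `^ p)%:E)%E.
Proof.
rewrite -Lnorm_powR// -poweR_EFin; apply: gt0_ler_poweR; rewrite ?(ltW p0)//.
- by rewrite in_itv/= leey andbT Lnorm_ge0.
- by rewrite in_itv/= leey andbT lee_fin.
apply: (@le_trans _ _ (\sum_(n <= k < n + m) 1%:E * (rnorm (u k))%:E)%E).
  under eq_bigr do rewrite rnorm_cLnorm.
  apply: le_trans (Lnorm_lincomb mu p1 (index_iota n (n + m)) _ _ _) => //.
  - rewrite le_eqVlt; apply/orP; left; apply/eqP; congr (Lnorm mu p%:E (EFin \o _)).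
    by apply/funext => w; apply: eq_bigr => k _; rewrite mul1r.
  - by move=> *; exact: normc_ge0.
  - by move=> k; exact: measurable_normc_rep.
under eq_bigr do rewrite mul1e.
rewrite sumEFin lee_fin; apply: (@le_trans _ _ (\sum_(n <= k < n + m) C * rho ^+ k)).
  by apply: ler_sum => k _.
by rewrite -mulr_sumr ler_wpM2l.
Qed.

Let D0 n w : (0 <= D n w)%E.
Proof.
apply: lime_ge; first exact: ereal_nondecreasing_is_cvgn.
by apply: nearW => m; rewrite lee_fin powR_ge0.
Qed.

Let TD n m w : ((T n m w `^ p)%:E <= D n w)%E.
Proof.
have nd := T_nd n w.
by rewrite /D (cvg_lim _ (ereal_nondecreasing_cvgn nd))//; apply: ereal_sup_ubound; exists m.
Qed.

Let mD n : measurable_fun setT (D n).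
Proof.
apply: (emeasurable_fun_cvg (fun m w => (T n m w `^ p)%:E)).
  by move=> m; apply/measurable_EFinP/measurable_powR_comp.
by move=> w _; apply: ereal_nondecreasing_is_cvgn.
Qed.

Let integral_D n : (\int[mu]_w D n w <= (B n `^ p)%:E)%E.
Proof.
rewrite (monotone_convergence mu measurableT)//.
- apply: lime_le; last by apply: nearW => m; exact: integral_T.
  apply: ereal_nondecreasing_is_cvgn => m m' mm; apply: ge0_le_integral => //.
  + by move=> w _; rewrite lee_fin powR_ge0.
  + by apply/measurable_EFinP/measurable_powR_comp.
  + by apply/measurable_EFinP/measurable_powR_comp.
  + by move=> w _; exact: T_nd.
- by move=> m; apply/measurable_EFinP/measurable_powR_comp.
- by move=> m w _; rewrite lee_fin powR_ge0.
Qed.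

Let D_fin : \forall w \ae mu, forall n, D n w \is a fin_num.
Proof.
apply: ae_foralln => n.
have Di : mu.-integrable setT (D n).
  apply/integrableP; split; first exact: mD.
  under eq_integral do rewrite gee0_abs//.
  by apply: le_lt_trans (integral_D n) _; rewrite ltry.
by have := integrable_ae measurableT Di; apply: filterS => w /(_ I).
Qed.

(** An upper limit is defined and measurable everywhere; where the series converges absolutely, that
    is almost everywhere, it is the sum. *)
Let f w : R[i] := Complex
  (fine (limn_esup (fun m => (\sum_(0 <= k < m) complex.Re (Lp_rep (u k) w))%:E)))
  (fine (limn_esup (fun m => (\sum_(0 <= k < m) complex.Im (Lp_rep (u k) w))%:E))).

Let mf : cmeasurable f.
Proof.
split => /=; apply: (@measurableT_comp _ _ _ _ _ _ fine) => //;
  apply: measurable_fun_limn_esup => m; apply/measurable_EFinP/measurable_sum => k.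
- by case: (Lp_rep_meas (u k)).
- by case: (Lp_rep_meas (u k)).
Qed.

Let f_approx : \forall w \ae mu, forall n,
  ((normc (f w - \sum_(0 <= k < n) Lp_rep (u k) w) `^ p)%:E <= (2 `^ p)%:E * D n w)%E.
Proof.
apply: filterS D_fin => w Dw n.
pose M n := fine (D n w) `^ p^-1.
have TM n' m : T n' m w <= M n'.
  rewrite -[leLHS](powRr1 (T0 _ _ _)) -(@mulfV _ p) ?gt_eqF// powRrM.
  rewrite ge0_ler_powR ?invr_ge0 ?(ltW p0) ?nnegrE ?powR_ge0//.
    by rewrite fine_ge0.
  by rewrite -lee_fin fineK.
have TM0 m : \sum_(0 <= k < m) normc (Lp_rep (u k) w) <= M 0%N by exact: (TM 0%N m).
have hr := abs_series_limit (fun k => normr_Re_le (Lp_rep (u k) w)) TM0 (TM n).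
have hi := abs_series_limit (fun k => normr_Im_le (Lp_rep (u k) w)) TM0 (TM n).
rewrite -(fineK (Dw n)) -EFinM lee_fin.
have -> : 2 `^ p * fine (D n w) = (2 * M n) `^ p.
  by rewrite powRM ?powR_ge0// /M -powRrM mulVf ?gt_eqF// powRr1// fine_ge0.
rewrite ge0_ler_powR ?nnegrE ?normc_ge0 ?mulr_ge0 ?powR_ge0 ?(ltW p0)//.
apply: (le_trans (normc_le_ReIm _)).
have ReB (z1 z2 : R[i]) : complex.Re (z1 - z2) = complex.Re z1 - complex.Re z2.
  by case: z1 z2 => ? ? [].
have ImB (z1 z2 : R[i]) : complex.Im (z1 - z2) = complex.Im z1 - complex.Im z2.
  by case: z1 z2 => ? ? [].
by rewrite ReB ImB Re_sum Im_sum mulr_natl mulr2n lerD.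
Qed.

(** Completeness in the form used below, with a geometric rate. Monotone convergence applied to the
    p-th powers of the tails of the moduli yields both the sum and the rate; the factor 2 comes from
    real and imaginary parts. *)
Lemma Lp_series_cvg : exists s : X, forall n,
  rnorm (s - \sum_(0 <= k < n) u k) <= 2 * C / (1 - rho) * rho ^+ n.
Proof.
have fle n : (\int[mu]_w (normc (f w - \sum_(0 <= k < n) Lp_rep (u k) w) `^ p)%:E
    <= ((2 * B n) `^ p)%:E)%E.
  apply: (@le_trans _ _ (\int[mu]_w ((2 `^ p)%:E * D n w))%E).
    apply: ae_ge0_le_integral => //.
    - by move=> w _; rewrite lee_fin powR_ge0.
    - apply/measurable_EFinP/measurable_powR_comp/cmeasurable_normc.
      apply: cmeasurableB => //; apply: cmeasurable_sum => k; exact: Lp_rep_meas.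
    - by move=> w _; rewrite mule_ge0// lee_fin powR_ge0.
    - exact: measurable_funeM.
    by apply: filterS f_approx => w H _.
  rewrite ge0_integralZl ?lee_fin ?powR_ge0//.
  by rewrite powRM// EFinM; apply: lee_wpmul2l; rewrite ?lee_fin ?powR_ge0.
have [s Hs] : exists s : X, \forall w \ae mu, Lp_rep s w = f w.
  apply: exists_Lp_rep; first exact: mf.
  apply: le_lt_trans (ltry ((2 * B 0%N) `^ p)); apply: le_trans (fle 0%N).
  by under [X in (_ <= X)%E]eq_integral do rewrite big_geq// subr0.
exists s => n.
have -> : 2 * C / (1 - rho) * rho ^+ n = 2 * B n by rewrite /B; field; rewrite gt_eqF.
have B20 : 0 <= 2 * B n by rewrite mulr_ge0.
apply: (ler_powR_cancel p0 (rnorm_ge0 _) B20).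
rewrite -lee_fin; apply: le_trans (fle n).
rewrite -poweR_EFin rnorm_cLnorm Lnorm_powR//; last by move=> w; exact: normc_ge0.
apply: ae_ge0_le_integral => //.
- by move=> w _; rewrite lee_fin powR_ge0.
- by apply/measurable_EFinP/measurable_powR_comp; exact: measurable_normc_rep.
- by move=> w _; rewrite lee_fin powR_ge0.
- apply/measurable_EFinP/measurable_powR_comp/cmeasurable_normc.
  apply: cmeasurableB => //; apply: cmeasurable_sum => k; exact: Lp_rep_meas.
have h1 := Lp_rep_sum (index_iota 0 n) u.
have h2 := Lp_repD s ((-1) *: \sum_(0 <= k < n) u k).
have h3 := Lp_repZ_ae (-1) (\sum_(0 <= k < n) u k).
have h12 : \forall w \ae mu, Lp_rep (s - \sum_(0 <= k < n) u k) w =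
    Lp_rep s w - Lp_rep (\sum_(0 <= k < n) u k) w.
  rewrite -scaleN1r; apply: filterS2 h2 h3 => w /(_ I) -> ->.
  by rewrite mulN1r.
have h4 : \forall w \ae mu, Lp_rep (s - \sum_(0 <= k < n) u k) w =
    Lp_rep s w - \sum_(0 <= k < n) Lp_rep (u k) w.
  by apply: filterS2 h12 h1 => w -> ->.
by apply: filterS2 h4 Hs => w -> -> _.
Qed.

End Series.
End Completeness.

Section DualityMapLimit.
Context (R : realType) (p : R) (p1 : 1 < p).

Lemma powR_continuous_at (r a : R) : 0 < a -> {for a, continuous (@powR R ^~ r)}.
Proof.
move=> a0; apply: differentiable_continuous; apply/derivable1_diffP.
by apply: derivable_powR; rewrite in_itv /= andbT.
Qed.

(** The point a = 0 is treated apart: for p < 2 the factor |.|^(p-2) is unbounded there, although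
    the map itself is of size |.|^(p-1). *)
Lemma cvg_duality_map (a h : R[i]) :
  (fun n => complex.Re (h * duality_map p (a + ((n.+1%:R^-1)%:C)%C * h))) @ \oo
    --> complex.Re (h * duality_map p a).
Proof.
have q0 : 0 < p - 1 by rewrite subr_gt0.
pose t n : R := n.+1%:R^-1.
have t0 n : 0 < t n by rewrite invr_gt0 ltr0n.
have ct : t @ \oo --> (0 : R) by exact: cvg_harmonic.
pose b n := a + ((t n)%:C)%C * h.
change ((fun n => complex.Re (h * duality_map p (b n))) @ \oo
    --> complex.Re (h * duality_map p a)).
have cst (c : R) : (fun _ : nat => c) @ \oo --> c by exact: cvg_cst.
have cth : (fun n => t n * normc h) @ \oo --> (0 : R).
  by rewrite -[X in _ --> X](mul0r (normc h)); apply: cvgM.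
have nth n : normc (((t n)%:C)%C * h) = t n * normc h.
  by rewrite normcM normc_real ger0_norm// ltW.
have [a0|aN0] := eqVneq a 0.
  have -> : duality_map p a = 0.
    by apply: eq0_normc; rewrite normc_duality_map// a0 normc0 powR0 ?gt_eqF.
  rewrite mulr0 /=.
  have [h0|hN0] := eqVneq h 0.
    by rewrite h0; under eq_fun do rewrite mul0r /=; exact: cvg_cst.
  have nh : 0 < normc h.
    rewrite lt_neqAle normc_ge0 andbT eq_sym.
    by apply: contra hN0 => /eqP /eq0_normc ->.
  have bn n : normc (b n) = t n * normc h by rewrite /b a0 add0r.
  apply: norm_cvg0; apply: (@squeeze_cvgr _ _ _ _ (fun=> 0)
     (fun n => normc h * (t n * normc h) `^ (p - 1))).
  - apply: nearW => n; rewrite normr_ge0 /=.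
    by rewrite (le_trans (normr_Re_le _))// normcM normc_duality_map// bn.
  - exact: cst.
  rewrite -[X in _ --> X](mulr0 (normc h)); apply: cvgM; first exact: cst.
  have := @powR_cvg0 R _ q0; move/cvg_at_rightP; apply; split => // n.
  by rewrite mulr_gt0.
have na : 0 < normc a.
  rewrite lt_neqAle normc_ge0 andbT eq_sym.
  by apply: contra aN0 => /eqP /eq0_normc ->.
have cb : (fun n => normc (b n)) @ \oo --> normc a.
  apply: (@squeeze_cvgr _ _ _ _ (fun n => normc a - t n * normc h)
     (fun n => normc a + t n * normc h)).
  - apply: nearW => n; rewrite -nth; apply/andP; split.
      rewrite lerBlDr -[in leRHS](normcN (_ * h)).
      by have := le_normcD (b n) (- (((t n)%:C)%C * h)); rewrite /b addrK.
    exact: le_normcD.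
  - by rewrite -[X in _ --> X](subr0 (normc a)); apply: cvgB.
  - by rewrite -[X in _ --> X](addr0 (normc a)); apply: cvgD.
have E c : complex.Re (h * duality_map p c) =
    normc c `^ (p - 2) * (complex.Re h * complex.Re c + complex.Im h * complex.Im c).
  rewrite /duality_map; case: h c {nth cth b cb} => h1 h2 [c1 c2] /=; ring.
under eq_fun do rewrite E.
rewrite E; apply: cvgM.
  by apply: (continuous_cvg _ (@powR_continuous_at (p - 2) _ na) cb).
have -> : (fun n => complex.Re h * complex.Re (b n) + complex.Im h * complex.Im (b n)) =
  (fun n => (complex.Re h * complex.Re a + complex.Im h * complex.Im a) +
     t n * (complex.Re h ^+ 2 + complex.Im h ^+ 2)).
  apply/funext => n; rewrite /b; case: a h {aN0 na nth cth b cb E} => a1 a2 [h1 h2] /=; ring.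
rewrite -[X in _ --> X]addr0; apply: cvgD; first exact: cst.
by rewrite -[X in _ --> X](mul0r (complex.Re h ^+ 2 + complex.Im h ^+ 2)); apply: cvgM.
Qed.

End DualityMapLimit.

Section LpUniformConvexity.
Context d (Omega : measurableType d) (R : realType).
Variables (mu : {measure set Omega -> \bar R}) (p : R) (p1 : 1 <= p).
Hypothesis pgt1 : 1 < p.
Let p0 : 0 < p. Proof. exact: lt_le_trans p1. Qed.
Local Notation X := (Lp mu p1).

Lemma rnorm_powR (x : X) :
  ((rnorm x `^ p)%:E = \int[mu]_w (normc (Lp_rep x w) `^ p)%:E)%E.
Proof.
rewrite -Lnorm_powR//; last by move=> w; exact: normc_ge0.
by rewrite -rnorm_cLnorm poweR_EFin.
Qed.

Let mpow (x : X) : measurable_fun setT (fun w => (normc (Lp_rep x w) `^ p)%:E).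
Proof. by apply/measurable_EFinP/measurable_powR_comp; exact: measurable_normc_rep. Qed.

Lemma rnorm_uniform_convexity (eta : R) : 0 < eta -> exists2 K : R, 0 < K &
  forall a b : X, rnorm (a - b) `^ p + K * rnorm ((2^-1 : R[i]) *: (a + b)) `^ p <=
    (eta + K) * ((rnorm a `^ p + rnorm b `^ p) / 2).
Proof.
move=> eta0; have [K K0 HK] := pointwise_uniform_convexity pgt1 eta0.
exists K => // a b; rewrite -lee_fin.
have K0' : 0 <= K by exact: ltW.
have c0 : 0 <= (eta + K) / 2 by lra.
have kn (c : R) (x : X) w : 0 <= c -> (0 <= c%:E * (normc (Lp_rep x w) `^ p)%:E)%E.
  by move=> ?; rewrite mule_ge0// lee_fin ?powR_ge0.
have mk (c : R) (x : X) : measurable_fun setT (fun w => c%:E * (normc (Lp_rep x w) `^ p)%:E)%E.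
  exact: measurable_funeM.
have Zi (c : R) (x : X) : 0 <= c -> ((c * rnorm x `^ p)%:E =
    \int[mu]_w (c%:E * (normc (Lp_rep x w) `^ p)%:E))%E.
  move=> c0'; rewrite EFinM rnorm_powR.
  rewrite ge0_integralZl//; try exact: (mpow x).
  by move=> w _; rewrite lee_fin powR_ge0.
have Di (c c' : R) (x x' : X) : 0 <= c -> 0 <= c' ->
    ((c * rnorm x `^ p + c' * rnorm x' `^ p)%:E = \int[mu]_w
      (c%:E * (normc (Lp_rep x w) `^ p)%:E + c'%:E * (normc (Lp_rep x' w) `^ p)%:E))%E.
  move=> c0' c0''; rewrite EFinD !Zi//.
  rewrite (ge0_integralD mu measurableT _ (mk c x) _ (mk c' x'))//.
  - by move=> w _; exact: kn.
  - by move=> w _; exact: kn.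
rewrite -[rnorm (a - b) `^ p]mul1r (Di _ _ _ _ ler01 K0').
have -> : (eta + K) * ((rnorm a `^ p + rnorm b `^ p) / 2) =
  (eta + K) / 2 * rnorm a `^ p + (eta + K) / 2 * rnorm b `^ p by field.
rewrite (Di _ _ a b c0 c0).
apply: ae_ge0_le_integral => //.
- by move=> w _; rewrite adde_ge0 ?kn.
- by apply: emeasurable_funD; exact: mk.
- by move=> w _; rewrite adde_ge0 ?kn.
- by apply: emeasurable_funD; exact: mk.
have h1 : \forall w \ae mu, Lp_rep (a - b) w = Lp_rep a w - Lp_rep b w.
  have h2 := Lp_repD a ((-1) *: b); have h3 := Lp_repZ_ae (-1) b.
  by rewrite -scaleN1r; apply: filterS2 h2 h3 => w /(_ I) -> ->; rewrite mulN1r.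
have h2 : \forall w \ae mu, Lp_rep ((2^-1 : R[i]) *: (a + b)) w = (Lp_rep a w + Lp_rep b w) / 2.
  have h2 := Lp_repD a b; have h3 := Lp_repZ_ae (2^-1) (a + b).
  by apply: filterS2 h2 h3 => w /(_ I) H ->; rewrite H mulrC.
apply: filterS2 h1 h2 => w -> -> _.
rewrite -!EFinM -!EFinD lee_fin mul1r; apply: le_trans (HK _ _) _.
by rewrite le_eqVlt; apply/orP; left; apply/eqP; field.
Qed.

Section Minimizer.
Variables (phi : X -> R[i]) (C : R).
Hypotheses (lphi : forall a x y, phi (a *: x + y) = a * phi x + phi y)
  (C0 : 0 <= C) (phiC : forall x, normc (phi x) <= C * rnorm x).

Let J x := rnorm x `^ p - complex.Re (phi x).
Let q := p / (p - 1).
Let q0 : 0 < q. Proof. by rewrite divr_gt0// subr_gt0. Qed.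
Let pq : p^-1 + q^-1 = 1.
Proof. by rewrite /q; field; rewrite !gt_eqF// subr_gt0. Qed.
Let A := C `^ q / q.

Let young (t : R) : 0 <= t -> C * t <= t `^ p / p + A.
Proof. by move=> t0; rewrite mulrC; exact: conjugate_powR. Qed.

Let pV1 : p^-1 < 1. Proof. by rewrite invf_lt1. Qed.

Let phi_le x : complex.Re (phi x) <= C * rnorm x.
Proof. by apply: le_trans (phiC x); apply: le_trans (normr_Re_le _); exact: ler_norm. Qed.

Let phiD x y : phi (x + y) = phi x + phi y.
Proof. by rewrite -[x]scale1r lphi mul1r scale1r. Qed.

Let phiZ a x : phi (a *: x) = a * phi x.
Proof.
have phi0 : phi 0 = 0 by apply: (addrI (phi 0)); rewrite -phiD !addr0.
by rewrite -[a *: x]addr0 lphi phi0 addr0.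
Qed.

Let J_ge x : - A <= J x.
Proof.
rewrite /J; have := young (rnorm_ge0 x); have := phi_le x.
have : rnorm x `^ p / p <= rnorm x `^ p by rewrite ler_piMr ?powR_ge0// ltW.
lra.
Qed.

Let m := inf (range J).

Let lbJ : has_lbound (range J).
Proof. by exists (- A) => _ [x _ <-]; exact: J_ge. Qed.

Let mJ x : m <= J x.
Proof. by apply: ge_inf => //; exists x. Qed.

Let Jm (e : R) : 0 < e -> exists x, J x <= m + e.
Proof.
move=> e0; have [|_ [x _ <-] H] := inf_adherent e0 (_ : has_inf (range J)).
  by split => //; exists (J 0); exists 0.
by exists x; apply: ltW.
Qed.

Let Bd := q * (m + 1 + A).

(** Coercivity: Young's inequality absorbs the linear part of [J] into a fraction 1/p of the norm
    term. *)
Let norm_bound x : J x <= m + 1 -> rnorm x `^ p <= Bd.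
Proof.
move=> Jx; have h1 := young (rnorm_ge0 x); have h2 := phi_le x.
have : rnorm x `^ p * (1 - p^-1) <= m + 1 + A by move: Jx; rewrite /J; lra.
have -> : 1 - p^-1 = q^-1 by rewrite -pq addrAC subrr add0r.
by rewrite ler_pdivrMr// /Bd mulrC.
Qed.

Let Bd0 : 0 <= Bd.
Proof. by have [x Jx] := Jm ltr01; apply: le_trans (norm_bound Jx); exact: powR_ge0. Qed.

(** The real part of [phi] cancels at the midpoint, so near minimality of both ends bounds the
    convexity defect of the norm term alone. *)
Let midpoint a b (dl : R) : J a <= m + dl -> J b <= m + dl ->
  (rnorm a `^ p + rnorm b `^ p) / 2 - rnorm ((2^-1 : R[i]) *: (a + b)) `^ p <= dl.
Proof.
move=> Ja Jb; have := mJ ((2^-1 : R[i]) *: (a + b)); rewrite /J phiZ phiD.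
have -> : complex.Re (2^-1 * (phi a + phi b)) = (complex.Re (phi a) + complex.Re (phi b)) / 2.
  have -> : (2^-1 : R[i]) = ((2^-1 : R)%:C)%C by rewrite fmorphV rmorph_nat.
  by case: (phi a) (phi b) => ? ? [? ?] /=; ring.
by move: Ja Jb; rewrite /J; lra.
Qed.

(** In uniform convexity [eta] and then [dl] are chosen so that each of the two contributions is at
    most e^p / 2. The bound by 1 makes [norm_bound] applicable; the bound by [e] later forces a
    geometric decay of the values of [J]. *)
Let small_diff (e : R) : 0 < e -> exists2 dl : R, 0 < dl <= Num.min 1 e &
  forall a b, J a <= m + dl -> J b <= m + dl -> rnorm (a - b) <= e.
Proof.
move=> e0.
pose eta := e `^ p / (2 * (Bd + 1)).
have B1 : 0 < 2 * (Bd + 1) by rewrite mulr_gt0// ltr_wpDl.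
have eta0 : 0 < eta by rewrite divr_gt0 ?powR_gt0.
have [K K0 HK] := rnorm_uniform_convexity eta0.
pose dl := Num.min (Num.min 1 e) (e `^ p / (2 * K)).
have dl0 : 0 < dl by rewrite !lt_min ltr01 e0 divr_gt0 ?powR_gt0// mulr_gt0.
exists dl; first by rewrite dl0 /dl ge_min lexx.
have dl1 : dl <= 1 by rewrite /dl !ge_min lexx.
move=> a b Ja Jb; apply: (ler_powR_cancel p0) => //; [exact: rnorm_ge0|exact: ltW|].
have na : rnorm a `^ p <= Bd by apply: norm_bound; apply: (le_trans Ja); rewrite lerD2l.
have nb : rnorm b `^ p <= Bd by apply: norm_bound; apply: (le_trans Jb); rewrite lerD2l.
have := HK a b; have := midpoint Ja Jb.
set M := rnorm (_ *: _) `^ p; set N := (_ + _) / 2 => h1 h2.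
have NB : N <= Bd by rewrite /N; lra.
have : K * (N - M) <= e `^ p / 2.
  apply: (@le_trans _ _ (K * dl)); first by rewrite ler_pM2l.
  rewrite /dl; apply: (@le_trans _ _ (K * (e `^ p / (2 * K)))).
    by rewrite ler_pM2l// ge_min lexx orbT.
  by rewrite le_eqVlt; apply/orP; left; apply/eqP; field; rewrite gt_eqF.
have : eta * N <= e `^ p / 2.
  apply: (@le_trans _ _ (eta * (Bd + 1))); first by rewrite ler_pM2l//; lra.
  rewrite /eta le_eqVlt; apply/orP; left; apply/eqP; field.
  by rewrite gt_eqF// ltr_wpDl.
move: h2; rewrite mulrDl mulrBr; lra.
Qed.

(** A mean value inequality for the p-th power, obtained from Young's inequality; it makes [J]
    Lipschitz on bounded sets. *)
Let rnorm_powR_increment (x y : R) : 0 <= x -> 0 <= y ->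
  (x + y) `^ p - x `^ p <= p * y * (x + y) `^ (p - 1).
Proof.
move=> x0 y0; have xy := addr_ge0 x0 y0.
have q1 : 0 < p - 1 by rewrite subr_gt0.
have := conjugate_powR x0 (powR_ge0 (x + y) (p - 1)) p0 q0 pq.
rewrite -powRrM.
have -> : (p - 1) * q = p by rewrite /q; field; rewrite gt_eqF.
rewrite -(mulr_powRB1 xy p0); set u := (x + y) `^ (p - 1) => h.
have h2 : p * (x * u) <= x `^ p + (p - 1) * ((x + y) * u).
  have -> : x `^ p + (p - 1) * ((x + y) * u) = p * (x `^ p / p + (x + y) * u / q).
    by rewrite /q; field; rewrite !gt_eqF.
  by rewrite ler_pM2l.
lra.
Qed.

(** A minimizing sequence is Cauchy by uniform convexity. It is selected with increments of size
    2^-n, so that its limit is the sum of a geometrically bounded series. *)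
Lemma exists_minimizer : exists s : X, forall x,
  rnorm s `^ p - complex.Re (phi s) <= rnorm x `^ p - complex.Re (phi x).
Proof.
suff [s Js] : exists s : X, J s <= m by exists s => x; apply: le_trans Js (mJ x).
have e0 n : 0 < 2^-1 ^+ n :> R by rewrite exprn_gt0// invr_gt0.
have Hex n : exists dl, 0 < dl <= Num.min 1 (2^-1 ^+ n) /\
    forall a b, J a <= m + dl -> J b <= m + dl -> rnorm (a - b) <= 2^-1 ^+ n.
  by have [dl ? ?] := small_diff (e0 n); exists dl.
have [dl Hdl] := choice Hex.
(* Running minima of the tolerances: decreasing, so that x_n and x_(n+1) both meet the n-th
   tolerance. *)
pose dm := fix dm n := if n is n'.+1 then Num.min (dm n') (dl n) else dl 0%N.
have dm0 n : 0 < dm n.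
  elim: n => [|n IH] /=; first by case: (Hdl 0%N) => /andP[].
  by rewrite lt_min IH; case: (Hdl n.+1) => /andP[].
have dml n : dm n <= dl n by case: n => [|n] //=; rewrite ge_min lexx orbT.
have dmS n : dm n.+1 <= dm n by rewrite /= ge_min lexx.
have dm1 n : dm n <= 1.
  apply: (le_trans (dml n)); case: (Hdl n) => /andP[_ h] _; apply: (le_trans h).
  by rewrite ge_min lexx.
have dme n : dm n <= 2^-1 ^+ n.
  apply: (le_trans (dml n)); case: (Hdl n) => /andP[_ h] _; apply: (le_trans h).
  by rewrite ge_min lexx orbT.
have [x Hx] := choice (fun n => Jm (dm0 n)).
pose u n := if n is n'.+1 then x n'.+1 - x n' else x 0%N.
have su n : \sum_(0 <= k < n.+1) u k = x n.
  elim: n => [|n IH]; first by rewrite big_nat1.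
  by rewrite big_nat_recr//= IH addrC subrK.
pose Cu := Num.max (rnorm (x 0%N)) 2.
have uC n : rnorm (u n) <= Cu * 2^-1 ^+ n.
  case: n => [|n] /=; first by rewrite expr0 mulr1 le_max lexx.
  apply: (@le_trans _ _ (2 * 2^-1 ^+ n.+1)); last first.
    by rewrite ler_wpM2r ?(ltW (e0 _))// le_max lexx orbT.
  rewrite exprS mulrA divff// mul1r; case: (Hdl n) => _; apply.
    by apply: (le_trans (Hx _)); rewrite lerD2l (le_trans (dmS n)).
  by apply: (le_trans (Hx _)); rewrite lerD2l.
have Cu0 : 0 <= Cu by rewrite le_max (ler0n R 2) orbT.
have rho01 : 0 <= (2^-1 : R) < 1 by rewrite invr_ge0 ler0n /= invf_lt1// ltr1n.
have [s Hs] := Lp_series_cvg Cu0 rho01 uC.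
exists s.
pose C2 := 2 * Cu / (1 - 2^-1) * 2^-1.
have C20 : 0 <= C2 by rewrite mulr_ge0// mulr_ge0 ?invr_ge0 ?mulr_ge0//; lra.
have Hsn n : rnorm (s - x n) <= C2 * 2^-1 ^+ n.
  by have := Hs n.+1; rewrite su exprS mulrA.
clearbody C2.
pose bb := Bd `^ p^-1.
have nx n : rnorm (x n) <= bb.
  apply: (ler_powR_cancel p0); [exact: rnorm_ge0|exact: powR_ge0|].
  rewrite /bb -powRrM mulVf ?gt_eqF// powRr1//; apply: norm_bound.
  by apply: (le_trans (Hx n)); rewrite lerD2l.
pose D := 1 + p * C2 * (bb + C2) `^ (p - 1) + C * C2.
have D1 : 0 <= D.
  by rewrite !addr_ge0 ?ler01 ?mulr_ge0 ?powR_ge0 ?(ltW p0).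
have key n : J s <= m + D * 2^-1 ^+ n.
  set en := 2^-1 ^+ n.
  have en0 : 0 < en by exact: e0.
  have en1 : en <= 1 by rewrite /en exprn_ile1 ?invr_ge0// invf_le1// ler1n.
  pose y := C2 * en.
  have y0 : 0 <= y by rewrite mulr_ge0// ltW.
  have yC : y <= C2 by rewrite /y ler_piMr.
  have sE : s = x n + (s - x n) by rewrite addrCA subrr addr0.
  have ns : rnorm s <= rnorm (x n) + y.
    by rewrite {1}sE; apply: (le_trans (rnormD _ _)); rewrite lerD2l; exact: Hsn.
  have ps : rnorm s `^ p <= (rnorm (x n) + y) `^ p.
    by rewrite ge0_ler_powR ?nnegrE ?addr_ge0 ?rnorm_ge0 ?(ltW p0).
  have inc := rnorm_powR_increment (rnorm_ge0 (x n)) y0.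
  have inc2 : p * y * (rnorm (x n) + y) `^ (p - 1) <= p * y * (bb + C2) `^ (p - 1).
    rewrite (ler_wpM2l (mulr_ge0 (ltW p0) y0))// ge0_ler_powR ?subr_ge0 ?nnegrE ?(ltW pgt1)//.
    - by rewrite addr_ge0 ?rnorm_ge0.
    - by rewrite addr_ge0 ?powR_ge0.
    - by rewrite lerD.
  have ph : complex.Re (phi (x n)) - C * y <= complex.Re (phi s).
    rewrite {1}sE phiD ReD lerBlDr -addrA lerDl.
    have : - complex.Re (phi (s - x n)) <= C * y.
      apply: (@le_trans _ _ (C * rnorm (s - x n))); last by rewrite ler_wpM2l.
      apply: le_trans (phiC _); apply: le_trans (normr_Re_le _).
      by rewrite -normrN ler_norm.
    by rewrite -subr_ge0 opprK addrC.
  have JX : J (x n) <= m + en by apply: (le_trans (Hx n)); rewrite lerD2l.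
  have -> : D * en = en + p * y * (bb + C2) `^ (p - 1) + C * y by rewrite /D /y; ring.
  move: JX; rewrite /J; lra.
apply/ler_addgt0Pr => e ep.
have [n Hn] : exists n, D * 2^-1 ^+ n <= e.
  have cv : (fun n => D * 2^-1 ^+ n) @ \oo --> (0 : R).
    rewrite -[X in _ --> X](mulr0 D); apply: cvgM; first exact: cvg_cst.
    by apply: cvg_expr; rewrite ger0_norm ?invr_ge0// invf_lt1// ltr1n.
  have [n _ Hn] := cvgr0_norm_le _ cv _ ep.
  exists n; have := Hn n (leqnn n) => /=; exact: le_trans (ler_norm _).
by apply: (le_trans (key n)); rewrite lerD2l.
Qed.

End Minimizer.
End LpUniformConvexity.

Section Riesz.
Context d (Omega : measurableType d) (R : realType).
Variables (mu : {measure set Omega -> \bar R}) (p q : R) (p1 : 1 <= p) (q1 : 1 <= q).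
Hypotheses (pgt1 : 1 < p) (pq : p^-1 + q^-1 = 1).
Let p0 : 0 < p. Proof. exact: lt_le_trans p1. Qed.
Let q0 : 0 < q. Proof. exact: lt_le_trans q1. Qed.
Local Notation X := (Lp mu p1).
Local Notation Y := (Lp mu q1).

Lemma cmeasurable_duality_map (f : Omega -> R[i]) : cmeasurable f ->
  cmeasurable (fun w => duality_map p (f w)).
Proof.
move=> mf; apply: cmeasurableM; last exact: cmeasurable_conj.
by apply: cmeasurable_real; apply: measurable_powR_comp; exact: cmeasurable_normc.
Qed.

Lemma integrable_normc_powR (x : X) :
  mu.-integrable setT (EFin \o (fun w => normc (Lp_rep x w) `^ p)).
Proof.
apply/integrableP; split.
  by apply/measurable_EFinP/measurable_powR_comp; exact: measurable_normc_rep.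
under eq_integral do rewrite /= ger0_norm ?powR_ge0//.
by rewrite -rnorm_powR ltry.
Qed.

Lemma Rintegral_normc_powR (x : X) :
  Rintegral mu setT (fun w => normc (Lp_rep x w) `^ p) = rnorm x `^ p.
Proof. by rewrite /Rintegral -rnorm_powR. Qed.

Section EulerLagrange.
Variables (s h : X).

Let g (t : R) w := complex.Re (Lp_rep h w * duality_map p (Lp_rep s w + (t%:C)%C * Lp_rep h w)).
Let G w := 2 `^ p * (normc (Lp_rep s w) `^ p + normc (Lp_rep h w) `^ p).

Let mg t : measurable_fun setT (g t).
Proof.
have : cmeasurable (fun w => Lp_rep h w * duality_map p (Lp_rep s w + (t%:C)%C * Lp_rep h w)).
  apply: cmeasurableM; first exact: Lp_rep_meas.
  apply: cmeasurable_duality_map; apply: cmeasurableD; first exact: Lp_rep_meas.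
  by apply: cmeasurableZ; exact: Lp_rep_meas.
by case.
Qed.

Let gG t w : 0 <= t <= 1 -> `|g t w| <= G w.
Proof.
case/andP=> t0 t1; set a := Lp_rep s w; set b := Lp_rep h w.
have a0 := normc_ge0 a; have b0 := normc_ge0 b.
have tb : normc (a + (t%:C)%C * b) <= normc a + normc b.
  rewrite (le_trans (le_normcD _ _))// lerD2l normcM normc_real ger0_norm//.
  by rewrite ler_piMl.
apply: (@le_trans _ _ ((normc a + normc b) `^ p)); last first.
  by apply: powR_addr_le => //; exact: ltW.
rewrite (le_trans (normr_Re_le _))// normcM normc_duality_map//.
rewrite -(mulr_powRB1 (addr_ge0 a0 b0) p0); apply: ler_pM => //.
- exact: powR_ge0.
- by rewrite lerDr.
by rewrite ge0_ler_powR ?subr_ge0 ?(ltW pgt1) ?nnegrE ?normc_ge0 ?addr_ge0.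
Qed.

Let integrableZ_real (c : R) (f : Omega -> R) : mu.-integrable setT (EFin \o f) ->
  mu.-integrable setT (EFin \o (fun w => c * f w)).
Proof.
move=> fi; rewrite (_ : _ \o _ = (fun w => c%:E * (EFin \o f) w)%E); last by apply/funext.
exact: integrableZl.
Qed.

Let integrableD_real (f1 f2 : Omega -> R) : mu.-integrable setT (EFin \o f1) ->
  mu.-integrable setT (EFin \o f2) -> mu.-integrable setT (EFin \o (fun w => f1 w + f2 w)).
Proof.
move=> i1 i2; rewrite (_ : _ \o _ = ((EFin \o f1) \+ (EFin \o f2))%E); last by apply/funext.
exact: integrableD.
Qed.

Let iG : mu.-integrable setT (EFin \o G).
Proof.
by apply: integrableZ_real; apply: integrableD_real; exact: integrable_normc_powR.
Qed.

Let ig t : 0 <= t <= 1 -> mu.-integrable setT (EFin \o g t).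
Proof.
move=> t01; apply: (le_integrable measurableT _ _ iG).
  by apply/measurable_EFinP; exact: mg.
move=> w _ /=; rewrite lee_fin [leRHS]ger0_norm; first exact: gG.
by rewrite mulr_ge0 ?addr_ge0 ?powR_ge0.
Qed.

(** The tangent inequality is taken at the displaced point s + t h, not at s: this bounds the
    increment from above. *)
Let gradient_integral t : 0 <= t <= 1 ->
  rnorm (s + (t%:C)%C *: h) `^ p <= rnorm s `^ p + p * t * Rintegral mu setT (g t).
Proof.
move=> t01; have ag := ig t01.
have ii : mu.-integrable setT (EFin \o (fun w => p * t * g t w)) by exact: integrableZ_real.
have iS := integrable_normc_powR s.
rewrite -(Rintegral_normc_powR s) -RintegralZl// -RintegralD//.
have fin := integrable_fin_num measurableT (integrableD_real iS ii).
rewrite -lee_fin rnorm_powR /Rintegral fineK//.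
have cm : cmeasurable (fun w => Lp_rep s w + (t%:C)%C * Lp_rep h w).
  by apply: cmeasurableD; [|apply: cmeasurableZ]; exact: Lp_rep_meas.
have pt w : normc (Lp_rep s w + (t%:C)%C * Lp_rep h w) `^ p <=
    normc (Lp_rep s w) `^ p + p * t * g t w.
  have := powR_normc_gradient pgt1 (Lp_rep s w) (Lp_rep s w + (t%:C)%C * Lp_rep h w).
  rewrite opprD addrA subrr add0r.
  have E (b e : R[i]) (r : R) : complex.Re (- ((r%:C)%C * b) * e) = - (r * complex.Re (b * e)).
    by case: b e => b1 b2 [e1 e2] /=; ring.
  rewrite E// -/(g t w); lra.
rewrite (_ : \int[mu]_w _ = \int[mu]_w
    (normc (Lp_rep s w + (t%:C)%C * Lp_rep h w) `^ p)%:E)%E.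
  apply: ge0_le_integral => //.
  - by move=> w _; rewrite lee_fin powR_ge0.
  - by apply/measurable_EFinP/measurable_powR_comp; exact: cmeasurable_normc.
  - by have /integrableP[] := integrableD_real iS ii.
  - by move=> w _; rewrite lee_fin.
apply: ge0_ae_eq_integral => //.
- by apply/measurable_EFinP/measurable_powR_comp; exact: measurable_normc_rep.
- by apply/measurable_EFinP/measurable_powR_comp; exact: cmeasurable_normc.
- by move=> w _; rewrite lee_fin powR_ge0.
- by move=> w _; rewrite lee_fin powR_ge0.
have h1 := Lp_repD s ((t%:C)%C *: h); have h2 := Lp_repZ_ae ((t%:C)%C) h.
by apply: filterS2 h1 h2 => w /(_ I) -> -> _.
Qed.

Let cvg_gradient : (fun n => Rintegral mu setT (g n.+1%:R^-1)) @ \oo --> Rintegral mu setT (g 0).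
Proof.
have t01 n : 0 <= (n.+1%:R^-1 : R) <= 1 by rewrite invr_ge0 ler0n /= invf_le1// ler1n.
have [||||ig0 _ cv] := @dominated_convergence _ _ _ mu setT measurableT
   (fun n => EFin \o g n.+1%:R^-1) (EFin \o g 0) (EFin \o G) _ _ _ iG.
- by move=> n; apply/measurable_EFinP; exact: mg.
- by apply/measurable_EFinP; exact: mg.
- apply: aeW => w _; apply: cvg_EFin; first exact: nearW.
  by rewrite /g rmorph0 mul0r addr0; exact: cvg_duality_map.
- by apply: aeW => w n _; rewrite /= lee_fin gG.
apply/fine_cvg; rewrite fineK//; first exact: integrable_fin_num.
Qed.

(** Divide by t = 1 / (n + 1) and let n grow, by dominated convergence. Only an inequality comes
    out; equality is recovered by replacing [h] with its opposite. *)
Lemma euler_lagrange (c : R) :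
  (forall t : R, rnorm s `^ p + t * c <= rnorm (s + (t%:C)%C *: h) `^ p) ->
  c <= p * Rintegral mu setT (fun w => complex.Re (Lp_rep h w * duality_map p (Lp_rep s w))).
Proof.
move=> H.
have -> : (fun w => complex.Re (Lp_rep h w * duality_map p (Lp_rep s w))) = g 0.
  by apply/funext => w; rewrite /g rmorph0 mul0r addr0.
have cv : (fun n => p * Rintegral mu setT (g n.+1%:R^-1)) @ \oo --> p * Rintegral mu setT (g 0).
  by apply: cvgM; [exact: cvg_cst|exact: cvg_gradient].
rewrite -(cvg_lim _ cv)//; apply: limr_ge; first by apply/cvg_ex; eexists; exact: cv.
apply: nearW => n; set t : R := n.+1%:R^-1.
have t0 : 0 < t by rewrite invr_gt0 ltr0n.
have t01 : 0 <= t <= 1 by rewrite (ltW t0) /= invf_le1// ler1n.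
have := le_trans (H t) (gradient_integral t01).
by rewrite lerD2l mulrAC mulrC ler_pM2r.
Qed.

End EulerLagrange.

(* The representative is a multiple of the duality map of a minimizer of
   |x|^p - Re (phi x). *)
Lemma riesz_representation (phi : X -> R[i]) (C : R) : 0 <= C ->
  (forall a x y, phi (a *: x + y) = a * phi x + phi y) ->
  (forall x, normc (phi x) <= C * rnorm x) ->
  exists z : Y, forall x, phi x = Lp_pairing x z.
Proof.
move=> C0 lphi phiC.
have [s Hs] := exists_minimizer pgt1 lphi C0 phiC.
have mz : cmeasurable (fun w => (p%:C)%C * duality_map p (Lp_rep s w)).
  by apply: cmeasurableZ; apply: cmeasurable_duality_map; exact: Lp_rep_meas.
have [z Hz] : exists z : Y, \forall w \ae mu, Lp_rep z w = (p%:C)%C * duality_map p (Lp_rep s w).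
  apply: exists_Lp_rep; first exact: mz.
  have nz w : normc ((p%:C)%C * duality_map p (Lp_rep s w)) `^ q =
      p `^ q * normc (Lp_rep s w) `^ p.
    rewrite normcM normc_real ger0_norm ?(ltW p0)// normc_duality_map//.
    by rewrite powRM ?powR_ge0 ?(ltW p0)// -powRrM (conjugate_mul p1 pgt1 pq).
  under eq_integral do rewrite nz EFinM.
  rewrite ge0_integralZl//.
  - by rewrite -rnorm_powR -EFinM ltry.
  - by apply/measurable_EFinP/measurable_powR_comp; exact: measurable_normc_rep.
  - by move=> w _; rewrite lee_fin powR_ge0.
  - by rewrite lee_fin powR_ge0.
exists z.
have key h : complex.Re (phi h) <= complex.Re (Lp_pairing h z).
  have -> : complex.Re (Lp_pairing h z) = p * Rintegral mu setT
      (fun w => complex.Re (Lp_rep h w * duality_map p (Lp_rep s w))).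
    rewrite /Lp_pairing (@eq_ae_cintegral _ _ _ mu _
      (fun w => (p%:C)%C * (Lp_rep h w * duality_map p (Lp_rep s w)))).
    - rewrite cintegralZ; last first.
        have [y Hy] : exists y : Y, \forall w \ae mu, Lp_rep y w = duality_map p (Lp_rep s w).
          exists ((p^-1%:C)%C *: z); have h1 := Lp_repZ_ae ((p^-1%:C)%C) z.
          apply: filterS2 h1 Hz => w -> ->; rewrite mulrA -rmorphM mulVf ?gt_eqF//.
          by rewrite rmorph1 mul1r.
        have [m1 f1] := cintegrable_pairing pq h y.
        have m2 : cmeasurable (fun w => Lp_rep h w * duality_map p (Lp_rep s w)).
          by apply: cmeasurableM; [|apply: cmeasurable_duality_map]; exact: Lp_rep_meas.
        split; first exact: m2.
        rewrite (_ : \int[mu]_w _ = \int[mu]_w (normc (Lp_rep h w * Lp_rep y w))%:E)%E//.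
        apply: ge0_ae_eq_integral => //.
        + by apply/measurable_EFinP; exact: cmeasurable_normc.
        + by apply/measurable_EFinP; exact: cmeasurable_normc.
        + by move=> w _; rewrite lee_fin normc_ge0.
        + by move=> w _; rewrite lee_fin normc_ge0.
        by apply: filterS Hy => w -> _.
      rewrite /cintegral; set I1 := Rintegral _ _ _; set I2 := Rintegral _ _ _.
      by rewrite /=; ring.
    - by apply: cmeasurableM; exact: Lp_rep_meas.
    - by apply: cmeasurableZ; apply: cmeasurableM; [|apply: cmeasurable_duality_map]; exact: Lp_rep_meas.
    - by apply: filterS Hz => w ->; rewrite mulrCA.
  apply: euler_lagrange => t; have := Hs (s + (t%:C)%C *: h).
  rewrite [s + _]addrC lphi [_ + s]addrC.
  have -> : complex.Re ((t%:C)%C * phi h + phi s) = t * complex.Re (phi h) + complex.Re (phi s).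
    by case: (phi h) (phi s) => ? ? [? ?] /=; ring.
  lra.
have phi0 : phi 0 = 0.
  apply: (addrI (phi 0)); have := lphi 1 0 0.
  by rewrite scale1r mul1r !addr0 => <-.
have phiZ a x : phi (a *: x) = a * phi x by rewrite -[a *: x]addr0 lphi phi0 addr0.
have pZ a (x : X) : Lp_pairing (a *: x) z = a * Lp_pairing x z.
  have := pairing_lincombl pq (fun _ : unit => a) (fun _ => x) z.
  by rewrite !(big_pred1 tt)//; case.
have ReE h : complex.Re (phi h) = complex.Re (Lp_pairing h z).
  apply/eqP; rewrite eq_le key /=; have := key ((-1) *: h).
  rewrite phiZ pZ !mulN1r.
  have ReN (b : R[i]) : complex.Re (- b) = - complex.Re b by case: b.
  by rewrite !ReN lerN2.
(* The real part at i x is minus the imaginary part at x, by complex linearity on both sides. *)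
move=> x; have := ReE x; have := ReE ('i%C *: x); rewrite phiZ pZ.
case: (phi x) (Lp_pairing x z) => a b [a' b'] /=.
rewrite !mul0r !sub0r !mul1r => /oppr_inj -> ->.
by [].
Qed.

Section Adjoint.
Variables (T : X -> X) (C : R).
Hypotheses (lT : linear T) (C0 : 0 <= C) (TC : opnorm_le C T).

Let Ts := adjoint q1 T.

(** The Riesz representation provides an element for [xget] in [adjoint] to choose, so that its
    default value does not occur. *)
Lemma adjointP (x : X) (y : Y) : Lp_pairing (T x) y = Lp_pairing x (Ts y).
Proof.
have H : exists z : Y, forall x, Lp_pairing (T x) y = Lp_pairing x z.
  apply: (@riesz_representation _ (2 * C * rnorm y)).
  - by rewrite !mulr_ge0 ?rnorm_ge0.
  - move=> a u v; rewrite lT.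
    have := pairing_lincombl pq (fun b : bool => if b then a else 1)
       (fun b => if b then T u else T v) y.
    by rewrite !big_bool /= !scale1r mul1r.
  - move=> u; apply: (le_trans (pairing_le pq _ _)).
    apply: (@le_trans _ _ (2 * ((C * rnorm u) * rnorm y))).
      by rewrite ler_wpM2l// ler_wpM2r ?rnorm_ge0.
    by rewrite le_eqVlt; apply/orP; left; apply/eqP; ring.
by have := @xgetPex _ 0 [set z | forall x, Lp_pairing (T x) y = Lp_pairing x z] H x.
Qed.

End Adjoint.
End Riesz.

(** * From the resolvent to the powers *)

Section PolynomialAction.
Context (K : comNzRingType) (X : lmodType K) (T : X -> X).
Hypothesis lT : linear T.

(** The polynomial [f] evaluated at [T], as a map on vectors. Since [pactM] turns products into
    compositions, identities between operators reduce to identities in a commutative ring. *)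
Definition pact (f : {poly K}) (x : X) : X := \sum_(i < size f) f`_i *: iter i T x.

Lemma linear_iter n : linear (iter n T).
Proof. by elim: n => // n IH a u v; rewrite !iterS IH lT. Qed.

Lemma pactE (f : {poly K}) N x : (size f <= N)%N ->
  pact f x = \sum_(i < N) f`_i *: iter i T x.
Proof.
move=> fN; rewrite /pact (big_ord_widen _ (fun i => f`_i *: iter i T x) fN).
rewrite [RHS](bigID (fun i : 'I_N => (i < size f)%N)) /= [X in _ = _ + X]big1 ?addr0// => i.
by rewrite -leqNgt => fi; rewrite nth_default// scale0r.
Qed.

Lemma pactD f g x : pact (f + g) x = pact f x + pact g x.
Proof.
rewrite (@pactE _ (maxn (size f) (size g))) ?size_polyD//.
rewrite (@pactE f (maxn (size f) (size g))) ?leq_maxl//.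
rewrite (@pactE g (maxn (size f) (size g))) ?leq_maxr//.
by rewrite -big_split; apply: eq_bigr => i _; rewrite coefD scalerDl.
Qed.

Lemma pactZ c f x : pact (c *: f) x = c *: pact f x.
Proof.
rewrite (@pactE _ (size f)) ?size_scale_leq// /pact scaler_sumr.
by apply: eq_bigr => i _; rewrite coefZ scalerA.
Qed.

Lemma pactN f x : pact (- f) x = - pact f x.
Proof. by have -> : - f = (-1 : K) *: f; rewrite ?pactZ scaleN1r. Qed.

Lemma pactB f g x : pact (f - g) x = pact f x - pact g x.
Proof. by rewrite pactD pactN. Qed.

Lemma pact0 x : pact 0 x = 0.
Proof. by rewrite /pact size_poly0 big_ord0. Qed.

Lemma pactXn n x : pact 'X^n x = iter n T x.
Proof.
rewrite (@pactE _ n.+1) ?size_polyXn// big_ord_recr /= coefXn eqxx scale1r.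
rewrite big1 ?add0r// => i _.
by rewrite coefXn ltn_eqF ?ltn_ord// scale0r.
Qed.

Lemma pact1 x : pact 1 x = x.
Proof. by rewrite -(expr0 'X) pactXn. Qed.

Lemma pact_sum (J : Type) (s : seq J) (P : pred J) (f : J -> {poly K}) x :
  pact (\sum_(i <- s | P i) f i) x = \sum_(i <- s | P i) pact (f i) x.
Proof. by elim/big_rec2: _ => [|i y1 y2 _ <-]; rewrite ?pact0 ?pactD. Qed.

Lemma linear_pact f : linear (pact f).
Proof.
move=> a u v; rewrite /pact scaler_sumr -big_split; apply: eq_bigr => i _ /=.
by rewrite linear_iter scalerDr !scalerA mulrC.
Qed.

Lemma pactM f g x : pact (f * g) x = pact f (pact g x).
Proof.
have -> : f * g = \sum_(i < size f) f`_i *: ('X^i * g).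
  by rewrite -{1}(coefK f) poly_def mulr_suml; apply: eq_bigr => i _; rewrite scalerAl.
rewrite pact_sum -[pact f _]/(\sum_(i < size f) f`_i *: iter i T (pact g x)).
apply: eq_bigr => i _ /=; rewrite pactZ; congr (_ *: _).
have -> : 'X^i * g = \sum_(j < size g) g`_j *: 'X^(i + j).
  rewrite -{1}(coefK g) poly_def mulr_sumr; apply: eq_bigr => j _.
  by rewrite -scalerAr exprD.
rewrite pact_sum -[pact g x]/(\sum_(j < size g) g`_j *: iter j T x).
rewrite (linear_lincomb (linear_iter i)); apply: eq_bigr => j _.
by rewrite pactZ pactXn iterD.
Qed.

Lemma pactX x : pact 'X x = T x.
Proof. by rewrite -(expr1 'X) pactXn. Qed.

End PolynomialAction.

Section ResolventPowers.
Context d (Omega : measurableType d) (R : realType).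
Variables (mu : {measure set Omega -> \bar R}) (p : R) (p1 : 1 <= p).
Local Notation X := (Lp mu p1).
Variables (T : X -> X) (P : R) (Rs : R[i] -> X -> X) (CR : R).
Hypotheses (lT : linear T) (P0 : 0 <= P) (TP : forall n, opnorm_le P (iter n T)).
Hypothesis RsP : forall l, 1 < normc l -> is_resolvent T l (Rs l).
Hypotheses (CR0 : 0 <= CR)
  (RsC : forall l, 1 < normc l -> opnorm_le CR (fun x => (l - 1) *: Rs l x)).

Lemma resolvent_linear l : 1 < normc l -> linear (Rs l).
Proof. by move=> /RsP[[]]. Qed.

Lemma resolventT l x : 1 < normc l -> Rs l (T x) = l *: Rs l x - x.
Proof.
move=> l1; have [_ H _] := RsP l1; have lR := resolvent_linear l1.
have E : x = l *: Rs l x - Rs l (T x).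
  rewrite -{1}(H x) addrC -scaleN1r lR scaleN1r addrC; congr (_ - _).
  by have := linear_lincomb lR [:: tt] (fun=> l) (fun=> x); rewrite !big_seq1.
by rewrite [X in _ - X]E opprB addrC subrK.
Qed.

(** Remainder after M terms in the expansion of R(l, T)^3 in powers of T, to be taken at z = T^M y.
    It results from iterating R(l, T) = l^-1 + l^-1 R(l, T) T. *)
Let rem l M z : X := (l ^- M) *: Rs l (Rs l (Rs l z)) +
  (M%:R * l ^- M.+1) *: Rs l (Rs l z) + ('C(M.+1, 2)%:R * l ^- M.+2) *: Rs l z.

Let regroup (V : zmodType) (a b c e w z : V) :
  a + c + e = z + ((a - b) + (c + b - w) + (e + w - z)).
Proof.
rewrite [RHS]addrCA [z + _]addrCA subrr addr0.
by rewrite [c + b]addrC !addrA subrK [RHS]addrAC subrK.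
Qed.

Let remS l M z : 1 < normc l ->
  rem l M z = ('C(M.+2, 2)%:R * l ^- M.+3) *: z + rem l M.+1 (T z).
Proof.
move=> l1; have lR := resolvent_linear l1.
have lN0 : l != 0 by apply: contraTneq l1 => ->; rewrite normc0 ltr10.
have RB a u v : Rs l (a *: u - v) = a *: Rs l u - Rs l v.
  by rewrite addrC -scaleN1r lR scaleN1r addrC; congr (_ - _);
     have := linear_lincomb lR [:: tt] (fun=> a) (fun=> u); rewrite !big_seq1.
rewrite /rem !resolventT// !RB.
set a := Rs l (Rs l (Rs l z)); set b := Rs l (Rs l z); set c := Rs l z.
have e (n : nat) : l * l ^- n.+1 = l ^- n.
  by rewrite exprS invfM mulrA divff// mul1r.
rewrite !scalerBr !scalerA.
have -> : l ^- M.+1 * l = l ^- M by rewrite mulrC e.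
have -> : M.+1%:R * l ^- M.+2 * l = M.+1%:R * l ^- M.+1 by rewrite -mulrA [_ * l]mulrC e.
have -> : 'C(M.+2, 2)%:R * l ^- M.+3 * l = 'C(M.+2, 2)%:R * l ^- M.+2.
  by rewrite -mulrA [_ * l]mulrC e.
have -> : 'C(M.+2, 2)%:R = 'C(M.+1, 2)%:R + M.+1%:R :> R[i].
  by rewrite binS bin1 natrD.
rewrite -[M.+1%:R]natr1 !mulrDl !mul1r !scalerDl.
exact: regroup.
Qed.

Let cube_expansion l M y : 1 < normc l ->
  Rs l (Rs l (Rs l y)) = \sum_(k < M) ('C(k.+2, 2)%:R * l ^- k.+3) *: iter k T y
    + rem l M (iter M T y).
Proof.
move=> l1; elim: M => [|M IH].
  rewrite big_ord0 add0r /rem expr0 invr1 scale1r mul0r scale0r addr0.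
  by rewrite bin_small// mul0r scale0r addr0.
by rewrite big_ord_recr /= -addrA -remS// -IH.
Qed.

Section Mean.
Variable n : nat.

(** This radius balances two needs: r^(n+3) is at most exp 3, while |l - 1| >= r - 1 >= 1 / (n + 1)
    on the circle. *)
Let r : R := expR (n.+1%:R^-1).

Let n0 : 0 < n.+1%:R :> R. Proof. by rewrite ltr0n. Qed.

Let r_ge : 1 + n.+1%:R^-1 <= r. Proof. exact: expR_ge1Dx. Qed.

Let r1 : 1 < r. Proof. by apply: lt_le_trans r_ge; rewrite ltrDl invr_gt0. Qed.

Let r0 : 0 < r. Proof. exact: expR_gt0. Qed.

Let rX M : r ^+ M = expR (M%:R / n.+1%:R).
Proof. by rewrite expRM_natl. Qed.

Let Q := CR * n.+1%:R.

Let Q0 : 0 <= Q. Proof. by rewrite mulr_ge0. Qed.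

Let Rs_norm l x : normc l = r -> rnorm (Rs l x) <= Q * rnorm x.
Proof.
move=> lr; have l1 : 1 < normc l by rewrite lr.
have lm : n.+1%:R^-1 <= normc (l - 1).
  have := le_normcD (l - 1) 1; rewrite subrK normc1 lr -lerBlDr.
  by apply: le_trans; rewrite lerBrDl.
have := RsC l1 x; rewrite rnormZ => H.
have : n.+1%:R^-1 * rnorm (Rs l x) <= CR * rnorm x.
  by apply: le_trans H; rewrite ler_wpM2r ?rnorm_ge0.
by rewrite ler_pdivrMl// /Q mulrAC mulrC.
Qed.

Let err := (Q ^+ 3 + Q ^+ 2 + Q) * P.

Let rem_norm l M y : normc l = r ->
  rnorm (rem l M (iter M T y)) <= (M.+1%:R ^+ 2 / r ^+ M) * (err * rnorm y).
Proof.
move=> lr; have l1 : 1 < normc l by rewrite lr.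
set z := iter M T y.
have zP : rnorm z <= P * rnorm y by exact: TP.
have z0 : 0 <= rnorm z := rnorm_ge0 _.
have b1 : rnorm (Rs l z) <= Q * rnorm z by exact: Rs_norm.
have b2 : rnorm (Rs l (Rs l z)) <= Q ^+ 2 * rnorm z.
  apply: (le_trans (Rs_norm _ lr)); rewrite expr2 -mulrA ler_wpM2l//.
have b3 : rnorm (Rs l (Rs l (Rs l z))) <= Q ^+ 3 * rnorm z.
  apply: (le_trans (Rs_norm _ lr)); rewrite exprS -mulrA ler_wpM2l//.
have rM : 0 < r ^+ M by rewrite exprn_gt0.
have nl k : normc (l ^- (M + k)) <= (r ^+ M)^-1.
  rewrite normcV normcX lr lef_pV2 ?posrE ?exprn_gt0//.
  by rewrite exprD ler_peMr ?(ltW rM)// exprn_ege1// ltW.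
have nn k : normc (k%:R : R[i]) = k%:R.
  have -> : (k%:R : R[i]) = ((k%:R : R)%:C)%C by rewrite rmorph_nat.
  by rewrite normc_real ger0_norm.
have MM : M%:R <= M.+1%:R ^+ 2 :> R.
  by rewrite -natrX ler_nat expnS expn1; exact: leq_trans (leqnSn _) (leq_pmulr _ _).
have BB : 'C(M.+1, 2)%:R <= M.+1%:R ^+ 2 :> R.
  rewrite -natrX ler_nat bin2 /= -divn2; apply: leq_trans (leq_div _ _) _.
  by rewrite expnS expn1 leq_mul2l leqnSn orbT.
have one : 1 <= M.+1%:R ^+ 2 :> R by rewrite -natrX ler1n expn_gt0.
have M20 : 0 <= M.+1%:R ^+ 2 :> R by rewrite sqr_ge0.
have I0 : 0 <= (r ^+ M)^-1 by rewrite invr_ge0 ltW.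
have h a c : 0 <= c -> a <= M.+1%:R ^+ 2 -> c <= (r ^+ M)^-1 -> 0 <= a ->
   a * c <= M.+1%:R ^+ 2 / r ^+ M.
  by move=> c0 aM cr a0; apply: ler_pM.
rewrite /rem; apply: (le_trans (rnormD _ _)); rewrite {1}rnormZ.
apply: (@le_trans _ _ ((M.+1%:R ^+ 2 / r ^+ M) * (Q ^+ 3 * rnorm z) +
  (M.+1%:R ^+ 2 / r ^+ M) * (Q ^+ 2 * rnorm z) +
  (M.+1%:R ^+ 2 / r ^+ M) * (Q * rnorm z))).
  apply: lerD.
    apply: (le_trans (rnormD _ _)); rewrite !rnormZ; apply: lerD.
      apply: ler_pM; rewrite ?normc_ge0 ?rnorm_ge0//.
      rewrite -[normc _]mul1r; apply: h; rewrite ?normc_ge0//.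
      by have := nl 0%N; rewrite addn0.
    apply: ler_pM; rewrite ?normc_ge0 ?rnorm_ge0// normcM nn.
    by apply: h; rewrite ?normc_ge0//; have := nl 1%N; rewrite addn1.
  apply: ler_pM; rewrite ?normc_ge0 ?rnorm_ge0// normcM nn.
  by apply: h; rewrite ?normc_ge0//; have := nl 2%N; rewrite addn2.
rewrite -!mulrDr -!mulrDl; apply: ler_wpM2l; first by rewrite mulr_ge0.
by rewrite /err -mulrA ler_wpM2l// !addr_ge0 ?exprn_ge0.
Qed.

Let err_small (B e : R) : 0 <= B -> 0 < e ->
  exists2 M : nat, (n < M)%N & M.+1%:R ^+ 2 / r ^+ M * B <= e.
Proof.
(* The cubic term of the exponential gives r^M >= (M / (n + 1))^3 / 6, which beats (M + 1)^2 <= 4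
   M^2; hence 24 = 6 * 4. *)
move=> B0 e0; pose K : R := 24 * n.+1%:R ^+ 3 * B / e.
have K0 : 0 <= K by rewrite divr_ge0 ?mulr_ge0 ?exprn_ge0 ?(ltW n0) ?(ltW e0).
pose M := maxn n.+1 (Num.truncn K).+1.
exists M; first by rewrite leq_maxl.
have KM : K <= M%:R.
  apply: (@le_trans _ _ ((Num.truncn K).+1%:R)); last by rewrite ler_nat leq_maxr.
  by rewrite ltW// truncnS_gt.
have M0 : 0 < M%:R :> R by rewrite ltr0n /M leq_max ltn0Sn.
have rM : (M%:R / n.+1%:R) ^+ 3 / 6 <= r ^+ M.
  rewrite rX; have := @expR_ge1Dxn _ (M%:R / n.+1%:R) 2 (divr_ge0 (ltW M0) (ltW n0)).
  by move=> H; apply: le_trans H; rewrite lerDr.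
have M1 : M.+1%:R <= 2 * M%:R :> R.
  rewrite -natr1; have : 1 <= M%:R :> R by rewrite ler1n -(ltr0n R).
  lra.
have p0 : 0 < (M%:R / n.+1%:R) ^+ 3 / 6 :> R by rewrite divr_gt0// exprn_gt0// divr_gt0.
apply: (@le_trans _ _ ((2 * M%:R) ^+ 2 / ((M%:R / n.+1%:R) ^+ 3 / 6) * B)).
  apply: ler_wpM2r => //; apply: ler_pM.
  - exact: sqr_ge0.
  - by rewrite invr_ge0 exprn_ge0// ltW.
  - by rewrite ler_sqr ?nnegrE ?mulr_ge0// ltW.
  - by rewrite lef_pV2 ?posrE ?exprn_gt0.
have -> : (2 * M%:R) ^+ 2 / ((M%:R / n.+1%:R) ^+ 3 / 6) * B = K * e / M%:R.
  have gen (a b : R) : 0 < a -> 0 < b ->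
      (2 * a) ^+ 2 / ((a / b) ^+ 3 / 6) * B = 24 * b ^+ 3 * B / e * e / a.
    by move=> a0 b0; field; rewrite !gt_eqF.
  exact: gen.
by rewrite ler_pdivrMr// mulrC ler_pM2l.
Qed.

Let radius M z i : M.-primitive_root z -> (0 < M)%N ->
  normc ((r%:C)%C * z ^+ i : R[i]) = r.
Proof.
move=> zM M0; rewrite normcM normc_real ger0_norm ?(ltW r0)//.
by rewrite (normc_prim_root M0 zM) mulr1.
Qed.

(* Discrete Cauchy formula: averaging l ^ (n + 3) R(l) ^ 3 over l = r w with
   w ^ M = 1 isolates the n-th coefficient of R(l) ^ 3 up to aliasing. *)
Lemma power_cube_mean y e : 0 < e -> exists M z,
  [/\ (n < M)%N, M.-primitive_root z &
   rnorm ('C(n.+2, 2)%:R *: iter n T y - (M%:R^-1 : R[i]) *: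
     \sum_(i < M) (((r%:C)%C * z ^+ i) ^+ n.+3) *: Rs ((r%:C)%C * z ^+ i)
       (Rs ((r%:C)%C * z ^+ i) (Rs ((r%:C)%C * z ^+ i) y))) <= e].
Proof.
move=> e0.
have B0 : 0 <= r ^+ n.+3 * (err * rnorm y).
  have err0 : 0 <= err by apply: mulr_ge0 => //; rewrite !addr_ge0 ?exprn_ge0.
  by apply: mulr_ge0; [apply: exprn_ge0; exact: ltW|apply: mulr_ge0 => //; exact: rnorm_ge0].
have [M nM HM] := err_small B0 e0.
have M0 : (0 < M)%N by apply: leq_ltn_trans nM.
have MR : 0 < M%:R :> R by rewrite ltr0n.
have MC : (M%:R : R[i]) != 0 by rewrite pnatr_eq0 -lt0n.
have [z zM] := exists_prim_root R M0.
exists M, z; split => //.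
pose l i : R[i] := (r%:C)%C * z ^+ i.
have lr i : normc (l i) = r by exact: (radius i zM M0).
have l1 i : 1 < normc (l i) by rewrite lr.
have rC : ((r%:C)%C : R[i]) != 0.
  by rewrite fmorph_eq0 gt_eqF.
have zN0 : z != 0 := prim_root_neq0 M0 zM.
(* The expansion is cut at the number M of roots: among indices below M only k = n survives the
   averaging, so the whole error is the averaged remainder. *)
have E : (M%:R^-1 : R[i]) *: \sum_(i < M) (l i ^+ n.+3) *: Rs (l i) (Rs (l i) (Rs (l i) y)) =
   'C(n.+2, 2)%:R *: iter n T y +
   (M%:R^-1 : R[i]) *: \sum_(i < M) (l i ^+ n.+3) *: rem (l i) M (iter M T y).
  under eq_bigr do rewrite (cube_expansion M y (l1 _)) scalerDr scaler_sumr.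
  rewrite big_split /= scalerDr; congr (_ + _).
  rewrite exchange_big /= (bigD1 (Ordinal nM))//= [X in _ *: (_ + X)]big1 ?addr0.
    rewrite (eq_bigr (fun=> 'C(n.+2, 2)%:R *: iter n T y)).
      by rewrite sumr_const card_ord -[(_ *: _) *+ M]scaler_nat [LHS]scalerA mulVf// scale1r.
    move=> i _; rewrite /= scalerA mulrCA mulfV ?mulr1// expf_neq0//.
    by rewrite mulf_neq0// expf_neq0.
  move=> k kn; under eq_bigr => i _ do rewrite /= scalerA.
  rewrite -scaler_suml (eq_bigr (fun i : 'I_M => ('C(k.+2, 2)%:R * ((r%:C)%C ^+ n.+3 / (r%:C)%C ^+ k.+3)) *
     ((z ^+ i) ^+ n / (z ^+ i) ^+ k))).
    rewrite -mulr_sumr (sum_prim_root_div M0 zM)//.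
    by rewrite [n == k]eq_sym -[n]/(val (Ordinal nM)) val_eqE (negbTE kn) mulr0 scale0r.
  move=> i _; rewrite /l mulrCA -mulrA; congr (_ * _).
  rewrite !exprMn invfM mulrACA; congr (_ * _).
  rewrite -[n.+3]addn3 -[k.+3]addn3 !exprD invfM mulrACA.
  by rewrite mulfV ?mulr1// !expf_neq0.
rewrite E opprD addrA subrr add0r rnormN rnormZ.
apply: le_trans HM.
have nM1 : normc (M%:R^-1 : R[i]) = M%:R^-1.
  have -> : (M%:R^-1 : R[i]) = ((M%:R^-1 : R)%:C)%C by rewrite fmorphV rmorph_nat.
  by rewrite normc_real ger0_norm// invr_ge0.
rewrite nM1 ler_pdivrMl//; apply: (le_trans (rnorm_sum _ _ _)).
apply: (@le_trans _ _ (\sum_(i < M) r ^+ n.+3 * (M.+1%:R ^+ 2 / r ^+ M * (err * rnorm y)))).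
  apply: ler_sum => i _; rewrite rnormZ normcX lr ler_wpM2l ?exprn_ge0 ?(ltW r0)//.
  exact: rem_norm.
by rewrite sumr_const card_ord -[leLHS]mulr_natl ler_wpM2l// mulrCA.
Qed.

End Mean.

(** Since M > n, r^M >= 2 and the Parseval estimate applies; moreover r^2 - 1 >= 2 / (n + 1). *)
Let inv_shift_sum n M z : (n < M)%N -> M.-primitive_root z ->
  \sum_(i < M) (normc (((expR (n.+1%:R^-1))%:C)%C * z ^+ i - 1 : R[i]) ^+ 2)^-1 <=
    M%:R * (3 / 2 * n.+1%:R) :> R.
Proof.
move=> nM zM; set r := expR _.
have n0 : 0 < n.+1%:R :> R by rewrite ltr0n.
have M0 : (0 < M)%N by apply: leq_ltn_trans nM.
have r1 : 1 + n.+1%:R^-1 <= r by exact: expR_ge1Dx.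
have i0 : 0 < n.+1%:R^-1 :> R by rewrite invr_gt0.
have r11 : 1 < r by apply: lt_le_trans r1; rewrite ltrDl.
have rM : 2 <= r ^+ M.
  rewrite /r -expRM_natl; apply: le_trans (expR_ge1Dx _).
  have -> : (2 : R) = 1 + 1 by ring.
  by rewrite lerD2l ler_pdivlMr// mul1r ler_nat.
apply: (le_trans (sum_inv_normc_sqr M0 zM r11 rM)); rewrite ler_wpM2l//.
have gen (u v : R) : 0 < v -> 1 + v <= u -> 2 * v <= u ^+ 2 - 1 by move=> ? ?; nra.
have h : 2 * n.+1%:R^-1 <= r ^+ 2 - 1 by exact: gen.
have h0 : 0 < r ^+ 2 - 1 by apply: lt_le_trans h; rewrite mulr_gt0.
rewrite ler_pdivrMr//; apply: (@le_trans _ _ (3 / 2 * n.+1%:R * (2 * n.+1%:R^-1))).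
  have g (v : R) : 0 < v -> 3 / 2 * v * (2 * v^-1) = 3 by move=> v0; field; rewrite gt_eqF.
  by rewrite g.
by rewrite ler_wpM2l// mulr_ge0// ltW.
Qed.

(** Common to powers (V = 1, m = 3) and to differences (V = T - 1, m = 2). In both cases R(l)^3 V is
    (l - 1)^-m times an operator of [G], and the coefficients of the average are summable with the
    bound r^(n+3) times the mean [S] of |l - 1|^-m, divided by the binomial coefficient. *)
Let mean_ptclosure n (V : X -> X) (c : R) (m : nat) (G : set (X -> X)) (L S : R) :
  0 <= c <= 'C(n.+2, 2)%:R ->
  (forall l, 1 < normc l -> exists2 W, G W & forall x,
     Rs l (Rs l (Rs l (V x))) = ((l - 1) ^- m) *: W x) ->
  (forall M z, (n < M)%N -> M.-primitive_root z ->
     \sum_(i < M) (normc (((expR (n.+1%:R^-1))%:C)%C * z ^+ i - 1 : R[i]) ^+ m)^-1 <=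
     M%:R * S) -> 0 <= S ->
  c / 'C(n.+2, 2)%:R * (expR 3 * S) <= L ->
  ptclosure (absconv L G) (fun x => (c%:C)%C *: iter n T (V x)).
Proof.
move=> /andP[c0 cC] GW HS S0 SL x e e0.
have [M [z [nM zM Hz]]] := power_cube_mean n (V x) e0.
set r : R := expR _ in Hz.
have n0 : 0 < n.+1%:R :> R by rewrite ltr0n.
have M0 : (0 < M)%N by apply: leq_ltn_trans nM.
have MR : 0 < M%:R :> R by rewrite ltr0n.
have r0 : 0 < r by exact: expR_gt0.
have r1 : 1 < r by rewrite /r expR_gt1 invr_gt0.
pose l (i : 'I_M) : R[i] := (r%:C)%C * z ^+ i.
have lr i : normc (l i) = r.
  by rewrite normcM normc_real ger0_norm ?(ltW r0)// (normc_prim_root M0 zM) mulr1.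
have l1 i : 1 < normc (l i) by rewrite lr.
pose B : R := 'C(n.+2, 2)%:R.
have B0 : 0 < B by rewrite ltr0n bin_gt0.
have nB : normc ((B%:C)%C : R[i]) = B by rewrite normc_real ger0_norm// ltW.
have BC : ((B%:C)%C : R[i]) != 0 by rewrite fmorph_eq0 gt_eqF.
have BE : ('C(n.+2, 2)%:R : R[i]) = (B%:C)%C by rewrite rmorph_nat.
have nMi : normc (M%:R^-1 : R[i]) = M%:R^-1.
  have -> : (M%:R^-1 : R[i]) = ((M%:R^-1 : R)%:C)%C by rewrite fmorphV rmorph_nat.
  by rewrite normc_real ger0_norm// invr_ge0 ltW.
have Hex i : exists W, G W /\ forall x,
     Rs (l i) (Rs (l i) (Rs (l i) (V x))) = ((l i - 1) ^- m) *: W x.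
  by have [W ? ?] := GW _ (l1 i); exists W.
have [W HW] := choice Hex.
pose a i : R[i] := (c%:C)%C / (B%:C)%C * M%:R^-1 * (l i ^+ n.+3 * (l i - 1) ^- m).
exists (fun x => \sum_(i < M) a i *: W i x).
  exists M, a, W; split => // [i|]; first by case: (HW i).
  have rn : r ^+ n.+3 <= expR 3.
    rewrite /r -expRM_natl ler_expR ler_pdivrMr//.
    by rewrite -natrM ler_nat mulnS -[n.+3]addn3 addnC leq_add2l leq_pmull.
  apply: le_trans SL.
  rewrite (eq_bigr (fun i => c / B * (M%:R^-1 * r ^+ n.+3) * (normc (l i - 1) ^+ m)^-1)); last first.
    move=> i _; rewrite /a (normcM ((c%:C)%C / (B%:C)%C * M%:R^-1)) (normcM ((c%:C)%C / (B%:C)%C)).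
    rewrite (normcM (c%:C)%C) (normcM (l i ^+ n.+3)) (normcV (B%:C)%C) nB nMi.
    by rewrite (normcX (l i)) lr normcV (normcX (l i - 1)) normc_real ger0_norm// !mulrA.
  rewrite -mulr_sumr -mulrA ler_wpM2l ?divr_ge0 ?(ltW B0)//.
  apply: (@le_trans _ _ (M%:R^-1 * r ^+ n.+3 * (M%:R * S))).
    apply: ler_wpM2l; last exact: (HS M z nM zM).
    by rewrite mulr_ge0 ?invr_ge0 ?exprn_ge0 ?(ltW r0).
  have -> : M%:R^-1 * r ^+ n.+3 * (M%:R * S) = r ^+ n.+3 * S.
    by rewrite mulrACA mulVf ?gt_eqF// mul1r.
  by rewrite ler_wpM2r.
have -> : \sum_(i < M) a i *: W i x = ((c%:C)%C / (B%:C)%C) *: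
    ((M%:R^-1 : R[i]) *: \sum_(i < M) (l i ^+ n.+3) *: Rs (l i) (Rs (l i) (Rs (l i) (V x)))).
  rewrite scalerA scaler_sumr; apply: eq_bigr => i _.
  by case: (HW i) => _ ->; rewrite !scalerA /a !mulrA.
have -> : (c%:C)%C *: iter n T (V x) = ((c%:C)%C / (B%:C)%C) *: ('C(n.+2, 2)%:R *: iter n T (V x)).
  by rewrite BE scalerA divfK.
rewrite -scalerBr rnormZ normcM normcV nB normc_real ger0_norm//.
apply: (@le_trans _ _ (1 * e)); last by rewrite mul1r.
apply: ler_pM => //; first by rewrite divr_ge0// ltW.
- exact: rnorm_ge0.
- by rewrite ler_pdivrMr// mul1r.
Qed.

Let F : set (X -> X) := [set S | exists2 l, 1 < normc l & S = fun x => (l - 1) *: Rs l x].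

Let Fm : set (X -> X) := [set S | exists2 A, F A & forall x, S x = A x - x].

Let sub1N0 (l : R[i]) : 1 < normc l -> l - 1 != 0.
Proof. by move=> l1; rewrite subr_eq0; apply: contraTneq l1 => ->; rewrite normc1 ltxx. Qed.

Let RsZ l a x : 1 < normc l -> Rs l (a *: x) = a *: Rs l x.
Proof.
move=> /resolvent_linear lR.
by have := linear_lincomb lR [:: tt] (fun=> a) (fun=> x); rewrite !big_seq1.
Qed.

Let bin2E n : 'C(n.+2, 2)%:R = (n.+1%:R * (n.+1%:R + 1)) / 2 :> R.
Proof.
have -> : (n.+1%:R * (n.+1%:R + 1)) = ('C(n.+2, 2) * 2)%:R :> R.
  by rewrite natr1 -natrM mulnC [in RHS]mulnC -(mul_bin_diag n.+2 1) bin1.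
by rewrite natrM mulfK.
Qed.

Lemma power_ptclosure n :
  ptclosure (absconv (3 * expR 3) (compset F (compset F F))) (iter n T).
Proof.
have n0 : 0 < n.+1%:R :> R by rewrite ltr0n.
have e3 : 0 <= expR (3 : R) by exact: expR_ge0.
have -> : iter n T = (fun x => (1%:C)%C *: iter n T x).
  by apply/funext => x; rewrite rmorph1 scale1r.
apply: (@mean_ptclosure n id 1 3 _ _ (n.+1%:R * (3 / 2 * n.+1%:R))).
- by rewrite ler01 ler1n bin_gt0.
- move=> l l1; pose A x := (l - 1) *: Rs l x.
  have FA : F A by exists l.
  exists (fun x => A (A (A x))).
    exists A, (fun x => A (A x)); split => //; by exists A, A.
  move=> x; rewrite /A !(RsZ _ _ l1) !scalerA.
  rewrite [X in X *: _](_ : _ = 1) ?scale1r//.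
  by field; exact: sub1N0.
- move=> M z nM zM; have := inv_shift_sum nM zM; set r : R := expR _ => H.
  have M0 : (0 < M)%N by apply: leq_ltn_trans nM.
  (* One factor |l - 1|^-1 is bounded by n + 1, which reduces the cube to the square treated by
     Parseval. *)
  apply: (@le_trans _ _ (\sum_(i < M) n.+1%:R * (normc ((r%:C)%C * z ^+ i - 1 : R[i]) ^+ 2)^-1)).
    apply: ler_sum => i _; rewrite exprS invfM ler_wpM2r ?invr_ge0 ?sqr_ge0//.
    have r1 : 1 + n.+1%:R^-1 <= r by exact: expR_ge1Dx.
    have i0 : 0 < n.+1%:R^-1 :> R by rewrite invr_gt0.
    have lm : n.+1%:R^-1 <= normc ((r%:C)%C * z ^+ i - 1 : R[i]).
      have := le_normcD ((r%:C)%C * z ^+ i - 1) 1; rewrite subrK normc1 normcM.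
      rewrite normc_real ger0_norm ?expR_ge0// (normc_prim_root M0 zM) mulr1 -lerBlDr.
      by apply: le_trans; rewrite lerBrDl.
    by rewrite -[leRHS]invrK lef_pV2 ?posrE// (lt_le_trans i0).
  by rewrite -mulr_sumr mulrCA ler_wpM2l// ltW.
- by rewrite !mulr_ge0// ltW.
rewrite bin2E; set x := n.+1%:R in n0 *.
have -> : 1 / (x * (x + 1) / 2) * (expR 3 * (x * (3 / 2 * x))) = 3 * expR 3 * (x / (x + 1)).
  by field; rewrite !gt_eqF// addr_gt0.
rewrite ler_piMr ?mulr_ge0// ler_pdivrMr ?addr_gt0// mul1r lerDl//.
Qed.

Lemma power_diff_ptclosure n :
  ptclosure (absconv (3 * expR 3) (compset F (compset F Fm)))
    (fun x => ((n.+1%:R)%:C)%C *: iter n T (T x - x)).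
Proof.
have n0 : 0 < n.+1%:R :> R by rewrite ltr0n.
have e3 : 0 <= expR (3 : R) by exact: expR_ge0.
apply: (@mean_ptclosure n (fun x => T x - x) n.+1%:R 2 _ _ (3 / 2 * n.+1%:R)).
- rewrite ler0n /= bin2E.
  have gen (v : R) : 1 <= v -> v <= v * (v + 1) / 2 by move=> ?; nra.
  by apply: gen; rewrite ler1n.
- move=> l l1; pose A x := (l - 1) *: Rs l x.
  have FA : F A by exists l.
  exists (fun x => A (A (A x - x))).
    exists A, (fun x => A (A x - x)); split => //; exists A, (fun x => A x - x); split => //.
    by exists A.
  have lR := resolvent_linear l1.
  have RB u v : Rs l (u - v) = Rs l u - Rs l v.
    by rewrite addrC -scaleN1r lR scaleN1r addrC.
  move=> x; rewrite /A !(RsZ _ _ l1) !scalerA.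
  rewrite [X in _ = X *: _](_ : _ = 1); last by field; exact: sub1N0.
  rewrite scale1r; congr (Rs l (Rs l _)).
  by rewrite RB resolventT// scalerBl scale1r addrAC.
- by move=> M z; exact: inv_shift_sum.
- by rewrite !mulr_ge0// ltW.
rewrite bin2E; set x := n.+1%:R in n0 *.
have -> : x / (x * (x + 1) / 2) * (expR 3 * (3 / 2 * x)) = 3 * expR 3 * (x / (x + 1)).
  by field; rewrite !gt_eqF// addr_gt0.
rewrite ler_piMr ?mulr_ge0// ler_pdivrMr ?addr_gt0// mul1r lerDl//.
Qed.

End ResolventPowers.

(** * From the Ritt conditions to square functions *)

Section DyadicDecomposition.
Context (R : realType).
Local Notation D := ('X - 1 : {poly R[i]}).

(** The exponents are 0, 1, 2, 4, 8, ...: the value 0 at j = 0 makes the first block 1 - T, so that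
    the blocks telescope from the identity. *)
Definition dyadic_exp j : nat := (2 ^ j)./2.
Local Notation e := dyadic_exp.

Lemma dyadic_expS j : e j.+1 = (2 ^ j)%N.
Proof. by rewrite /dyadic_exp expnS mul2n doubleK. Qed.

Definition dyadic_diff j : {poly R[i]} := 'X^(e j) - 'X^(e j.+1).

(** The quotient of g(u) - g(u^2) by (u - u^2)^2, with g(u) = 3 u^2 - 2 u^3 and u = X^(e j). The
    first block passes from 1 to X, not from u to u^2, and has its own quotient. *)
Definition dyadic_cofactor j : {poly R[i]} :=
  if j is j'.+1 then 3%:P + 4%:P * 'X^(e j) + 2%:P * 'X^(e j) * 'X^(e j)
  else 1 + 2%:P * 'X.

(* g = 3 u ^ 2 - 2 u ^ 3 satisfies g 1 = 1, and g u - g (u ^ 2) is divisible by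
   (u - u ^ 2) ^ 2. *)
Lemma dyadic_reproducing J :
  1 = \sum_(j < J) dyadic_diff j * dyadic_cofactor j * dyadic_diff j +
    (3%:P * 'X^(e J) ^+ 2 - 2%:P * 'X^(e J) ^+ 3).
Proof.
have c3 : (3%:P : {poly R[i]}) = 3 by rewrite polyC_natr.
have c2 : (2%:P : {poly R[i]}) = 2 by rewrite polyC_natr.
have c4 : (4%:P : {poly R[i]}) = 4 by rewrite polyC_natr.
elim: J => [|J ->]; first by rewrite big_ord0 /dyadic_exp /= expr0 c3 c2; ring.
rewrite big_ord_recr /= -addrA; congr (_ + _).
rewrite /dyadic_diff /dyadic_cofactor; case: J => [|J].
  by rewrite dyadic_expS expn0 expr1 /dyadic_exp /= expr0 c3 c2; ring.
rewrite (dyadic_expS J.+1) expnS mul2n -addnn exprD -dyadic_expS c2 c3 c4.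
by ring.
Qed.

Lemma dyadic_diffE j :
  dyadic_diff j = - \sum_(i < e j.+1 - e j) 'X^(e j + i) * D.
Proof.
rewrite -mulr_suml; under eq_bigr do rewrite exprD.
rewrite -mulr_sumr -mulrA.
have -> : (\sum_(i < e j.+1 - e j) 'X^i) * D = 'X^(e j.+1 - e j) - 1.
  by rewrite mulrC subrX1.
rewrite mulrBr mulr1 -exprD subnKC ?opprB//.
rewrite dyadic_expS /dyadic_exp -divn2; exact: leq_div.
Qed.

End DyadicDecomposition.

Section SchurTest.
Context d (Omega : measurableType d) (R : realType).
Variables (mu : {measure set Omega -> \bar R}) (p : R) (p1 : 1 <= p).
Local Notation X := (Lp mu p1).

(** Weighted Cauchy-Schwarz with the row sums extracts one factor sqrt B, [l2_bounded] then removes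
    the operators, and the column sums give the other sqrt B. The weight [s] stands for the factor k
    of the square function. *)
Lemma schur_test (N J : nat) (F : set (X -> X)) (W : 'I_N -> 'I_J -> X -> X)
    (b : 'I_N -> 'I_J -> R) (s : 'I_N -> R) (B C : R) (y : 'I_J -> X) :
  0 <= C -> linset F -> l2_bounded C F -> (forall k j, F (W k j)) ->
  0 <= B -> (forall k j, 0 <= b k j) -> (forall k, 0 < s k) ->
  (forall k, \sum_j b k j <= B) -> (forall j, \sum_k b k j / s k <= B) ->
  sqn (fun k => \sum_j ((b k j / Num.sqrt (s k))%:C)%C *: W k j (y j)) <= B * C * sqn y.
Proof.
move=> C0 lF HF FW B0 b0 s0 bB bsB.
have bs0 k j : 0 <= b k j / s k by rewrite divr_ge0// ltW.
pose a k j : R[i] := ((Num.sqrt (b k j / s k))%:C)%C.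
have sB : Num.sqrt B ^+ 2 = B by rewrite sqr_sqrtr.
pose z := fun kj : 'I_N * 'I_J => W kj.1 kj.2 (a kj.1 kj.2 *: y kj.2).
have H1 : sqn (fun k => \sum_j ((b k j / Num.sqrt (s k))%:C)%C *: W k j (y j)) <= Num.sqrt B * sqn z.
  apply: sqn_le; first exact: sqrtr_ge0.
  rewrite sB.
  have A1 : \forall w \ae mu, forall k,
     Lp_rep (\sum_j ((b k j / Num.sqrt (s k))%:C)%C *: W k j (y j)) w =
     \sum_j ((b k j / Num.sqrt (s k))%:C)%C * Lp_rep (W k j (y j)) w.
    by apply: filter_forall => k; exact: Lp_rep_lincomb.
  have A2 : \forall w \ae mu, forall kj : 'I_N * 'I_J,
     Lp_rep (z kj) w = a kj.1 kj.2 * Lp_rep (W kj.1 kj.2 (y kj.2)) w.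
    apply: filter_forall => kj; rewrite /z.
    have := linear_lincomb (lF _ (FW kj.1 kj.2)) [:: tt] (fun=> a kj.1 kj.2) (fun=> y kj.2).
    by rewrite !big_seq1 => ->; exact: Lp_repZ_ae.
  apply: filterS2 A1 A2 => w E1 E2.
  rewrite -(pair_bigA _ (fun k j => normc (Lp_rep (z (k, j)) w) ^+ 2)) /= mulr_sumr.
  apply: ler_sum => k _; rewrite E1.
  pose v j := (((Num.sqrt (s k))^-1)%:C)%C * Lp_rep (W k j (y j)) w.
  rewrite (eq_bigr (fun j => ((b k j)%:C)%C * v j)); last first.
    by move=> j _; rewrite /v mulrA -(rmorphM (real_complex R)).
  apply: (le_trans (normc_lincomb_sqr (L := B) v _)).
    by under eq_bigr do rewrite normc_real ger0_norm//; exact: bB.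
  rewrite ler_wpM2l// le_eqVlt; apply/orP; left; apply/eqP; apply: eq_bigr => j _.
  rewrite (E2 (k, j)) /v !normcM !exprMn normc_sqrt// !normc_real ger0_norm//.
  rewrite real_normK ?num_real// exprVn sqr_sqrtr ?(ltW (s0 k))//.
  by rewrite mulrA.
have H2 : sqn z <= C * sqn (fun kj : 'I_N * 'I_J => a kj.1 kj.2 *: y kj.2).
  by apply: (HF _ (fun kj => W kj.1 kj.2)) => kj; exact: FW.
have H3 : sqn (fun kj : 'I_N * 'I_J => a kj.1 kj.2 *: y kj.2) <= Num.sqrt B * sqn y.
  apply: sqn_le; first exact: sqrtr_ge0.
  rewrite sB.
  have A2 : \forall w \ae mu, forall kj : 'I_N * 'I_J,
     Lp_rep (a kj.1 kj.2 *: y kj.2) w = a kj.1 kj.2 * Lp_rep (y kj.2) w.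
    by apply: filter_forall => kj; exact: Lp_repZ_ae.
  apply: filterS A2 => w E2.
  rewrite -(pair_bigA _ (fun k j => normc (Lp_rep (a k j *: y j) w) ^+ 2)) /= exchange_big /=.
  rewrite mulr_sumr; apply: ler_sum => j _.
  rewrite (eq_bigr (fun k => b k j / s k * normc (Lp_rep (y j) w) ^+ 2)).
    by rewrite -mulr_suml ler_wpM2r ?sqr_ge0.
  by move=> k _; rewrite (E2 (k, j)) normcM exprMn normc_sqrt.
apply: (le_trans H1); rewrite -{2}sB expr2 -!mulrA ler_wpM2l ?sqrtr_ge0//.
apply: (le_trans H2); rewrite [leRHS]mulrCA; exact: ler_wpM2l.
Qed.

End SchurTest.

Section SquareFunction.
Context d (Omega : measurableType d) (R : realType).
Variables (mu : {measure set Omega -> \bar R}) (p : R) (p1 : 1 <= p).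
Local Notation X := (Lp mu p1).
Variables (T : X -> X) (C1 C2 C3 : R).
Hypotheses (lT : linear T) (C10 : 0 <= C1) (C20 : 0 <= C2) (C30 : 0 <= C3).

Definition powers (S : X -> X) : set (X -> X) := [set A | exists n, A = iter n S].
Definition power_diffs (S : X -> X) : set (X -> X) :=
  [set A | exists n, A = fun x => ((n.+1%:R)%:C)%C *: iter n S (S x - x)].

Hypotheses (H1 : l2_bounded C1 (powers T)) (H2 : l2_bounded C2 (power_diffs T)).
Hypothesis H3 : forall J x,
  sqn (fun j : 'I_J => pact T (dyadic_diff R j) x) <= C3 * rnorm x.

Local Notation D := ('X - 1 : {poly R[i]}).
Local Notation e := dyadic_exp.
Local Notation beta := (@dyadic_weight R).

Lemma pact_diff n x : pact T ('X^n * D) x = iter n T (T x - x).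
Proof. by rewrite pactM// pactB// pactX// pact1 pactXn. Qed.

Lemma iter_diff n x : iter n.+1 T x - iter n T x = pact T ('X^n * D) x.
Proof. by rewrite mulrBr mulr1 -exprSr pactB// !pactXn. Qed.

Lemma linset_powers : linset (powers T).
Proof. by move=> A [n ->]; exact: linear_iter. Qed.

Lemma linset_power_diffs : linset (power_diffs T).
Proof.
move=> A [n ->] a u v; rewrite -!pact_diff linear_pact//.
by rewrite scalerDr !scalerA mulrC.
Qed.

Let G := compset (powers T) (power_diffs T `|` compset (power_diffs T) (power_diffs T)).

Let linG : linset G.
Proof.
apply: linset_comp; first exact: linset_powers.
move=> A [|]; first exact: linset_power_diffs.
by apply: linset_comp; exact: linset_power_diffs.
Qed.

Let CG := C1 * (C2 + C2 * C2).

Let CG0 : 0 <= CG. Proof. by rewrite mulr_ge0// addr_ge0// mulr_ge0. Qed.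

Let l2G : l2_bounded CG G.
Proof.
apply: l2_bounded_comp => //; apply: l2_boundedU => //; first exact: mulr_ge0.
exact: l2_bounded_comp.
Qed.

Let natC (k : nat) : ((k%:R)%:C)%C = k%:R :> R[i].
Proof. by rewrite rmorph_nat. Qed.

Let pd n x : pact T ('X^n * D) x = ((n.+1%:R^-1)%:C)%C *: (((n.+1%:R)%:C)%C *: iter n T (T x - x)).
Proof.
by rewrite pact_diff scalerA -rmorphM mulVf ?pnatr_eq0// rmorph1 scale1r.
Qed.

Let pactZr f c x : pact T f (c *: x) = c *: pact T f x.
Proof.
by have := linear_lincomb (linear_pact lT f) [:: tt] (fun=> c) (fun=> x); rewrite !big_seq1.
Qed.

(** The factor k T^k D P_j is [dyadic_weight] times a combination of operators of [G] with
    coefficients summing to at most 4. The two regimes of the weight need different factorizations,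
    which is why [G] allows one or two difference factors. *)
Let block k j : exists2 W, absconv 4 G W &
  forall x, ((k.+1%:R)%:C)%C *: pact T ('X^k * D * dyadic_diff R j) x =
    ((beta k.+1 j)%:C)%C *: W x.
Proof.
have k0 : 0 < k.+1%:R :> R by rewrite ltr0n.
have j0 : 0 < (2 ^ j)%:R :> R by rewrite ltr0n expn_gt0.
have b0 : 0 < beta k.+1 j.
  by rewrite /dyadic_weight; case: ifP => _; rewrite divr_gt0.
suff [m [c [A [GA cA HA]]]] : exists m (c : 'I_m -> R) (A : 'I_m -> X -> X),
    [/\ forall i, G (A i), \sum_i `|c i| <= 4 * beta k.+1 j &
     forall x, ((k.+1%:R)%:C)%C *: pact T ('X^k * D * dyadic_diff R j) x =
       \sum_i ((c i)%:C)%C *: A i x].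
  exists (fun x => \sum_i ((c i / beta k.+1 j)%:C)%C *: A i x).
    exists m, (fun i => ((c i / beta k.+1 j)%:C)%C), A; split => //.
    under eq_bigr do rewrite normc_real normrM normfV [`|beta _ _|]gtr0_norm//.
    by rewrite -mulr_suml ler_pdivrMr.
  move=> x; rewrite HA scaler_sumr; apply: eq_bigr => i _.
  by rewrite scalerA -rmorphM mulrC divfK// gt_eqF.
(* For 2^j <= k + 1 expand P_j into at most 2^j terms T^i D and split k = a + b: each term costs (k
   + 1) / ((a + 1) (b + 1)) <= 4 / (k + 1). *)
have [jk|kj] := leqP (2 ^ j) k.+1.
  pose a := k./2; pose b := (k - k./2)%N.
  have ab : (a + b = k)%N by rewrite /a /b; clear; lia.
  have a0 : 0 < a.+1%:R :> R by rewrite ltr0n.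
  have b0' : 0 < b.+1%:R :> R by rewrite ltr0n.
  exists (e j.+1 - e j)%N, (fun=> - (k.+1%:R / (a.+1%:R * b.+1%:R))),
    (fun i x => iter (e j + i) T ((((a.+1%:R)%:C)%C *: iter a T (T
       (((b.+1%:R)%:C)%C *: iter b T (T x - x)) - ((b.+1%:R)%:C)%C *: iter b T (T x - x))))).
  split.
  - move=> i; exists (iter (e j + i) T), (fun x => (((a.+1%:R)%:C)%C *: iter a T (T
       (((b.+1%:R)%:C)%C *: iter b T (T x - x)) - ((b.+1%:R)%:C)%C *: iter b T (T x - x)))).
    split; [by exists (e j + i)%N| |by []].
    right; exists (fun x => ((a.+1%:R)%:C)%C *: iter a T (T x - x)),
      (fun x => ((b.+1%:R)%:C)%C *: iter b T (T x - x)).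
    by split; [exists a|exists b|].
  - rewrite sumr_const card_ord -[leLHS]mulr_natl normrN ger0_norm; last first.
      by rewrite divr_ge0 ?mulr_ge0// ltW.
    rewrite /dyadic_weight jk.
    have ka : k.+1%:R <= 2 * a.+1%:R :> R.
      by rewrite -natrM ler_nat /a; clear; lia.
    have kb : k.+1%:R <= 2 * b.+1%:R :> R.
      by rewrite -natrM ler_nat /b; clear; lia.
    have ej : (e j.+1 - e j)%:R <= (2 ^ j)%:R :> R.
      by rewrite ler_nat dyadic_expS leq_subr.
    have kab : k.+1%:R / (a.+1%:R * b.+1%:R) <= 4 / k.+1%:R :> R.
      rewrite ler_pdivrMr ?mulr_gt0// mulrAC ler_pdivlMr//.
      apply: (@le_trans _ _ ((2 * a.+1%:R) * (2 * b.+1%:R))).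
        by apply: ler_pM => //; exact: ltW.
      by rewrite le_eqVlt; apply/orP; left; apply/eqP; ring.
    apply: (@le_trans _ _ ((2 ^ j)%:R * (4 / k.+1%:R))).
      by apply: ler_pM => //; rewrite divr_ge0// mulr_ge0// ltW.
    by rewrite mulrCA.
  move=> x; rewrite dyadic_diffE mulrN pactN// mulr_sumr pact_sum// scalerN scaler_sumr -sumrN.
  apply: eq_bigr => i _.
  have -> : 'X^k * D * ('X^(e j + i) * D) = 'X^(e j + i) * (('X^a * D) * ('X^b * D)).
    by rewrite -ab (exprD _ a b); ring.
  rewrite (pactM lT 'X^(e j + i)) (pactM lT ('X^a * D)) pactXn (pd b) pactZr.
  rewrite (pd a); set B := (_ *: iter b T _); move: (_ *: iter a T (T B - B)) => A.
  rewrite -!pactXn !pactZr !scalerA -scaleNr; congr (_ *: _).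
  move: (k.+1%:R) (a.+1%:R) (b.+1%:R) => u v w.
  by rewrite rmorphN -!(rmorphM (real_complex R)) invfM [v^-1 * _]mulrC mulrA.
(* For 2^j > k + 1 no cancellation in P_j is used: each of its two powers is joined to T^k D, and n
   + 1 > 2^j / 2 supplies the gain (k + 1) / (n + 1). *)
case: j j0 b0 kj => [|j] j0 b0 kj; first by rewrite expn0 ltnS leqn0 in kj.
have em : e j.+1 = (2 ^ j)%N by rewrite dyadic_expS.
have em1 : e j.+2 = (2 ^ j + 2 ^ j)%N by rewrite dyadic_expS expnS mul2n addnn.
pose m := (2 ^ j)%N; pose n := (k + m)%N.
pose c : R := k.+1%:R / n.+1%:R.
pose E x := ((n.+1%:R)%:C)%C *: iter n T (T x - x).
have n0 : 0 < n.+1%:R :> R by rewrite ltr0n.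
exists 2%N, (fun i : 'I_2 => if i == ord0 then c else - c),
  (fun i x => iter (if i == ord0 then 0 else m) T (E x)).
split.
- move=> i; exists (iter (if i == ord0 then 0 else m) T), E; split => //.
    by exists (if i == ord0 then 0 else m)%N.
  by left; exists n.
- rewrite big_ord_recl big_ord1 /= normrN.
  have c0 : 0 <= c by rewrite divr_ge0// ltW.
  rewrite (ger0_norm c0) /dyadic_weight leqNgt kj /=.
  have -> : c + c = k.+1%:R * (2 / n.+1%:R) by rewrite mulrCA -/c; ring.
  rewrite (mulrCA 4) ler_wpM2l ?(ltW k0)//.
  rewrite ler_pdivrMr// mulrAC ler_pdivlMr//.
  have -> : (2 ^ j.+1)%:R = 2 * m%:R :> R by rewrite expnS natrM.
  have : m%:R <= n.+1%:R :> R by rewrite ler_nat /n; clear; lia.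
  by move=> ?; lra.
move=> x; rewrite big_ord_recl big_ord1 /=.
rewrite /dyadic_diff em em1 mulrBr pactB//.
have -> : 'X^k * D * 'X^(2 ^ j) = 'X^n * D by rewrite mulrAC -exprD.
have -> : 'X^k * D * 'X^(2 ^ j + 2 ^ j) = 'X^m * ('X^n * D) by rewrite /n !exprD; ring.
rewrite (pactM lT 'X^m) !pactXn pd -/(E x) -[iter m T (_ *: _)]pactXn pactZr pactXn.
rewrite rmorphN scaleNr scalerBr; move: (E x) (iter m T (E x)) => u v.
by rewrite !scalerA -(rmorphM (real_complex R)).
Qed.

(** The constant 9 is the coefficient sum 3 + 4 + 2. *)
Let cofactor_powers j : absconv 9 (powers T) (pact T (dyadic_cofactor R j)).
Proof.
have n2 : normc (2 : R[i]) = 2 by rewrite -[2]natC normc_real ger0_norm.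
have n3 : normc (3 : R[i]) = 3 by rewrite -[3]natC normc_real ger0_norm.
have n4 : normc (4 : R[i]) = 4 by rewrite -[4]natC normc_real ger0_norm.
have gen (a b c : R[i]) x u :
    \sum_(i < 3) [:: a; b; c]`_i *: iter (i * u) T x =
      a *: x + (b *: iter u T x + c *: iter (u + u) T x).
  by rewrite !big_ord_recl big_ord0 addr0 /= /bump /= addn0 mulnDl mul1n.
pose u : nat := if j is 0 then 1%N else e j.
exists 3%N, (fun i : 'I_3 => nth 0 (if j is 0 then [:: 1; 2; 0] else [:: 3; 4; 2]) i),
  (fun i => iter (i * u) T).
split.
- by move=> i; exists (i * u)%N.
- have gen' (a b c : R[i]) :
      \sum_(i < 3) normc [:: a; b; c]`_i = normc a + (normc b + normc c).
    by rewrite !big_ord_recl big_ord0 /= addr0.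
  by case: j {u} => [|j]; rewrite gen' ?normc1 ?normc0 n2 ?n3 ?n4; lra.
move=> x; rewrite (_ : \sum_i _ = \sum_(i < 3) (if j is 0 then [:: 1; 2; 0] else
  [:: 3; 4; 2])`_i *: iter (i * u) T x)//.
case: j @u => [|j] u.
  rewrite gen /dyadic_cofactor pactD// pact1 scale1r scale0r addr0; congr (_ + _).
  by rewrite mul_polyC pactZ// pactX.
rewrite gen /dyadic_cofactor !pactD// -addrA; congr (_ + (_ + _)).
- by rewrite -[_%:P]mulr1 mul_polyC pactZ// pact1.
- by rewrite mul_polyC pactZ// pactXn.
by rewrite -mulrA mul_polyC pactZ// -exprD pactXn addnn -mul2n.
Qed.

Let rnorm_diff n x : rnorm (pact T ('X^n * D) x) <= C2 / n.+1%:R * rnorm x.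
Proof.
have n0 : 0 < n.+1%:R :> R by rewrite ltr0n.
have := l2_bounded_opnorm H2 (_ : power_diffs T _) x => /(_ _ (ex_intro _ n erefl)) /=.
rewrite -pact_diff rnormZ normc_real ger0_norm// => H.
by rewrite mulrAC ler_pdivlMr// mulrC.
Qed.

(** The Schur bound does not depend on the number of blocks, which may thus be chosen in terms of
    [N], [x] and a tolerance [t] so large that the remainder contributes at most [t]. *)
Lemma finite_square_function_estimate N x :
  sqn (fun k : 'I_N => ((Num.sqrt k.+1%:R)%:C)%C *: (iter k.+1 T x - iter k T x)) <=
    4 * (4 * CG) * (9 * C1 * C3) * rnorm x.
Proof.
apply/ler_addgt0Pr => t t0.
(* A crude bound for the remainder: [N] terms of weight at most [N], and 5 = 3 + 2 from the
   coefficients of 3 u^2 - 2 u^3. *)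
pose A := N%:R * N%:R * (5 * C2) * rnorm x.
have A0 : 0 <= A by rewrite !mulr_ge0 ?rnorm_ge0.
pose J := (Num.truncn (A / t)).+1.
have eJ : A / t <= (e J.+1).+1%:R.
  apply: (@le_trans _ _ J%:R); first by rewrite ltW// truncnS_gt.
  by rewrite ler_nat dyadic_expS ltnW// ltnS ltnW// ltn_expl.
pose y (j : 'I_J.+1) := pact T (dyadic_cofactor R j) (pact T (dyadic_diff R j) x).
have yx : sqn y <= 9 * C1 * C3 * rnorm x.
  have := l2_bounded_absconv (ler0n _ 9) C10 linset_powers H1.
  move=> /(_ _ (fun j : 'I_J.+1 => pact T (dyadic_cofactor R j))
    (fun j => pact T (dyadic_diff R j) x)) H.
  apply: (le_trans (H _)); first by move=> j; exact: cofactor_powers.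
  by rewrite -(mulrA _ C3) ler_wpM2l// mulr_ge0.
have [W HW] : exists W : 'I_N -> 'I_J.+1 -> X -> X, forall k j, absconv 4 G (W k j) /\
    forall x, ((k.+1%:R)%:C)%C *: pact T ('X^k * D * dyadic_diff R j) x =
    ((beta k.+1 j)%:C)%C *: W k j x.
  suff /choice[W HW] : forall kj : 'I_N * 'I_J.+1, exists W, absconv 4 G W /\
    forall x, ((kj.1.+1%:R)%:C)%C *: pact T ('X^(kj.1) * D * dyadic_diff R kj.2) x =
    ((beta kj.1.+1 kj.2)%:C)%C *: W x.
    by exists (fun k j => W (k, j)) => k j; exact: (HW (k, j)).
  by move=> kj; have [W ? ?] := block kj.1 kj.2; exists W.
pose r (k : 'I_N) := pact T ('X^k * D * (3%:P * 'X^(e J.+1) ^+ 2 - 2%:P * 'X^(e J.+1) ^+ 3)) x.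
have E (k : 'I_N) : ((Num.sqrt k.+1%:R)%:C)%C *: (iter k.+1 T x - iter k T x) =
    \sum_(j < J.+1) ((beta k.+1 j / Num.sqrt k.+1%:R)%:C)%C *: W k j (y j) +
    ((Num.sqrt k.+1%:R)%:C)%C *: r k.
  have s0 : 0 < Num.sqrt k.+1%:R :> R by rewrite sqrtr_gt0.
  rewrite iter_diff (_ : 'X^k * D = 'X^k * D *
    (\sum_(j < J.+1) dyadic_diff R j * dyadic_cofactor R j * dyadic_diff R j +
     (3%:P * 'X^(e J.+1) ^+ 2 - 2%:P * 'X^(e J.+1) ^+ 3))); last first.
    by rewrite -dyadic_reproducing mulr1.
  rewrite mulrDr.
  rewrite pactD// scalerDr; congr (_ + _).
  rewrite mulr_sumr pact_sum// scaler_sumr; apply: eq_bigr => j _.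
  rewrite [X in _ *: pact T X x](_ : _ =
    'X^k * D * dyadic_diff R j * (dyadic_cofactor R j * dyadic_diff R j)); last by ring.
  rewrite (pactM lT ('X^k * D * _)) (pactM lT (dyadic_cofactor R j)) -/(y j).
  have -> : beta k.+1 j / Num.sqrt k.+1%:R = (Num.sqrt k.+1%:R)^-1 * beta k.+1 j.
    by rewrite mulrC.
  rewrite (rmorphM (real_complex R)) -scalerA -(proj2 (HW k j)) scalerA.
  rewrite -(rmorphM (real_complex R)); congr ((_%:C)%C *: _).
  by rewrite -{3}(sqr_sqrtr (ler0n R k.+1)) expr2 mulKf ?gt_eqF.
have rk (k : 'I_N) : rnorm (r k) <= 5 * C2 / (e J.+1).+1%:R * rnorm x.
  have -> : r k = (3 : R[i]) *: pact T ('X^(k + 2 * e J.+1) * D) x -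
      (2 : R[i]) *: pact T ('X^(k + 3 * e J.+1) * D) x.
    rewrite -!pactZ// -pactB//; congr (pact T _ x).
    have pw m : 'X^(k + m * e J.+1) = 'X^k * 'X^(e J.+1) ^+ m :> {poly R[i]}.
      by rewrite exprD [(m * _)%N]mulnC exprM.
    have gen (a b c u v : {poly R[i]}) : a * v * (b * u ^+ 2 - c * u ^+ 3) =
      b * (a * u ^+ 2 * v) - c * (a * u ^+ 3 * v) by ring.
    by rewrite -!mul_polyC !pw; exact: gen.
  have n2 : normc (2 : R[i]) = 2 by rewrite -[2]natC normc_real ger0_norm.
  have n3 : normc (3 : R[i]) = 3 by rewrite -[3]natC normc_real ger0_norm.
  apply: (le_trans (rnormB _ _)); rewrite !rnormZ n2 n3.
  have h m : (e J.+1 <= m)%N -> rnorm (pact T ('X^m * D) x) <= C2 / (e J.+1).+1%:R * rnorm x.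
    move=> em; apply: (le_trans (rnorm_diff _ _)); rewrite ler_wpM2r ?rnorm_ge0//.
    by rewrite ler_wpM2l// lef_pV2 ?posrE ?ltr0n// ler_nat.
  have h2 : rnorm (pact T ('X^(k + 2 * e J.+1) * D) x) <= C2 / (e J.+1).+1%:R * rnorm x.
    by apply: h; rewrite (leq_trans _ (leq_addl _ _))// leq_pmull.
  have h3 : rnorm (pact T ('X^(k + 3 * e J.+1) * D) x) <= C2 / (e J.+1).+1%:R * rnorm x.
    by apply: h; rewrite (leq_trans _ (leq_addl _ _))// leq_pmull.
  have -> : 5 * C2 / (e J.+1).+1%:R * rnorm x = 3 * (C2 / (e J.+1).+1%:R * rnorm x) +
    2 * (C2 / (e J.+1).+1%:R * rnorm x) by ring.
  by apply: lerD; rewrite ler_wpM2l.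
rewrite (_ : (fun k => _) = (fun k : 'I_N =>
    \sum_(j < J.+1) ((beta k.+1 j / Num.sqrt k.+1%:R)%:C)%C *: W k j (y j) +
    ((Num.sqrt k.+1%:R)%:C)%C *: r k)); last by apply/funext => k; exact: E.
apply: (le_trans (sqnD _ _)); apply: lerD.
  apply: (le_trans (schur_test (F := absconv 4 G) (C := 4 * CG) (B := 4)
    (b := fun (k : 'I_N) (j : 'I_J.+1) => beta k.+1 j) (s := fun k : 'I_N => k.+1%:R)
    y _ _ _ _ _ _ _ _ _)) => //.
  - exact: mulr_ge0.
  - exact: linset_absconv.
  - by apply: l2_bounded_absconv.
  - by move=> k j; case: (HW k j).
  - by move=> k j; exact: dyadic_weight_ge0.
  - by move=> k; exact: sum_dyadic_weight.
  - by move=> j; apply: (le_trans (sum_dyadic_weight_div R N j)); rewrite ler_nat.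
  have c0 : 0 <= 4 * (4 * CG) by rewrite mulr_ge0// mulr_ge0.
  by rewrite -(mulrA (4 * (4 * CG))); exact: ler_wpM2l.
apply: (le_trans (sqn_le_sum _)).
have e0 : 0 < (e J.+1).+1%:R :> R by rewrite ltr0n.
apply: (@le_trans _ _ (\sum_(k < N) N%:R * (5 * C2 / (e J.+1).+1%:R * rnorm x))).
  apply: ler_sum => k _; rewrite rnormZ normc_real ger0_norm ?sqrtr_ge0//.
  apply: ler_pM; rewrite ?sqrtr_ge0 ?rnorm_ge0//.
  apply: (@le_trans _ _ k.+1%:R); last by rewrite ler_nat.
  rewrite -{2}(sqr_sqrtr (ler0n R k.+1)) expr2 ler_peMr ?sqrtr_ge0//.
  by rewrite -{1}sqrtr1 ler_sqrt// ler1n.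
rewrite sumr_const card_ord -[leLHS]mulr_natl.
have -> : N%:R * (N%:R * (5 * C2 / (e J.+1).+1%:R * rnorm x)) = A / (e J.+1).+1%:R.
  by rewrite /A; ring.
by rewrite ler_pdivrMr// mulrC -ler_pdivrMr.
Qed.

End SquareFunction.

Section UnconditionalRitt.
Context d (Omega : measurableType d) (R : realType).
Variables (mu : {measure set Omega -> \bar R}) (p : R) (p1 : 1 <= p).
Local Notation X := (Lp mu p1).
Variables (T : X -> X).
Hypothesis lT : linear T.

(** A dyadic block is minus a sum of consecutive differences T^k - T^(k-1), so the coefficients are
    constant on blocks and the supremum does not grow. *)
Lemma dyadic_diff_lincomb J (t : nat -> R[i]) x : (forall j, normc (t j) <= 1) ->
  exists2 a : nat -> R[i], forall k, normc (a k) <= 1 &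
    \sum_(j < J) t j *: pact T (dyadic_diff R j) x =
    \sum_(1 <= k < (dyadic_exp J).+1) a k *: (iter k T x - iter k.-1 T x).
Proof.
move=> t1; elim: J => [|J [a a1 IH]].
  by exists (fun=> 0) => [k|]; rewrite ?normc0// big_ord0 /dyadic_exp /= big_geq.
exists (fun k => if (k <= dyadic_exp J)%N then a k else - t J).
  by move=> k; case: ifP => _; rewrite ?normcN.
have ee : (dyadic_exp J <= dyadic_exp J.+1)%N.
  by rewrite dyadic_expS /dyadic_exp -divn2; exact: leq_div.
rewrite big_ord_recr /= IH [RHS](@big_cat_nat _ _ _ (dyadic_exp J).+1)//=; congr (_ + _).
  by apply: eq_big_nat => k /andP[_]; rewrite ltnS => ->.
rewrite (eq_big_nat _ _ (F2 := fun k => (- t J) *: (iter k T x - iter k.-1 T x))); last first.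
  by move=> k /andP[kJ _]; rewrite leqNgt kJ.
rewrite -scaler_sumr big_add1 /= telescope_sumr// scaleNr -scalerN opprB.
by rewrite /dyadic_diff pactB// !pactXn.
Qed.

Lemma sqn_dyadic_diff (K : R) : 0 <= K ->
  (forall n (a : nat -> R[i]), opnorm_le (K * \big[Num.max/0]_(1 <= k < n.+1) normc (a k))
      (fun x => \sum_(1 <= k < n.+1) a k *: (iter k T x - iter k.-1 T x))) ->
  forall J x, sqn (fun j : 'I_J => pact T (dyadic_diff R j) x) <= 2 * K * rnorm x.
Proof.
move=> K0 HK J x; apply: (le_trans (sqn_le_rademacher _)); rewrite -mulrA ler_wpM2l//.
rewrite /rademacher_mean ler_pdivrMl ?exprn_gt0//.
apply: (@le_trans _ _ (\sum_(s : {ffun 'I_J -> bool}) K * rnorm x)); last first.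
  by rewrite sumr_const card_ffun card_bool card_ord -[leLHS]mulr_natl natrX.
apply: ler_sum => s _.
pose t (j : nat) : R[i] := if insub j is Some i then (-1) ^+ (s i) else 0.
have t1 j : normc (t j) <= 1.
  by rewrite /t; case: insub => [i|]; rewrite ?normcX ?normcN ?normc1 ?expr1n ?normc0.
have [a a1] := dyadic_diff_lincomb J x t1.
rewrite (eq_bigr (fun j : 'I_J => ((-1) ^+ s j) *: pact T (dyadic_diff R j) x)); last first.
  by move=> j _; rewrite /t valK.
move=> ->; apply: (le_trans (HK _ _ _)); rewrite ler_wpM2r ?rnorm_ge0//.
rewrite ler_piMr//; elim/big_ind: _ => // u v u1 v1.
by rewrite ge_max u1.
Qed.

End UnconditionalRitt.

(** * From square functions to the Ritt conditions *)

Section Halves.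
Context (R : realType).
Variables (f : nat -> R) (f0 : forall a, 0 <= f a).

Let sum_double m : \sum_(k < m.*2) f k./2 = 2 * \sum_(a < m) f a.
Proof.
elim: m => [|m IH]; first by rewrite !big_ord0 mulr0.
rewrite doubleS !big_ord_recr /= IH uphalf_double doubleK -addrA.
by rewrite -mulr2n -[f m *+ 2]mulr_natl -mulrDr.
Qed.

Lemma sum_half n : \sum_(k < n) f k./2 <= 2 * \sum_(a < n) f a.
Proof.
rewrite -sum_double -addnn big_split_ord /= lerDl.
by apply: sumr_ge0 => k _; exact: f0.
Qed.

Lemma sum_uphalf n : \sum_(k < n) f (uphalf k) <= 2 * \sum_(a < n.+1) f a.
Proof.
apply: le_trans (sum_half n.+1).
by rewrite big_ord_recl /= lerDr f0.
Qed.

End Halves.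

Section PairingPolynomials.
Context d (Omega : measurableType d) (R : realType).
Variables (mu : {measure set Omega -> \bar R}) (p q : R) (p1 : 1 <= p) (q1 : 1 <= q).
Hypotheses (pq : p^-1 + q^-1 = 1).
Local Notation X := (Lp mu p1).
Local Notation Y := (Lp mu q1).

Lemma pairingZ (a b : R[i]) (x : X) (y : Y) :
  Lp_pairing (a *: x) (b *: y) = a * b * Lp_pairing x y.
Proof.
have qp : q^-1 + p^-1 = 1 by rewrite addrC.
have := pairing_lincombl pq (fun _ : unit => a) (fun=> x) (b *: y).
have := pairing_lincombl qp (fun _ : unit => b) (fun=> y) x.
rewrite !(big_pred1 tt)// => E1 ->.
by rewrite -mulrA; congr (a * _); rewrite Lp_pairingC E1 Lp_pairingC.
Qed.

Variables (T : X -> X) (S : Y -> Y).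
Hypothesis TS : forall n x y, Lp_pairing (iter n T x) y = Lp_pairing x (iter n S y).

Lemma pairing_pact (f : {poly R[i]}) x y :
  Lp_pairing (pact T f x) y = Lp_pairing x (pact S f y).
Proof.
rewrite /pact (pairing_lincombl pq) [RHS]Lp_pairingC.
have qp : q^-1 + p^-1 = 1 by rewrite addrC.
rewrite (pairing_lincombl qp); apply: eq_bigr => i _.
by rewrite TS Lp_pairingC.
Qed.

End PairingPolynomials.

Section SecondDifferences.
Context d (Omega : measurableType d) (R : realType).
Variables (mu : {measure set Omega -> \bar R}) (p q : R) (p1 : 1 <= p) (q1 : 1 <= q).
Hypotheses (pgt1 : 1 < p) (pq : p^-1 + q^-1 = 1).
Local Notation X := (Lp mu p1).
Local Notation Y := (Lp mu q1).
Local Notation D := ('X - 1 : {poly R[i]}).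

(** Both [half] and [uphalf] take each value at most twice; [uphalf] may reach n when n = 1, hence
    the n + 1 terms on the right. *)
Lemma sqn_halves (e : R) (e1 : 1 <= e) (h : nat -> nat) (I : finType) n (z : I -> nat -> Lp mu e1) :
  (h = half \/ h = uphalf) ->
  sqn (fun ik : I * 'I_n => z ik.1 (h ik.2)) <= 2 * sqn (fun ia : I * 'I_n.+1 => z ia.1 ia.2).
Proof.
move=> hh; apply: sqn_le => //; apply: aeW => w.
rewrite -(pair_bigA _ (fun i (k : 'I_n) => normc (Lp_rep (z i (h k)) w) ^+ 2)) /=.
rewrite -(pair_bigA _ (fun i (k : 'I_n.+1) => normc (Lp_rep (z i k) w) ^+ 2)) /=.
rewrite mulr_sumr; apply: ler_sum => i _.
pose f k := normc (Lp_rep (z i k) w) ^+ 2.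
have f0 k : 0 <= f k by exact: sqr_ge0.
apply: (@le_trans _ _ (2 * \sum_(k < n.+1) f k)).
  case: hh => ->; last exact: sum_uphalf.
  apply: (le_trans (sum_half f0 n)); rewrite ler_wpM2l//.
  by rewrite big_ord_recr /= lerDl f0.
rewrite ler_wpM2r ?sumr_ge0// expr2; lra.
Qed.

(** The estimate for one vector is extended to families by [sqn_extension], with a constant that
    depends neither on [T] nor on the family. *)
Lemma sqn_square_function (e : R) (e1 : 1 <= e) : exists2 M : R, 0 < M &
  forall (T : Lp mu e1 -> Lp mu e1) (C : R), linear T -> 0 <= C ->
  (forall N x, sqn (fun k : 'I_N => ((Num.sqrt k.+1%:R)%:C)%C *:
     (iter k.+1 T x - iter k T x)) <= C * rnorm x) ->
  forall h, (h = half \/ h = uphalf) -> forall (I : finType) n (x : I -> Lp mu e1),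
  sqn (fun ik : I * 'I_n => ((Num.sqrt (h ik.2).+1%:R)%:C)%C *:
     pact T ('X^(h ik.2) * D) (x ik.1)) <= M * C * sqn x.
Proof.
have [M M0 H] := sqn_extension mu e1.
exists (2 * M); first by rewrite mulr_gt0.
move=> T C lT C0 SF h hh I n x; rewrite -!mulrA.
pose z i k := ((Num.sqrt k.+1%:R)%:C)%C *: pact T ('X^k * D) (x i).
apply: (le_trans (sqn_halves n z hh)); rewrite ler_wpM2l// mulrA.
apply: (H _ (fun (k : 'I_n.+1) x => ((Num.sqrt k.+1%:R)%:C)%C *: pact T ('X^k * D) x)) => //.
  move=> k a u v; rewrite linear_pact// scalerDr !scalerA; congr (_ *: _ + _).
  by rewrite mulrC.
move=> y; apply: le_trans (SF n.+1 y).
rewrite (_ : (fun _ => _) = (fun k : 'I_n.+1 => ((Num.sqrt k.+1%:R)%:C)%C *: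
     (iter k.+1 T y - iter k T y)))//.
by apply/funext => k; rewrite iter_diff.
Qed.

(* X^k (X - 1)^2 = X^b (X - 1) X^a (X - 1) with a + b = k and
   k + 1 <= 2 sqrt ((a + 1) (b + 1)): one factor is moved to the dual side. *)
Lemma second_differences : exists2 M : R, 0 <= M &
  forall (T : X -> X) (S : Y -> Y) (C C' : R),
  linear T -> linear S ->
  (forall n x y, Lp_pairing (iter n T x) y = Lp_pairing x (iter n S y)) ->
  0 <= C -> 0 <= C' ->
  (forall N x, sqn (fun k : 'I_N => ((Num.sqrt k.+1%:R)%:C)%C *:
     (iter k.+1 T x - iter k T x)) <= C * rnorm x) ->
  (forall N y, sqn (fun k : 'I_N => ((Num.sqrt k.+1%:R)%:C)%C *:
     (iter k.+1 S y - iter k S y)) <= C' * rnorm y) ->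
  forall (I : finType) n (A : I -> nat -> R[i]) (m : R) (x : I -> X), 0 <= m ->
  (forall i k, normc (A i k) <= m * k.+1%:R) ->
  sqn (fun i => \sum_(k < n) A i k *: pact T ('X^k * D * D) (x i)) <= M * C * C' * m * sqn x.
Proof.
have [M1 M10 H1] := sqn_square_function p1.
have [M2 M20 H2] := sqn_square_function q1.
exists (4 * M1 * M2); first by rewrite !mulr_ge0// ltW.
move=> T S C C' lT lS TS C0 C'0 SFT SFS I n A m x m0 Am.
have /(_ _ (or_introl erefl) I n x) {}H1 := H1 T C lT C0 SFT.
have {}H2 y := H2 S C' lS C'0 SFS _ (or_intror erefl) I n y.
pose s k : R := Num.sqrt k.+1%:R.
have s0 k : 0 < s k by rewrite sqrtr_gt0.
pose c i k := A i k / ((s k./2 * s (uphalf k))%:C)%C.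
have ck i k : normc (c i k) <= 2 * m.
  rewrite normcM normcV normc_real ger0_norm ?mulr_ge0 ?sqrtr_ge0//.
  rewrite ler_pdivrMr ?mulr_gt0// (le_trans (Am i k))// [2 * m]mulrC -mulrA ler_wpM2l//.
  rewrite -ler_sqr ?nnegrE ?mulr_ge0 ?(ltW (s0 _))// !exprMn !sqr_sqrtr// -!natrX -!natrM ler_nat.
  rewrite uphalf_half; clear; have := odd_double_half k; case: (odd k) => /= E; nia.
pose u (ik : I * 'I_n) := ((s ik.2./2)%:C)%C *: pact T ('X^(ik.2./2) * D) (x ik.1).
pose v (y : I -> Y) (ik : I * 'I_n) :=
  ((s (uphalf ik.2))%:C)%C *: pact S ('X^(uphalf ik.2) * D) (y ik.1).
apply: (@sqn_le_dual _ _ _ mu p q p1 q1 pgt1 pq).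
  by rewrite !mulr_ge0 ?sqn_ge0 ?(ltW M10) ?(ltW M20).
move=> y.
rewrite (_ : \sum_i _ = \sum_(ik : I * 'I_n) Lp_pairing (c ik.1 ik.2 *: u ik) (v y ik)); last first.
  rewrite -(pair_bigA _ (fun i (k : 'I_n) => Lp_pairing (c i k *: u (i, k)) (v y (i, k)))) /=.
  apply: eq_bigr => i _; rewrite (pairing_lincombl pq); apply: eq_bigr => k _.
  rewrite /u /v /= scalerA pairingZ// -(pairing_pact pq TS) -pactM//.
  have -> : 'X^(uphalf k) * D * ('X^(k./2) * D) = 'X^k * D * D.
    by rewrite mulrACA -exprD mulrA uphalf_half -addnA addnn odd_double_half.
  by rewrite -(mulrA (c i k)) -(rmorphM (real_complex R)) /c divfK// fmorph_eq0 gt_eqF// mulr_gt0.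
apply: (le_trans (sum_pairing_le pq _ _)).
have Hu : sqn (fun ik : I * 'I_n => c ik.1 ik.2 *: u ik) <= 2 * m * (M1 * C * sqn x).
  apply: (le_trans (sqnZ_le (c := 2 * m) _ _ _)); rewrite ?mulr_ge0//.
  by rewrite ler_wpM2l ?mulr_ge0.
apply: (@le_trans _ _ (2 * (2 * m * (M1 * C * sqn x) * (M2 * C' * sqn y)))).
  rewrite ler_wpM2l//; apply: ler_pM; rewrite ?sqn_ge0//; exact: H2.
by rewrite le_eqVlt; apply/orP; left; apply/eqP; ring.
Qed.

End SecondDifferences.

Section RittEstimates.
Context d (Omega : measurableType d) (R : realType).
Variables (mu : {measure set Omega -> \bar R}) (p : R) (p1 : 1 <= p).
Local Notation X := (Lp mu p1).
Local Notation D := ('X - 1 : {poly R[i]}).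
Variables (T : X -> X) (P K : R).
Hypotheses (lT : linear T) (P0 : 0 <= P) (TP : forall n, opnorm_le P (iter n T)).
Hypothesis K0 : 0 <= K.
Hypothesis HK : forall (I : finType) n (A : I -> nat -> R[i]) (m : R) (x : I -> X),
  0 <= m -> (forall i k, normc (A i k) <= m * k.+1%:R) ->
  sqn (fun i => \sum_(k < n) A i k *: pact T ('X^k * D * D) (x i)) <= K * m * sqn x.

Let diff2E n x : pact T ('X^n * D * D) x = pact T ('X^(n.+1) * D) x - pact T ('X^n * D) x.
Proof. by rewrite -pactB//; congr (pact T _ x); rewrite exprS; ring. Qed.

Let rnorm_diff2 n (A : nat -> R[i]) (m : R) x : 0 <= m ->
  (forall k, normc (A k) <= m * k.+1%:R) ->
  rnorm (\sum_(k < n) A k *: pact T ('X^k * D * D) x) <= K * m * rnorm x.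
Proof.
move=> m0 Am; have := HK (I := unit) (A := fun=> A) n (fun=> x) m0 (fun=> Am).
by rewrite !sqn1.
Qed.

(** Solving for the term n T^n D shows that it is bounded, as soon as second differences with
    coefficients k + 1 and the powers of T are. *)
Lemma sum_second_diff n x :
  \sum_(k < n) (k.+1%:R : R[i]) *: pact T ('X^k * D * D) x =
    (n%:R : R[i]) *: pact T ('X^n * D) x - iter n T x + x.
Proof.
elim: n => [|n IH]; first by rewrite big_ord0 scale0r add0r addNr.
have gen (a b v w : X) : a - w + x + (b - (a + v)) = b - (v + w) + x.
  by rewrite !opprD [LHS](AC (3*(1*2)) ((1*5)*4*6*2*3)) /= subrr add0r !addrA.
have E (v : X) : (n.+1%:R : R[i]) *: v = (n%:R : R[i]) *: v + v.
  by rewrite -natr1 scalerDl scale1r.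
by rewrite big_ord_recr /= IH diff2E scalerBr (E (pact T ('X^n * D) x)) gen -(iter_diff _ n)// subrK.
Qed.

Lemma rnorm_power_diff n x :
  n%:R * rnorm (pact T ('X^n * D) x) <= (K + P + 1) * rnorm x.
Proof.
have -> : n%:R * rnorm (pact T ('X^n * D) x) = rnorm ((n%:R : R[i]) *: pact T ('X^n * D) x).
  by rewrite rnormZ -(rmorph_nat (real_complex R)) normc_real ger0_norm.
have := sum_second_diff n x.
move/(congr1 (fun z => z - x + iter n T x)); rewrite addrK subrK => <-.
apply: (le_trans (rnormD _ _)); rewrite mulrDl mulrDl mul1r addrAC; apply: lerD; last exact: TP.
apply: (le_trans (rnormB _ _)); rewrite lerD2r.
have := @rnorm_diff2 n (fun k => k.+1%:R) 1 x ler01; rewrite mulr1; apply=> k.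
by rewrite mul1r -(rmorph_nat (real_complex R)) normc_real ger0_norm.
Qed.

(** Partial sums of bounded coefficients grow at most linearly, which is exactly the growth that
    [HK] permits. *)
Lemma abel_summation (b : nat -> R[i]) n x :
  \sum_(k < n) b k *: pact T ('X^k * D) x =
    (\sum_(k < n) b k) *: pact T ('X^n * D) x -
    \sum_(k < n) (\sum_(i < k.+1) b i) *: pact T ('X^k * D * D) x.
Proof.
elim: n => [|n IH]; first by rewrite !big_ord0 scale0r subr0.
rewrite [LHS]big_ord_recr /= {}IH [\sum_(k < n.+1) _ *: _]big_ord_recr /= diff2E.
have gen (u v s z : X) : (u - s) + v = z - (s + (z - (u + v))).
  by rewrite !opprD !opprK [RHS](AC (1*(1*(1*2))) ((1*3)*4*2*5)) /= subrr add0r.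
have E : (\sum_(k < n.+1) b k) *: pact T ('X^n * D) x =
    (\sum_(k < n) b k) *: pact T ('X^n * D) x + b n *: pact T ('X^n * D) x.
  by rewrite big_ord_recr scalerDl.
by rewrite scalerBr E -gen.
Qed.

Let normc_sum_le (b : nat -> R[i]) (m : R) n : (forall k, normc (b k) <= m) ->
  normc (\sum_(k < n) b k) <= m * n%:R.
Proof.
move=> bm; elim: n => [|n IH]; first by rewrite big_ord0 normc0 mulr0.
rewrite big_ord_recr /= -natr1 mulrDr mulr1.
by apply: (le_trans (le_normcD _ _)); exact: lerD.
Qed.

Lemma unconditional_Ritt_of_second_diff : unconditional_Ritt T.
Proof.
exists (2 * K + P + 1); first by rewrite !addr_ge0// mulr_ge0.
move=> n a x; set m := \big[Num.max/0]_(1 <= k < n.+1) normc (a k).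
have m0 : 0 <= m.
  by rewrite /m; elim/big_ind: _ => // [u v u0 v0|k _]; rewrite ?le_max ?u0 ?normc_ge0.
(* Shifted to start at 0 and extended by 0, so that the bound [m] holds at every index. *)
pose b k := if (k < n)%N then a k.+1 else 0.
have bm k : normc (b k) <= m.
  rewrite /b; case: ifP => kn; last by rewrite normc0.
  by rewrite /m big_add1 big_mkord (le_bigmax _ (fun k : 'I_n => normc (a k.+1)) (Ordinal kn)).
rewrite big_add1 big_mkord /=.
rewrite (eq_bigr (fun k : 'I_n => b k *: pact T ('X^k * D) x)); last first.
  by move=> k _; rewrite /b ltn_ord -iter_diff.
rewrite abel_summation; apply: (le_trans (rnormB _ _)).
(* K + P + 1 pays for the boundary term of Abel summation, the second K for the second
   differences. *)
have -> : (2 * K + P + 1) * m * rnorm x = m * ((K + P + 1) * rnorm x) + K * m * rnorm x by ring.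
apply: lerD.
  rewrite rnormZ; apply: (@le_trans _ _ (m * n%:R * rnorm (pact T ('X^n * D) x))).
    by rewrite ler_wpM2r ?rnorm_ge0//; exact: normc_sum_le.
  by rewrite -mulrA ler_wpM2l//; exact: rnorm_power_diff.
by apply: (@rnorm_diff2 n (fun k => \sum_(i < k.+1) b i)) => // k; exact: normc_sum_le.
Qed.

(** Identities for the sum of the Neumann series are proved by showing that the error is O(r^n),
    computed on partial sums. *)
Lemma rnorm_geometric_eq0 (z : X) (c r : R) : 0 <= r < 1 ->
  (forall n, rnorm z <= c * r ^+ n) -> z = 0.
Proof.
move=> /andP[r0 r1] H; apply: rnorm0_eq0; apply/eqP; rewrite eq_le rnorm_ge0 andbT.
have cv : (fun n => c * r ^+ n) @ \oo --> (c * 0 : R).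
  by apply: cvgMr; apply: cvg_expr; rewrite ger0_norm.
rewrite mulr0 in cv; rewrite -(cvg_lim _ cv)//.
apply: limr_ge; first by apply/cvg_ex; exists 0.
by apply: nearW => n; exact: H.
Qed.

Section Neumann.
Variables (l : R[i]) (l1 : 1 < normc l).

Let lN0 : l != 0.
Proof. by apply: contraTneq l1 => ->; rewrite normc0 ltr10. Qed.

Let r := (normc l)^-1.

Let r01 : 0 <= r < 1.
Proof. by rewrite invr_ge0 normc_ge0 invf_lt1// (lt_trans ltr01). Qed.

Let partial n x := \sum_(0 <= k < n) l ^- k.+1 *: iter k T x.

Let lin_partial n : linear (partial n).
Proof.
move=> a u v; rewrite /partial scaler_sumr -big_split; apply: eq_bigr => k _ /=.
by rewrite linear_iter// scalerDr !scalerA [a * _]mulrC.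
Qed.

Let TB u v : T (u - v) = T u - T v.
Proof. by rewrite addrC -scaleN1r lT scaleN1r addrC. Qed.

Let partialS n x : l *: partial n x - T (partial n x) = x - l ^- n *: iter n T x.
Proof.
have TE : T (partial n x) = \sum_(0 <= k < n) l ^- k.+1 *: iter k.+1 T x.
  by rewrite /partial (linear_lincomb lT).
rewrite TE /partial; elim: n {TE} => [|n IH].
  by rewrite !big_geq// scaler0 expr0 invr1 scale1r !subrr.
rewrite !big_nat_recr //= scalerDr opprD addrACA IH scalerA.
have -> : l * l ^- n.+1 = l ^- n by rewrite exprS invfM mulrA divff// mul1r.
by rewrite addrA subrK.
Qed.

Let S_ex : exists S : X -> X, forall x n,
  rnorm (S x - partial n x) <= 2 * (P * rnorm x * r) / (1 - r) * r ^+ n.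
Proof.
suff H x : exists s, forall n,
    rnorm (s - partial n x) <= 2 * (P * rnorm x * r) / (1 - r) * r ^+ n.
  by have [S HS] := choice H; exists S.
apply: Lp_series_cvg => //; first by rewrite !mulr_ge0 ?rnorm_ge0//; case/andP: r01.
move=> n; rewrite rnormZ normcV normcX -exprVn -/r exprS -(mulrA _ r) [leRHS]mulrC ler_wpM2l//.
  by rewrite mulr_ge0 ?exprn_ge0//; case/andP: r01.
exact: TP.
Qed.

(** [S] is chosen separately at each vector; linearity, commutation with [T] and the resolvent
    identities are then forced by the geometric approximation. *)
Lemma neumann_series : exists2 S : X -> X, is_resolvent T l S &
  forall x, exists c, forall n, rnorm (S x - \sum_(0 <= k < n) l ^- k.+1 *: iter k T x) <= c * r ^+ n.
Proof.
have [S HS] := S_ex.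
pose c (x : X) := 2 * (P * rnorm x * r) / (1 - r).
exists S; last by move=> x; exists (c x); exact: HS.
have [r0 r1] : 0 <= r /\ r < 1 by apply/andP.
have lS : linear S.
  move=> a u v; apply/eqP; rewrite -subr_eq0; apply/eqP.
  apply: (@rnorm_geometric_eq0 _ (c (a *: u + v) + (normc a * c u + c v)) r) => // n.
  have -> : S (a *: u + v) - (a *: S u + S v) = (S (a *: u + v) - partial n (a *: u + v)) -
      (a *: (S u - partial n u) + (S v - partial n v)).
    rewrite lin_partial scalerBr.
    move: (S _) (_ *: S u) (S v) (_ *: partial n u) (partial n v) => s a' v' b' w'.
    by rewrite !opprD !opprK [RHS](AC ((1*2)*(2*2)) (1*4*6*(5*2)*(7*3))) /= !subrr !addr0 addrA.
  apply: (le_trans (rnormB _ _)); rewrite mulrDl; apply: lerD; first exact: HS.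
  apply: (le_trans (rnormD _ _)); rewrite mulrDl; apply: lerD; last exact: HS.
  by rewrite rnormZ -mulrA ler_wpM2l ?normc_ge0//; exact: HS.
have T1 z : rnorm (T z) <= P * rnorm z by exact: (TP 1).
have Pl n x : rnorm (l ^- n *: iter n T x) <= P * rnorm x * r ^+ n.
  rewrite rnormZ normcV normcX -exprVn -/r mulrC ler_wpM2r ?exprn_ge0//; exact: TP.
have STC x : S (T x) = T (S x).
  apply/eqP; rewrite -subr_eq0; apply/eqP.
  apply: (@rnorm_geometric_eq0 _ (c (T x) + P * c x) r) => // n.
  have pT : partial n (T x) = T (partial n x).
    rewrite /partial (linear_lincomb lT); apply: eq_bigr => k _.
    by rewrite -iterSr.
  have -> : S (T x) - T (S x) = (S (T x) - partial n (T x)) - T (S x - partial n x).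
    by rewrite TB pT opprB addrA subrK.
  apply: (le_trans (rnormB _ _)); rewrite mulrDl; apply: lerD; first exact: HS.
  by apply: (le_trans (T1 _)); rewrite -mulrA ler_wpM2l//; exact: HS.
have SR x : l *: S x - T (S x) = x.
  apply/eqP; rewrite -subr_eq0; apply/eqP.
  apply: (@rnorm_geometric_eq0 _ (normc l * c x + P * c x + P * rnorm x) r) => // n.
  have -> : l *: S x - T (S x) - x = l *: (S x - partial n x) - T (S x - partial n x) -
      l ^- n *: iter n T x.
    have -> : l ^- n *: iter n T x = x - (l *: partial n x - T (partial n x)).
      by rewrite partialS opprB addrCA subrr addr0.
    rewrite TB scalerBr !opprB [RHS](AC (2*2*(2*1)) (1*4*7*(5*2)*(3*6))) /=.
    by rewrite !subrr !addr0.
  apply: (le_trans (rnormB _ _)); rewrite mulrDl; apply: lerD; last exact: Pl.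
  apply: (le_trans (rnormB _ _)); rewrite mulrDl; apply: lerD.
    by rewrite rnormZ -mulrA ler_wpM2l ?normc_ge0//; exact: HS.
  by apply: (le_trans (T1 _)); rewrite -mulrA ler_wpM2l//; exact: HS.
split => //.
- split => //; exists (2 * (P * r) / (1 - r)) => x.
  have := HS x 0%N; rewrite /partial big_geq// subr0 expr0 mulr1.
  by move=> H; apply: (le_trans H); rewrite le_eqVlt; apply/orP; left; apply/eqP; ring.
- move=> x; rewrite -[RHS]SR -STC addrC -scaleN1r lS scaleN1r addrC; congr (_ - _).
  by have := linear_lincomb lS [:: tt] (fun=> l) (fun=> x); rewrite !big_seq1.
Qed.

Lemma resolventP : is_resolvent T l (resolvent T l).
Proof.
have [S HS _] := neumann_series.
have := xgetPex (fun=> 0) (ex_intro (fun S => is_resolvent T l S) S HS).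
by [].
Qed.

Let resolvent_partial x : exists c, forall n,
  rnorm (resolvent T l x - partial n x) <= c * r ^+ n.
Proof.
have [S [_ _ HS] HSr] := neumann_series.
have [_ HR _] := resolventP.
have [c Hc] := HSr x; exists c => n.
have -> : resolvent T l x = S x by rewrite -[x in LHS]HS HR.
exact: Hc.
Qed.

Let l1N0 : 0 < normc (l - 1).
Proof.
rewrite lt_neqAle normc_ge0 andbT eq_sym; apply/eqP => /eq0_normc /eqP.
by rewrite subr_eq0 => /eqP l1E; move: l1; rewrite l1E normc1 ltxx.
Qed.

Let geometric_le n : normc (\sum_(i < n) l ^- i.+1) <= 2 / normc (l - 1).
Proof.
rewrite ler_pdivlMr// mulrC -normcM.
have -> : (l - 1) * \sum_(i < n) l ^- i.+1 = 1 - l ^- n.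
  elim: n => [|n IH]; first by rewrite big_ord0 mulr0 expr0 invr1 subrr.
  rewrite big_ord_recr /= mulrDr IH mulrBl mul1r.
  have -> : l * l ^- n.+1 = l ^- n by rewrite exprS invfM mulrA divff// mul1r.
  by rewrite addrA subrK.
apply: (le_trans (le_normcD _ _)); rewrite normcN normc1 normcV normcX.
have -> : (2 : R) = 1 + 1 by ring.
by rewrite lerD2l invf_le1 ?exprn_gt0 ?(lt_trans ltr01)// exprn_ege1// ltW.
Qed.

(** Since (l - 1) R(l, T) = 1 + D R(l, T), apply Abel summation to the Neumann series of D R(l, T).
    The boundary term tends to 0 like 1/n, with a constant depending on [l] and [x]. *)
Lemma resolvent_second_diff x e : 0 < e -> exists n,
  rnorm ((l - 1) *: resolvent T l x -
    (x - \sum_(k < n) (\sum_(i < k.+1) l ^- i.+1) *: pact T ('X^k * D * D) x)) <= e.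
Proof.
move=> e0; have [c Hc] := resolvent_partial x.
have [_ _ HR] := resolventP.
have T1 z : rnorm (T z) <= P * rnorm z by exact: (TP 1).
pose c2 := 2 / normc (l - 1) * ((K + P + 1) * rnorm x).
have err n : rnorm ((l - 1) *: resolvent T l x - (x - \sum_(k < n.+1)
    (\sum_(i < k.+1) l ^- i.+1) *: pact T ('X^k * D * D) x)) <=
    ((P + 1) * c * r) * r ^+ n + c2 / n.+1%:R.
  set s := resolvent T l x; set z := \sum_(k < _) _.
  have -> : (l - 1) *: s - (x - z) =
      (T (s - partial n.+1 x) - (s - partial n.+1 x)) +
      (\sum_(i < n.+1) l ^- i.+1) *: pact T ('X^(n.+1) * D) x.
    have -> : (\sum_(i < n.+1) l ^- i.+1) *: pact T ('X^(n.+1) * D) x =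
        T (partial n.+1 x) - partial n.+1 x + z.
      apply/eqP; rewrite -subr_eq -(abel_summation (fun i => l ^- i.+1)); apply/eqP.
      rewrite /partial big_mkord (linear_lincomb lT) -sumrB; apply: eq_bigr => k _.
      by rewrite -scalerBr -iter_diff.
    have gen (ls v ts tp pn y t : X) : ls - ts = y ->
        ls - v - (y - t) = ts - tp - (v - pn) + (tp - pn + t).
      move=> <-; rewrite !opprB [LHS](AC (2*(1*2)) ((1*5)*4*2*3)) /= subrr add0r.
      by rewrite [RHS](AC (2*2*(2*1)) ((5*2)*(3*6)*1*4*7)) /= !subrr !add0r.
    by rewrite scalerBl scale1r TB; exact: gen (HR x).
  apply: (le_trans (rnormD _ _)); apply: lerD.
    apply: (@le_trans _ _ ((P + 1) * rnorm (s - partial n.+1 x))).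
      by rewrite mulrDl mul1r; apply: (le_trans (rnormB _ _)); rewrite lerD2r.
    by rewrite -!mulrA ler_wpM2l ?addr_ge0// -exprS.
  rewrite rnormZ /c2 -!mulrA mulrA; apply: ler_pM; rewrite ?normc_ge0 ?rnorm_ge0//.
  by rewrite mulrA ler_pdivlMr ?ltr0n// mulrC; exact: rnorm_power_diff.
have cv : (fun n => ((P + 1) * c * r) * r ^+ n + c2 / n.+1%:R) @ \oo --> ((P + 1) * c * r * 0 + c2 * 0).
  apply: cvgD; apply: cvgMr; last exact: cvg_harmonic.
  by apply: cvg_expr; case/andP: r01 => r0 ?; rewrite ger0_norm.
rewrite !mulr0 addr0 in cv.
have /cvgrPdist_le /(_ e e0) [N _ HN] := cv.
exists N.+1; apply: (le_trans (err N)).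
have := HN N (leqnn N); rewrite /= sub0r normrN; exact: le_trans (ler_norm _).
Qed.

End Neumann.

(** The coefficient bound k + 1 does not mention [l]: the partial sums of l^-(i+1) satisfy it for
    every |l| > 1. One [l2_bounded] constant thus covers the whole Ritt set. *)
Let F : set (X -> X) := [set V | exists n (A : nat -> R[i]),
  (forall k, normc (A k) <= k.+1%:R) /\
  forall x, V x = x - \sum_(k < n) A k *: pact T ('X^k * D * D) x].

Let l2F : l2_bounded (1 + K) F.
Proof.
move=> I V x HV; have [n Hn] := choice HV; have [A HA] := choice Hn.
(* [HK] asks for a common length, so the coefficients are padded with zeros. *)
pose m := (\max_i n i)%N.
pose B i k : R[i] := if (k < n i)%N then A i k else 0.
have E i : V i (x i) = x i - \sum_(k < m) B i k *: pact T ('X^k * D * D) (x i).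
  have [_ ->] := HA i; congr (_ - _).
  rewrite (big_ord_widen m (fun k => A i k *: pact T ('X^k * D * D) (x i)) (leq_bigmax i)).
  rewrite big_mkcond; apply: eq_bigr => k _; rewrite /B; case: ifP => // _.
  by rewrite scale0r.
rewrite (_ : (fun i => _) = (fun i => x i - \sum_(k < m) B i k *: pact T ('X^k * D * D) (x i))); last first.
  by apply/funext => i; exact: E.
apply: (le_trans (sqnB _ _)); rewrite mulrDl mul1r lerD2l.
have := HK m x (A := B) ler01; rewrite mulr1; apply => i k.
rewrite mul1r /B; case: ifP => _; last by rewrite normc0.
by have [] := HA i.
Qed.

Lemma Ritt_set_closure : Ritt_set T `<=` ptclosure F.
Proof.
move=> V [l l1 ->] x e e0; have [n Hn] := resolvent_second_diff l1 x e0.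
exists (fun x => x - \sum_(k < n) (\sum_(i < k.+1) l ^- i.+1) *: pact T ('X^k * D * D) x) => //.
exists n, (fun k => \sum_(i < k.+1) l ^- i.+1); split => // k.
rewrite -[leRHS]mul1r; apply: (normc_sum_le (b := fun i => l ^- i.+1)) => i.
by rewrite normcV normcX invf_le1 ?exprn_gt0 ?(lt_trans ltr01)// exprn_ege1// ltW.
Qed.

Lemma R_Ritt_of_second_diff : R_Ritt T.
Proof.
have l2R : l2_bounded (1 + K) (Ritt_set T).
  exact: l2_bounded_sub Ritt_set_closure (l2_bounded_ptclosure l2F).
split; last by apply: l2_R_bounded l2R; rewrite addr_ge0.
split; last by exists (1 + K) => V /(l2_bounded_opnorm l2R).
move=> l /=; apply: contra_notT; rewrite -ltNge => l1.
by exists (resolvent T l); exact: resolventP.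
Qed.

End RittEstimates.

(** * Duality and the equivalence *)

Section LnormSeries.
Context d (Omega : measurableType d) (R : realType).
Variables (mu : {measure set Omega -> \bar R}) (p : R) (p1 : 1 <= p).
Variables (a : nat -> Omega -> R).
Hypotheses (a0 : forall k w, 0 <= a k w) (ma : forall k, measurable_fun setT (a k)).

Let p0 : 0 < p. Proof. exact: lt_le_trans p1. Qed.

Let r : R := 2^-1 * p.
Let r0 : 0 < r. Proof. by rewrite mulr_gt0// invr_gt0. Qed.

Let S N w : \bar R := (\sum_(0 <= k < N) (a k w)%:E)%E.
Let S0 N w : (0 <= S N w)%E.
Proof. by apply: sume_ge0 => k _; rewrite lee_fin. Qed.

Let Soo w : \bar R := (\sum_(0 <= k <oo) (a k w)%:E)%E.
Let Soo0 w : (0 <= Soo w)%E.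
Proof. by apply: nneseries_ge0 => k _ _; rewrite lee_fin. Qed.

Let le_powe (s : R) (x y : \bar R) : (0 <= s)%R -> (0 <= x)%E -> (x <= y)%E ->
  (x `^ s <= y `^ s)%E.
Proof.
move=> s0 x0 xy; apply: gt0_ler_poweR => //; rewrite in_itv /= leey andbT//.
exact: le_trans xy.
Qed.

Let mS N : measurable_fun setT (S N).
Proof. by apply: emeasurable_sum => k; exact/measurable_EFinP. Qed.

Let mSr N : measurable_fun setT (fun w => (S N w `^ r)%E).
Proof. exact: (measurableT_comp (measurable_poweR r)). Qed.

Let mSoo : measurable_fun setT Soo.
Proof.
apply: (@ge0_emeasurable_sum _ _ _ setT (fun k w => (a k w)%:E) xpredT) => //.
  by move=> k w _ _; rewrite lee_fin.
by move=> k _; exact/measurable_EFinP.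
Qed.

Let mSoor : measurable_fun setT (fun w => (Soo w `^ r)%E).
Proof. exact: (measurableT_comp (measurable_poweR r)). Qed.

Let ndS w : {homo (fun N => (S N w `^ r)%E) : n m / (n <= m)%N >-> (n <= m)%E}.
Proof.
move=> n m nm; apply: le_powe => //; first exact: ltW.
by apply: lee_sum_nneg_natr => // k _ _; rewrite lee_fin.
Qed.

(** Monotonicity of the powers r and 1/r moves the supremum through the power, infinite values
    included. *)
Let Soo_le w : (Soo w `^ r <= limn (fun N => S N w `^ r))%E.
Proof.
set L := limn _.
have L1 N : (S N w `^ r <= L)%E.
  apply: lime_ge; first exact: ereal_nondecreasing_is_cvgn (@ndS w).
  by exists N => // m /= Nm; exact: ndS.
have L0 : (0 <= L)%E by apply: le_trans (L1 0%N); exact: poweR_ge0.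
have rr (x : \bar R) : (0 <= x)%E -> ((x `^ r) `^ r^-1 = x)%E.
  by move=> x0; rewrite -poweRrM mulfV ?gt_eqF// poweRe1.
have rr' (x : \bar R) : (0 <= x)%E -> ((x `^ r^-1) `^ r = x)%E.
  by move=> x0; rewrite -poweRrM mulVf ?gt_eqF// poweRe1.
rewrite -[leRHS]rr'//; apply: le_powe => //; first exact: ltW.
apply: lime_le; first by apply: is_cvg_nneseries => k _ _; rewrite lee_fin.
apply: nearW => N; rewrite -[leLHS]rr ?S0//.
apply: le_powe (L1 N); [by rewrite invr_ge0 ltW|exact: poweR_ge0].
Qed.

Let LnormE (f : Omega -> \bar R) : (forall w, 0 <= f w)%E ->
  ('N[mu]_p%:E[(fun w => (f w `^ 2^-1)%E)] = (\int[mu]_w (f w `^ r)) `^ p^-1)%E.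
Proof.
move=> f0; rewrite unlock; congr (_ `^ _)%E; apply: eq_integral => w _ /=.
by rewrite gee0_abs ?poweR_ge0// -poweRrM.
Qed.

(** The Lp norm of a square root is the integral of the power p/2, raised to 1/p; monotone
    convergence passes from partial sums to the series with the same constant. *)
Lemma Lnorm_sqrt_series (B : R) :
  ('N[mu]_p%:E[(fun w => ((\sum_(0 <= k <oo) (a k w)%:E) `^ 2^-1)%E)] <= B%:E)%E <->
  forall N, ('N[mu]_p%:E[(fun w => (Num.sqrt (\sum_(k < N) a k w))%:E)] <= B%:E)%E.
Proof.
have SE N : ('N[mu]_p%:E[(fun w => (Num.sqrt (\sum_(k < N) a k w))%:E)] =
    (\int[mu]_w (S N w `^ r)) `^ p^-1)%E.
  rewrite -LnormE//; apply: eq_Lnorm => w.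
  rewrite -powR12_sqrt ?sumr_ge0// -poweR_EFin; congr (_ `^ _)%E.
  by rewrite /S sumEFin big_mkord.
have I0 N : (0 <= \int[mu]_w (S N w `^ r))%E.
  by apply: integral_ge0 => w _; exact: poweR_ge0.
have pp : (0 <= p^-1)%R by rewrite invr_ge0 ltW.
rewrite (LnormE Soo0); split.
  move=> H N; rewrite SE; apply: le_trans H; apply: le_powe => //.
  apply: ge0_le_integral => //.
    by move=> w _; exact: poweR_ge0.
  move=> w _; apply: le_powe => //; first exact: ltW.
  by apply: nneseries_lim_ge => k _ _; rewrite lee_fin.
move=> H; have B0 : (0 <= B%:E)%E by apply: le_trans (H 0%N); rewrite SE poweR_ge0.
have IB N : (\int[mu]_w (S N w `^ r) <= (B `^ p)%:E)%E.
  have := H N; rewrite SE => /(le_powe (ltW p0) (poweR_ge0 _ _)).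
  by rewrite -poweRrM mulVf ?gt_eqF// poweRe1// poweR_EFin.
have -> : B%:E = ((B `^ p)%:E `^ p^-1)%E.
  by rewrite poweR_EFin -powRrM mulfV ?gt_eqF// powRr1.
apply: le_powe => //; first by apply: integral_ge0 => w _; exact: poweR_ge0.
apply: (@le_trans _ _ (\int[mu]_w limn (fun N => S N w `^ r))%E).
  apply: ge0_le_integral => //.
  - by move=> w _; exact: poweR_ge0.
  - apply: (@emeasurable_fun_cvg _ _ _ _ (fun N w => (S N w `^ r)%E)) => // w _.
    exact: ereal_nondecreasing_is_cvgn (@ndS w).
rewrite monotone_convergence//; last by move=> N w _; exact: poweR_ge0.
apply: lime_le; last by apply: nearW.
apply: ereal_nondecreasing_is_cvgn => n m nm.
apply: ge0_le_integral => //; try by move=> w _; exact: poweR_ge0.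
by move=> w _; exact: ndS.
Qed.

End LnormSeries.

Section SquareFunctionEstimate.
Context d (Omega : measurableType d) (R : realType).
Variables (mu : {measure set Omega -> \bar R}) (p : R) (p1 : 1 <= p).
Local Notation X := (Lp mu p1).

Lemma square_function_estimateP (C : R) (T : X -> X) :
  square_function_estimate C T <->
  forall N x, sqn (fun k : 'I_N => ((Num.sqrt k.+1%:R)%:C)%C *:
    (iter k.+1 T x - iter k T x)) <= C * rnorm x.
Proof.
pose a x k w := k.+1%:R * normc (Lp_rep (iter k.+1 T x - iter k T x) w) ^+ 2 : R.
have a0 x k w : 0 <= a x k w by rewrite mulr_ge0// sqr_ge0.
have ma x k : measurable_fun setT (a x k).
  apply: measurable_funM => //; apply: measurable_funX; exact: measurable_normc_rep.
have SFE x : ('N[mu]_p%:E[square_function T x] =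
    'N[mu]_p%:E[(fun w => ((\sum_(0 <= k <oo) (a x k w)%:E) `^ 2^-1)%E)])%E.
  apply: eq_Lnorm => w; rewrite /square_function; congr (_ `^ _)%E.
  (* The series starts at k = 1 while the finite families start at 0, whence the weights k + 1. *)
  rewrite -(nneseries_addn 1) => [|k]; last by rewrite lee_fin mulr_ge0// sqr_ge0.
  by apply: eq_eseriesr => k _; rewrite addn1.
have sqnE' x N : ((sqn (fun k : 'I_N => ((Num.sqrt k.+1%:R)%:C)%C *:
    (iter k.+1 T x - iter k T x)))%:E =
    'N[mu]_p%:E[(fun w => (Num.sqrt (\sum_(k < N) a x k w))%:E)])%E.
  rewrite sqnE; set y := (fun k : 'I_N => _).
  have ms : measurable_fun setT (fun w => Num.sqrt (\sum_(k < N) a x k w)).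
    apply: (measurableT_comp (f := @Num.sqrt R)).
      by apply: continuous_measurable_fun; exact: sqrt_continuous.
    by apply: measurable_sum => k.
  have E : \forall w \ae mu, sqf y w = Num.sqrt (\sum_(k < N) a x k w).
    have : \forall w \ae mu, forall k : 'I_N, Lp_rep (y k) w =
        ((Num.sqrt k.+1%:R)%:C)%C * Lp_rep (iter k.+1 T x - iter k T x) w.
      by apply: filter_forall => k; exact: Lp_repZ_ae.
    apply: filterS => w Hw; congr Num.sqrt; apply: eq_bigr => k _.
    by rewrite Hw normcM exprMn normc_sqrt.
  apply/eqP; rewrite eq_le; apply/andP; split; apply: le_ae_Lnorm => //;
    try exact: measurable_sqf; try (by move=> w; exact: sqrtr_ge0);
    by apply: filterS E => w ->.
split=> H.
  move=> N x; rewrite -lee_fin sqnE'.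
  have := H x; rewrite SFE => /(Lnorm_sqrt_series mu p1 (a0 x) (ma x)); exact.
move=> x; rewrite SFE; apply/(Lnorm_sqrt_series mu p1 (a0 x) (ma x)) => N.
by rewrite -sqnE' lee_fin.
Qed.

End SquareFunctionEstimate.

Section Duality.
Context d (Omega : measurableType d) (R : realType).
Variables (mu : {measure set Omega -> \bar R}) (p q : R) (p1 : 1 <= p) (q1 : 1 <= q).
Hypotheses (pgt1 : 1 < p) (qgt1 : 1 < q) (pq : p^-1 + q^-1 = 1).
Local Notation X := (Lp mu p1).
Local Notation Y := (Lp mu q1).
Let qp : q^-1 + p^-1 = 1. Proof. by rewrite addrC. Qed.

(** Norms are computed by duality and each operator is moved to the other side; the factor 2 is that
    of the pairing. *)
Lemma l2_bounded_dual (C : R) (F : set (X -> X)) (G : set (Y -> Y)) : 0 <= C ->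
  (forall B, G B -> exists2 A, F A & forall x y, Lp_pairing (A x) y = Lp_pairing x (B y)) ->
  l2_bounded C F -> l2_bounded (2 * C) G.
Proof.
move=> C0 GF HF I B y GB.
have H i : exists A, F A /\ forall x y, Lp_pairing (A x) y = Lp_pairing x (B i y).
  by have [A ? ?] := GF _ (GB i); exists A.
have [A HA] := choice H.
apply: (@sqn_le_dual _ _ _ mu q p q1 p1 qgt1 qp); first by rewrite !mulr_ge0 ?sqn_ge0.
move=> x; rewrite (eq_bigr (fun i => Lp_pairing (A i (x i)) (y i))); last first.
  by move=> i _; rewrite (proj2 (HA i)) Lp_pairingC.
apply: (le_trans (sum_pairing_le pq _ _)).
have HA' : sqn (fun i => A i (x i)) <= C * sqn x by apply: (HF _ A) => i; case: (HA i).
have -> : 2 * C * sqn y * sqn x = 2 * ((C * sqn x) * sqn y) by ring.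
by rewrite ler_wpM2l// ler_wpM2r ?sqn_ge0.
Qed.

Variables (T : X -> X) (S : Y -> Y).
Hypotheses (lT : linear T).
Hypothesis TS : forall x y, Lp_pairing (T x) y = Lp_pairing x (S y).

Lemma dual_iter n x y : Lp_pairing (iter n T x) y = Lp_pairing x (iter n S y).
Proof. by elim: n y => // n IH y; rewrite iterS TS IH iterSr. Qed.

(** [S] is known only through its pairing with [X], and this pairing separates the points of [Y]. *)
Lemma dual_linear : linear S.
Proof.
move=> a u v; apply/eqP; rewrite -subr_eq0; apply/eqP.
apply: (pairing_eq0 (q1 := p1) qgt1 qp) => x.
have addP (f g : Y) b (z : X) : Lp_pairing (f + b *: g) z = Lp_pairing f z + b * Lp_pairing g z.
  have := pairing_lincombl qp (fun i : bool => if i then 1 else b)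
    (fun i : bool => if i then f else g) z.
  by rewrite !big_bool /= scale1r mul1r.
have E z : Lp_pairing (S z) x = Lp_pairing z (T x).
  by rewrite Lp_pairingC -TS Lp_pairingC.
rewrite -scaleN1r addP E -(addrC v) addP -(addrC (S v)) addP !E.
by ring.
Qed.

Lemma dual_opnorm (C : R) (f : {poly R[i]}) : 0 <= C ->
  opnorm_le C (pact T f) -> opnorm_le (2 * C) (pact S f).
Proof.
move=> C0 Hf y; rewrite -sqn1.
apply: (@sqn_le_dual _ _ _ mu q p q1 p1 qgt1 qp); first by rewrite !mulr_ge0 ?rnorm_ge0.
move=> x; rewrite !(big_pred1 tt)// Lp_pairingC -(pairing_pact pq dual_iter).
apply: (le_trans (pairing_le pq _ _)).
have E : sqn x = rnorm (x tt) by rewrite -sqn1; congr sqn; apply/funext; case.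
have -> : 2 * C * rnorm y * sqn x = 2 * ((C * rnorm (x tt)) * rnorm y) by rewrite E; ring.
by rewrite ler_wpM2l// ler_wpM2r ?rnorm_ge0.
Qed.

Lemma dual_powers (C : R) : 0 <= C -> l2_bounded C (powers T) ->
  l2_bounded (2 * C) (powers S).
Proof.
move=> C0; apply: l2_bounded_dual => // B [n ->].
by exists (iter n T); [exists n|move=> x y; exact: dual_iter].
Qed.

Lemma dual_power_diffs (C : R) : 0 <= C -> l2_bounded C (power_diffs T) ->
  l2_bounded (2 * C) (power_diffs S).
Proof.
move=> C0; apply: l2_bounded_dual => // B [n ->].
exists (fun x => ((n.+1%:R)%:C)%C *: iter n T (T x - x)); first by exists n.
move=> x y; rewrite -!pact_diff//; last exact: dual_linear.
by rewrite -!pactZ (pairing_pact pq dual_iter).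
Qed.

Let lincombE (U : lmodType R[i]) (V : U -> U) n (a : nat -> R[i]) x :
  \sum_(1 <= k < n.+1) a k *: (iter k V x - iter k.-1 V x) =
  pact V (\sum_(1 <= k < n.+1) a k *: ('X^k - 'X^(k.-1))) x.
Proof.
by rewrite pact_sum; apply: eq_bigr => k _; rewrite pactZ pactB !pactXn.
Qed.

Lemma dual_unconditional : unconditional_Ritt T -> unconditional_Ritt S.
Proof.
case=> K K0 HK; exists (2 * K); first exact: mulr_ge0.
move=> n a x; rewrite lincombE -(mulrA 2 K); apply: dual_opnorm.
  rewrite mulr_ge0//; elim/big_ind: _ => // [u v u0 v0|k _].
    by rewrite le_max u0.
  exact: normc_ge0.
by move=> z; rewrite -lincombE; exact: HK.
Qed.

End Duality.

Section RittToSquareFunctions.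
Context d (Omega : measurableType d) (R : realType).
Variables (mu : {measure set Omega -> \bar R}) (p : R) (p1 : 1 <= p).
Local Notation X := (Lp mu p1).
Variables (T : X -> X).
Hypotheses (lT : linear T).

Lemma R_Ritt_l2_bounded (P : R) : 0 <= P -> (forall n, opnorm_le P (iter n T)) ->
  R_Ritt T -> exists C1 C2, [/\ 0 <= C1, 0 <= C2, l2_bounded C1 (powers T) &
    l2_bounded C2 (power_diffs T)].
Proof.
move=> P0 TP [[sT _] /R_bounded_l2[C C0 l2F]].
(* The spectral inclusion guarantees that [resolvent] is a true inverse off the closed disc, not its
   default value. *)
have RsP l : 1 < normc l -> is_resolvent T l (resolvent T l).
  move=> l1; apply: xgetPex; apply: contrapT => nex.
  by have /= := sT l nex; rewrite leNgt l1.
have RsC l : 1 < normc l -> opnorm_le C (fun x => (l - 1) *: resolvent T l x).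
  by move=> l1; apply: (l2_bounded_opnorm l2F); exists l.
have lF : linset (Ritt_set T).
  move=> A [l l1 ->] a u v; have [[lR _] _ _] := RsP _ l1.
  by rewrite lR scalerDr !scalerA mulrC.
have e3 : 0 <= 3 * expR (3 : R) by rewrite mulr_ge0// expR_ge0.
pose Fm := [set S | exists2 A, Ritt_set T A & forall x : X, S x = A x - x].
have lFm : linset Fm.
  move=> S [A FA SE] a u v; rewrite !SE (lF _ FA) scalerBr.
  by rewrite opprD addrACA.
have C10 : 0 <= C + 1 by rewrite addr_ge0.
exists (3 * expR 3 * (C * (C * C))), (3 * expR 3 * (C * (C * (C + 1)))); split.
- by rewrite mulr_ge0// !mulr_ge0.
- by rewrite mulr_ge0// !mulr_ge0.
- have l2 : l2_bounded (3 * expR 3 * (C * (C * C)))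
      (absconv (3 * expR 3) (compset (Ritt_set T) (compset (Ritt_set T) (Ritt_set T)))).
    apply: l2_bounded_absconv => //; first by rewrite !mulr_ge0.
      by do 2?apply: linset_comp.
    by do 2?apply: l2_bounded_comp.
  apply: l2_bounded_sub (l2_bounded_ptclosure l2) => S [n ->].
  exact: (power_ptclosure P0 TP RsP C0 RsC).
- have l2 : l2_bounded (3 * expR 3 * (C * (C * (C + 1))))
      (absconv (3 * expR 3) (compset (Ritt_set T) (compset (Ritt_set T) Fm))).
    apply: l2_bounded_absconv => //; first by rewrite !mulr_ge0.
      by do 2?apply: linset_comp.
    by do 2?apply: l2_bounded_comp => //; exact: l2_bounded_subid.
  apply: l2_bounded_sub (l2_bounded_ptclosure l2) => S [n ->].
  exact: (power_diff_ptclosure P0 TP RsP C0 RsC).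
Qed.

Lemma unconditional_square_function (C1 C2 : R) : 0 <= C1 -> 0 <= C2 ->
  l2_bounded C1 (powers T) -> l2_bounded C2 (power_diffs T) ->
  unconditional_Ritt T -> exists2 C : R, 0 <= C & square_function_estimate C T.
Proof.
move=> C10 C20 H1 H2 [K K0 HK].
have K20 : 0 <= 2 * K by exact: mulr_ge0.
exists (4 * (4 * (C1 * (C2 + C2 * C2))) * (9 * C1 * (2 * K))).
  by rewrite !mulr_ge0// addr_ge0// mulr_ge0.
apply/square_function_estimateP => N x.
apply: finite_square_function_estimate => // J y.
exact: sqn_dyadic_diff.
Qed.

End RittToSquareFunctions.

Lemma conj_exponentK (R : realType) (p : R) : 1 < p ->
  1 < conj_exponent p /\ p^-1 + (conj_exponent p)^-1 = 1.
Proof.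
move=> p1; have q0 : 0 < p - 1 by rewrite subr_gt0.
have p0 : 0 < p by apply: lt_trans p1.
split; first by rewrite /conj_exponent ltr_pdivlMr// mul1r gtrBl.
by rewrite /conj_exponent invf_div; field; rewrite gt_eqF.
Qed.

Theorem corollary4p3 (d : measure_display) (Omega : measurableType d)
    (R : realType) (mu : {measure set Omega -> \bar R})
    (p : R) (hp : 1 < p)
    (T : {linear Lp mu (ltW hp) -> Lp mu (ltW hp)})
    (hT : power_bounded T) :
  (R_Ritt T /\ unconditional_Ritt T) <->
  (exists2 C : R, 0 < C &
     square_function_estimate C T /\
     square_function_estimate C
       (adjoint (conj_exponent_ge1 hp) T)).
Proof.
have [qgt1 pq] := conj_exponentK hp.
set q1 := conj_exponent_ge1 hp; set S := adjoint q1 T.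
have lT : linear T by move=> a u v; rewrite linearP.
(* The constant in [power_bounded] carries no sign; its absolute value is also a bound. *)
have [P P0 TP] : exists2 P, 0 <= P & forall n, opnorm_le P (iter n T).
  case: hT => P TP; exists `|P| => // n x; apply: (le_trans (TP n x)).
  by rewrite ler_wpM2r ?rnorm_ge0// ler_norm.
have TS x y : Lp_pairing (T x) y = Lp_pairing x (S y) by apply: (adjointP _ _ lT P0 (TP 1%N)).
have lS : linear S := dual_linear qgt1 pq TS.
split.
- move=> [RT UT].
  have [C1 [C2 [C10 C20 H1 H2]]] := R_Ritt_l2_bounded P0 TP RT.
  have [C C0 HC] := unconditional_square_function lT C10 C20 H1 H2 UT.
  have [C' C'0 HC'] : exists2 C : R, 0 <= C & square_function_estimate C S.
    apply: (@unconditional_square_function _ _ _ _ _ _ S lS (2 * C1) (2 * C2)); rewrite ?mulr_ge0//.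
    - exact: (dual_powers qgt1 pq TS C10 H1).
    - exact: (dual_power_diffs qgt1 pq lT TS C20 H2).
    - exact: (dual_unconditional qgt1 pq TS UT).
  have mono (e : R) (e1 : 1 <= e) (V : Lp mu e1 -> Lp mu e1) (c c' : R) : c <= c' ->
      square_function_estimate c V -> square_function_estimate c' V.
    by move=> cc' HV x; apply: (le_trans (HV x)); rewrite lee_fin ler_wpM2r ?rnorm_ge0.
  (* A common constant for [T] and its adjoint; the added 1 makes it positive. *)
  exists (C + C' + 1); first by rewrite ltr_wpDl// addr_ge0.
  by split; [apply: mono HC|apply: mono HC']; lra.
move=> [C C0 [/square_function_estimateP HT /square_function_estimateP HS]].
have [M M0 HM] := second_differences mu (ltW hp) q1 hp pq.
have HK := HM _ _ _ _ lT lS (dual_iter TS) (ltW C0) (ltW C0) HT HS.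
have K0 : 0 <= M * C * C by rewrite !mulr_ge0// ltW.
split; first exact: R_Ritt_of_second_diff lT P0 TP K0 HK.
exact: unconditional_Ritt_of_second_diff P0 TP K0 HK.
Qed.
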